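(* For any two stellar sequences $\mathcal W$ and $\mathcal W'$, $\mathcal G(\mathcal W)\cong\mathcal G(\mathcal W')$ (as unital $\ell$-groups) if and only if there is a stellar sequence $\mathcal W''$ which is strongly equivalent to $\mathcal W$ and to $\mathcal W'$.
   Context: Unital $\ell$-groups. A unital $\ell$-group $(G,u)$ is an abelian group $G$ with a lattice structure such that $x+(y\vee z)=(x+y)\vee(x+z)$ for all $x,y,z$, together with a distinguished order-unit $u$, i.e. for every $g\in G$ there is an integer $k\ge 0$ with $g\le ku$. Unital $\ell$-homomorphisms are group homomorphisms preserving $\vee,\wedge$ and the order-unit; $\cong$ means there is a bijective one. An $\ell$-ideal is the kernel of a unital $\ell$-homomorphism. $\mathcal M([0,1]^n)$ is the unital $\ell$-group (pointwise operations, order-unit the constant $1$) of continuous piecewise linear functions $f\colon[0,1]^n\to\mathbb R$ with finitely many pieces, each piece affine with integer coefficients. For $f\in\mathcal M([0,1]^n)$ let $\mathcal Z(f)=f^{-1}(0)$. Confluence. A nonempty family $\mathcal P$ of subsets of a set $E$ is filtering if for all $X,Y\in\mathcal P$ there is $Z\in\mathcal P$ with $Z\subseteq X\cap Y$. For filtering families, $\mathcal P$ minorizes $\mathcal Q$ if for every $A\in\mathcal Q$ there is $B\in\mathcal P$ with $B\subseteq A$; $\mathcal P\uparrow\mathcal Q$ ($\mathcal P$ and $\mathcal Q$ are confluent) means each minorizes the other. Regular complexes. For a rational point $y\in\mathbb R^n$, $\mathrm{den}(y)$ is the least common denominator of its coordinates and $\tilde y=\mathrm{den}(y)(y,1)\in\mathbb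 Z^{n+1}$. A simplex $\mathrm{conv}(v_0,\dots,v_k)\subseteq\mathbb R^n$ with rational vertices is regular if $\{\tilde v_0,\dots,\tilde v_k\}$ is part of a basis of the free abelian group $\mathbb Z^{n+1}$. A regular complex $\Delta$ is a finite (geometric) simplicial complex all of whose simplexes are rational and regular; its support $|\Delta|$ is the union of its simplexes. The Farey mediant of a regular $1$-simplex $\mathrm{conv}(v_0,v_1)$ is the rational point $v$ of it with $\tilde v=\tilde v_0+\tilde v_1$. The blow-up $\Delta_{(p)}$ of $\Delta$ at $p\in|\Delta|$ is obtained by replacing every $T\in\Delta$ containing $p$ by all simplexes $\mathrm{conv}(F\cup\{p\})$, with $F$ a face of $T$ not containing $p$. Weighted complexes and stellar sequences. A weighted abstract simplicial complex is a triple $W=(\mathcal V,\Sigma,\omega)$ where $\mathcal V$ is a finite nonempty set (of vertices), $\Sigma$ is a collection of subsets of $\mathcal V$ with union $\mathcal V$ and closed under taking subsets, and $\omega\colon\mathcal V\to\{1,2,3,\dots\}$. For a two-element set $\{v,w\}\in\Sigma$ and $a\notin\mathcal V$, the binary subdivision $(\{v,w\},a)W$ is obtained by adding $a$ to the vertex set, replacing every set $\{v,w,u_1,\dots,u_t\}\in\Sigma$ by the two sets $\{v,a,u_1,\dots,u_t\}$, $\{a,w,u_1,\dots,u_t\}$ and their faces, and extending the weight by $\omega(a)=\omega(v)+\omega(w)$. A sequence $\mathcal W=(W_0,W_1,\dots)$ of weighted abstract simplicial complexes is stellar if each $W_{j+1}$ is obtained from $W_j$ either by deleting a maximal set of $W_j$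 (if this set is a singleton $\{v\}$, the vertex $v$ is removed too), or by a binary subdivision, or else $W_{j+1}=W_j$. Construction of $\mathcal G(\mathcal W)$. A $\nabla$-realization of $W=(\mathcal V,\Sigma,\omega)$, for $\nabla$ a regular complex, is a bijection $\iota$ from $\mathcal V$ onto the set of vertices of $\nabla$ such that $\mathrm{den}(\iota(v))=\omega(v)$ for all $v$, and $\{w_1,\dots,w_k\}\in\Sigma$ iff $\mathrm{conv}(\iota(w_1),\dots,\iota(w_k))\in\nabla$; one writes $\iota\colon W\to\nabla$. Given a stellar sequence $\mathcal W$ and a $\Delta_0$-realization $\iota_0$ of $W_0$ with $|\Delta_0|\subseteq[0,1]^n$, define inductively $\Delta_j$-realizations $\iota_j$ of $W_j$: if $W_{j+1}$ is obtained by deleting the maximal set $M$, then $\Delta_{j+1}$ is $\Delta_j$ with the simplex $\mathrm{conv}(\iota_j(M))$ deleted and $\iota_{j+1}$ is the restriction of $\iota_j$; if $W_{j+1}=(\{a,b\},c)W_j$, then $\Delta_{j+1}=(\Delta_j)_{(e)}$ with $e$ the Farey mediant of $\mathrm{conv}(\iota_j(a),\iota_j(b))$, and $\iota_{j+1}=\iota_j\cup\{(c,e)\}$; if $W_{j+1}=W_j$ then $\Delta_{j+1}=\Delta_j$, $\iota_{j+1}=\iota_j$. The $\Delta_0$-orbit (depending on $\iota_0$) is $\mathcal O(\mathcal W,\Delta_0)=\{|\Delta_0|\supseteq|\Delta_1|\supseteq\cdots\}$; $\mathcal I(\mathcal W,\Delta_0)=\{f\in\mathcal M([0,1]^n)\mid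 \mathcal Z(f)\supseteq|\Delta_j|\text{ for some }j\}$, an $\ell$-ideal; and $\mathcal G(\mathcal W,\Delta_0)=\mathcal M([0,1]^n)/\mathcal I(\mathcal W,\Delta_0)$. The canonical realization of $W_0$ with vertices $v_1,\dots,v_n$ sends $v_i$ to $e_i/\omega(v_i)$ ($e_i$ the standard basis vectors of $\mathbb R^n$), and its regular complex $\Delta_{W_0}$ consists of the simplexes spanned by the images of the sets in $\Sigma$. $\mathcal G(\mathcal W)$ denotes $\mathcal G(\mathcal W,\Delta_{W_0})$. Strong equivalence. Two stellar sequences $\mathcal W=W_0,W_1,\dots$ and $\mathcal W'=W_0',W_1',\dots$ are strongly equivalent if there are realizations $\rho\colon W_0\to\nabla_0$ and $\rho'\colon W_0'\to\nabla_0'$ in the same $d$-cube (i.e. $|\nabla_0|,|\nabla_0'|\subseteq[0,1]^d$ for some $d$) whose orbits are confluent: $\mathcal O(\mathcal W,\nabla_0)\uparrow\mathcal O(\mathcal W',\nabla_0')$. *)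

(* Defs.v *)
From HB Require Import structures.
From mathcomp Require Import all_boot all_order all_algebra.
From mathcomp Require Import finmap.
From mathcomp Require Import all_classical reals topology normedtype.

Set Implicit Arguments.
Unset Strict Implicit.
Unset Printing Implicit Defensive.

Import Order.TTheory GRing.Theory Num.Theory.
Import numFieldNormedType.Exports.

Local Open Scope classical_set_scope.
Local Open Scope ring_scope.

(* The lattice structure is given algebraically, by its two operations, and
   x <= y reads [lmeet x y = x].  [Order.Lattice] cannot be used here, since
   Hierarchy Builder admits no join of it with [GRing.Zmodule] below
   [Num.RealDomain]. *)
HB.mixin Record Zmodule_isUnitalLGroup G of GRing.Zmodule G := {
  ljoin : G -> G -> G;
  lmeet : G -> G -> G;
  ljoinC : commutative ljoin;
  lmeetC : commutative lmeet;
  ljoinA : associative ljoin;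
  lmeetA : associative lmeet;
  ljoinKI : forall y x, lmeet x (ljoin x y) = x;
  lmeetKU : forall y x, ljoin x (lmeet x y) = x;
  laddUr : forall x y z, x + ljoin y z = ljoin (x + y) (x + z);
  lunit : G;
  lunit_order : forall g, exists k : nat, lmeet g (lunit *+ k) = g
}.

#[short(type="unitalLGroupType")]
HB.structure Definition UnitalLGroup :=
  { G of GRing.Zmodule G & Zmodule_isUnitalLGroup G }.

Arguments lunit {s}.

Section UnitalLHom.
Variables (G H : unitalLGroupType).

Definition unital_lhom (h : G -> H) : Prop :=
  [/\ {morph h : x y / x + y},
      {morph h : x y / ljoin x y},
      {morph h : x y / lmeet x y} &
      h lunit = lunit].

Definition unital_liso : Prop :=
  exists h : G -> H, unital_lhom h /\ bijective h.

End UnitalLHom.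

(* A subset is the kernel of a unital l-homomorphism exactly when it is a
   subgroup whose associated congruence is compatible with join and meet;
   see [lquot_proj_hom] and [lquot_proj_ker]. *)
HB.mixin Record isLCongruence (G : unitalLGroupType)
    (I : {pred G}) := {
  lideal_joinl : forall x y z : G, x - y \in I ->
    ljoin x z - ljoin y z \in I;
  lideal_meetl : forall x y z : G, x - y \in I ->
    lmeet x z - lmeet y z \in I
}.

#[short(type="lIdeal")]
HB.structure Definition LIdeal (G : unitalLGroupType) :=
  { I of GRing.ZmodClosed G I & isLCongruence G I }.

Definition lquot (G : unitalLGroupType) (I : lIdeal G)
  : Type := Quotient.quot (I : zmodClosed G).

Section LQuotient.
Local Open Scope quotient_scope.
Variables (G : unitalLGroupType) (I : lIdeal G).

HB.instance Definition _ := GRing.Zmodule.on (lquot I).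
HB.instance Definition _ := Quotient.on (lquot I).

Local Notation Q := (lquot I).
Implicit Types x y z : Q.

Definition lquot_proj (g : G) : Q := \pi_Q g.

Definition lquot_join x y : Q := lquot_proj (ljoin (repr x) (repr y)).
Definition lquot_meet x y : Q := lquot_proj (lmeet (repr x) (repr y)).

Lemma lquot_projE (a b : G) : (lquot_proj a = lquot_proj b) <-> (a - b \in I).
Proof.
rewrite (Quotient.idealrBE (I : zmodClosed G)).
by split => [/eqP|/eqP].
Qed.

Lemma lquot_projK x : lquot_proj (repr x) = x.
Proof. exact: reprK. Qed.

Lemma lquot_projD (a b : G) :
  lquot_proj (a + b) = lquot_proj a + lquot_proj b.
Proof. exact: (Quotient.pi_add (I : zmodClosed G)). Qed.

Lemma repr_lquot_proj (a : G) : repr (lquot_proj a) - a \in I.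
Proof. by apply/lquot_projE; rewrite lquot_projK. Qed.

Lemma lquot_projU (a b : G) :
  lquot_proj (ljoin a b) = lquot_join (lquot_proj a) (lquot_proj b).
Proof.
apply/esym; transitivity (lquot_proj (ljoin a (repr (lquot_proj b)))).
  apply/lquot_projE; exact/lideal_joinl/repr_lquot_proj.
apply/lquot_projE; rewrite ![ljoin a _]ljoinC.
exact/lideal_joinl/repr_lquot_proj.
Qed.

Lemma lquot_projI (a b : G) :
  lquot_proj (lmeet a b) = lquot_meet (lquot_proj a) (lquot_proj b).
Proof.
apply/esym; transitivity (lquot_proj (lmeet a (repr (lquot_proj b)))).
  apply/lquot_projE; exact/lideal_meetl/repr_lquot_proj.
apply/lquot_projE; rewrite ![lmeet a _]lmeetC.
exact/lideal_meetl/repr_lquot_proj.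
Qed.

Lemma lquot_ind (P : Q -> Prop) : (forall a, P (lquot_proj a)) -> forall x, P x.
Proof. by move=> Pa x; rewrite -[x]lquot_projK. Qed.

Let joinqC : commutative lquot_join.
Proof.
by elim/lquot_ind=> a; elim/lquot_ind=> b; rewrite -!lquot_projU ljoinC.
Qed.
Let meetqC : commutative lquot_meet.
Proof.
by elim/lquot_ind=> a; elim/lquot_ind=> b; rewrite -!lquot_projI lmeetC.
Qed.
Let joinqA : associative lquot_join.
Proof.
elim/lquot_ind=> a; elim/lquot_ind=> b; elim/lquot_ind=> c.
by rewrite -!lquot_projU ljoinA.
Qed.
Let meetqA : associative lquot_meet.
Proof.
elim/lquot_ind=> a; elim/lquot_ind=> b; elim/lquot_ind=> c.
by rewrite -!lquot_projI lmeetA.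
Qed.
Let joinqKI y x : lquot_meet x (lquot_join x y) = x.
Proof.
elim/lquot_ind: y => b; elim/lquot_ind: x => a.
by rewrite -lquot_projU -lquot_projI ljoinKI.
Qed.
Let meetqKU y x : lquot_join x (lquot_meet x y) = x.
Proof.
elim/lquot_ind: y => b; elim/lquot_ind: x => a.
by rewrite -lquot_projI -lquot_projU lmeetKU.
Qed.

Let addqUr x y z : x + lquot_join y z = lquot_join (x + y) (x + z).
Proof.
elim/lquot_ind: x => a; elim/lquot_ind: y => b; elim/lquot_ind: z => c.
by rewrite -lquot_projU -!lquot_projD -lquot_projU laddUr.
Qed.

Let lquot_projMn (a : G) k : lquot_proj (a *+ k) = lquot_proj a *+ k.
Proof.
elim: k => [|k IH]; last by rewrite !mulrS lquot_projD IH.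
rewrite !mulr0n; apply: (addrI (lquot_proj 0)).
by rewrite -lquot_projD !addr0.
Qed.

Let unitq_order x :
  exists k : nat, lquot_meet x (lquot_proj lunit *+ k) = x.
Proof.
elim/lquot_ind: x => a; have [k ak] := lunit_order a; exists k.
by rewrite -lquot_projMn -lquot_projI ak.
Qed.

HB.instance Definition _ := Zmodule_isUnitalLGroup.Build Q
  joinqC meetqC joinqA meetqA joinqKI meetqKU addqUr unitq_order.

Lemma lquot_proj_hom : unital_lhom lquot_proj.
Proof.
by split=> [a b|a b|a b|] //; [exact: lquot_projD|exact: lquot_projU
  |exact: lquot_projI].
Qed.

Lemma lquot_proj_ker (a : G) : lquot_proj a = 0 <-> a \in I.
Proof.
have <- : lquot_proj 0 = 0.
  by apply: (addrI (lquot_proj 0)); rewrite -lquot_projD !addr0.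
by rewrite lquot_projE subr0.
Qed.

End LQuotient.

Section McNaughton.
Variables (R : realType) (n : nat).

Definition cube : set 'rV[R]_n := [set x | forall i, 0 <= x 0 i <= 1].

Definition int_affine (p : int * 'rV[int]_n) (x : 'rV[R]_n) : R :=
  p.1%:~R + \sum_(i < n) (p.2 0 i)%:~R * x 0 i.

Definition int_piecewise (f : cube -> R) : Prop :=
  exists s : seq (int * 'rV[int]_n),
    forall x : cube, exists2 p, p \in s & f x = int_affine p (val x).

(* [cube] carries the topology induced from that of R^n. *)
Definition mcNaughton_pred : {pred cube -> R} :=
  [pred f : cube -> R | `[< continuous f /\ int_piecewise f >]].

Lemma mcNaughtonP (f : cube -> R) :
  (f \in mcNaughton_pred) <-> (continuous f /\ int_piecewise f).
Proof. by split => [/asboolP|h]; last exact/asboolP. Qed.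

Let mcN_zmod : zmod_closed mcNaughton_pred.
Proof.
split.
  apply/mcNaughtonP; split; first by move=> x; exact: cst_continuous.
  exists [:: (0, 0)] => x; exists (0, 0); rewrite ?inE //.
  rewrite /int_affine /= add0r big1 // => i _.
  by rewrite mxE mul0r.
move=> f g /mcNaughtonP[cf [s sf]] /mcNaughtonP[cg [t tg]].
apply/mcNaughtonP; split.
  by move=> x; apply: (@continuousB R R^o); [exact: cf|exact: cg].
exists [seq (p.1 - q.1, p.2 - q.2) | p <- s, q <- t] => x.
have [p ps fp] := sf x; have [q qt gq] := tg x.
exists (p.1 - q.1, p.2 - q.2); first exact: allpairs_f.
rewrite (_ : (f - g) x = f x - g x) // fp gq /int_affine /=.
rewrite intrB opprD addrACA -sumrB; congr (_ + _).
by apply: eq_bigr => i _; rewrite !mxE intrB mulrBl.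
Qed.

HB.instance Definition _ :=
  GRing.isZmodClosed.Build (cube -> R) mcNaughton_pred mcN_zmod.

Let mcN_max (f g : cube -> R) : f \in mcNaughton_pred ->
  g \in mcNaughton_pred -> f \max g \in mcNaughton_pred.
Proof.
move=> /mcNaughtonP[cf [s sf]] /mcNaughtonP[cg [t tg]].
apply/mcNaughtonP; split.
  by move=> x; apply: continuous_max; [exact: cf|exact: cg].
exists (s ++ t) => x /=.
have [p ps fp] := sf x; have [q qt gq] := tg x.
rewrite maxEle; case: ifP => _.
  by exists q; rewrite // mem_cat qt orbT.
by exists p; rewrite // mem_cat ps.
Qed.

Let mcN_min (f g : cube -> R) : f \in mcNaughton_pred ->
  g \in mcNaughton_pred -> f \min g \in mcNaughton_pred.
Proof.
move=> /mcNaughtonP[cf [s sf]] /mcNaughtonP[cg [t tg]].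
apply/mcNaughtonP; split.
  by move=> x; apply: continuous_min; [exact: cf|exact: cg].
exists (s ++ t) => x /=.
have [p ps fp] := sf x; have [q qt gq] := tg x.
rewrite minEle; case: ifP => _.
  by exists p; rewrite // mem_cat ps.
by exists q; rewrite // mem_cat qt orbT.
Qed.

Let mcN_cst1 : (fun=> 1 : R) \in mcNaughton_pred.
Proof.
apply/mcNaughtonP; split; first by move=> x; exact: cst_continuous.
exists [:: (1, 0)] => x; exists (1, 0); rewrite ?inE //.
by rewrite /int_affine /= big1 ?addr0 // => i _; rewrite mxE mul0r.
Qed.

(* The elements of M([0,1]^n), as functions defined on the cube only. *)
Record mcNaughton : Type := McNaughton {
  mcN_fun :> cube -> R;
  mcNP : mcN_fun \in mcNaughton_pred
}.

HB.instance Definition _ := [isSub for mcN_fun].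
HB.instance Definition _ := [Choice of mcNaughton by <:].
HB.instance Definition _ := [SubChoice_isSubZmodule of mcNaughton by <:].

Implicit Types f g h : mcNaughton.

Definition mcN_join f g : mcNaughton := McNaughton (mcN_max (mcNP f) (mcNP g)).
Definition mcN_meet f g : mcNaughton := McNaughton (mcN_min (mcNP f) (mcNP g)).
Definition mcN_one : mcNaughton := McNaughton mcN_cst1.

Lemma mcN_ext f g : (forall x, f x = g x) -> f = g.
Proof. by move=> fg; apply/val_inj/funext. Qed.

Let mcN_joinC : commutative mcN_join.
Proof. by move=> f g; apply: mcN_ext => x /=; rewrite maxC. Qed.
Let mcN_meetC : commutative mcN_meet.
Proof. by move=> f g; apply: mcN_ext => x /=; rewrite minC. Qed.
Let mcN_joinA : associative mcN_join.
Proof. by move=> f g h; apply: mcN_ext => x /=; rewrite maxA. Qed.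
Let mcN_meetA : associative mcN_meet.
Proof. by move=> f g h; apply: mcN_ext => x /=; rewrite minA. Qed.
Let mcN_joinKI g f : mcN_meet f (mcN_join f g) = f.
Proof. by apply: mcN_ext => x /=; rewrite minEle le_max lexx. Qed.
Let mcN_meetKU g f : mcN_join f (mcN_meet f g) = f.
Proof. by apply: mcN_ext => x /=; rewrite maxEge ge_min lexx. Qed.
Let mcN_addUr f g h : f + mcN_join g h = mcN_join (f + g) (f + h).
Proof. by apply: mcN_ext => x; rewrite /= -addr_maxr. Qed.

Let mcN_one_order f : exists k : nat, mcN_meet f (mcN_one *+ k) = f.
Proof.
have [_ [s sf]] := (mcNaughtonP f).1 (mcNP f).
pose B (p : int * 'rV[int]_n) : nat := (`|p.1| + \sum_(i < n) `|p.2 0%R i|)%N.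
exists (\sum_(p <- s) B p)%N; apply: mcN_ext => x /=.
have [p ps ->] := sf x.
have -> : (mcN_one *+ (\sum_(p <- s) B p)%N) x = (\sum_(p <- s) B p)%:R.
  elim: (\sum_(p <- s) B p)%N => [|k IH]; first by rewrite mulr0n.
  by rewrite !mulrSr -IH.
apply/min_idPl; apply: (@le_trans _ _ ((B p)%:R : R)); last first.
  by rewrite ler_nat (big_rem p) //= leq_addr.
rewrite /int_affine natrD natr_sum; apply: lerD.
  by rewrite natr_absz ler_int ler_norm.
apply: ler_sum => i _; have /andP[x0 x1] : 0 <= val x 0 i <= 1.
  by have := set_mem (valP x); apply.
apply: (@le_trans _ _ (`|p.2 0 i|%:~R * val x 0 i)).
  by rewrite ler_wpM2r // ler_int ler_norm.
by rewrite natr_absz ler_piMr // ler0z.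
Qed.

HB.instance Definition _ := Zmodule_isUnitalLGroup.Build mcNaughton
  mcN_joinC mcN_meetC mcN_joinA mcN_meetA mcN_joinKI mcN_meetKU
  mcN_addUr mcN_one_order.

End McNaughton.

Arguments cube R n : clear implicits.
Arguments mcNaughton R n : clear implicits.

(* Rational points of R^n are elements of 'rV[rat]_n, embedded in R^n by
   [map_mx ratr]. *)

Section RationalPoints.
Variable n : nat.
Implicit Types y : 'rV[rat]_n.

Definition den y : nat := \big[lcmn/1%N]_(i < n) `|denq (y 0%R i)|%N.

(* The entries of den(y)(y,1) are integers, on which [numq] is the identity. *)
Definition homog y : 'rV[int]_(n + 1) :=
  map_mx numq ((den y)%:R *: row_mx y 1%:M).

(* Bases of Z^(n+1) are the families of rows of invertible integer matrices.
   A regular family of vertices is affinely independent. *)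
Definition regular_simplex (S : {fset 'rV[rat]_n}) : Prop :=
  exists2 B : 'M[int]_(n + 1), B \in unitmx &
    forall v, v \in S -> exists i, row i B = homog v.

End RationalPoints.

Section RegularComplexes.
Variables (R : realType) (n : nat).
Implicit Types (S F : {fset 'rV[rat]_n}) (D : {fset {fset 'rV[rat]_n}}).

Definition conv S : set 'rV[R]_n :=
  [set x | exists a : 'rV[rat]_n -> R,
    [/\ forall v, v \in S -> 0 <= a v,
        \sum_(v <- S) a v = 1 &
        x = \sum_(v <- S) a v *: map_mx ratr v]].

(* A complex is given by the vertex sets of its simplexes, the empty simplex
   being one of them.  Faces of conv(S) are the conv(F) with F a subset of S,
   and two simplexes meet in a common (possibly empty) face. *)
Definition regular_complex D : Prop :=
  [/\ forall S, S \in D -> regular_simplex S,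
      forall S F, S \in D -> (F `<=` S)%fset -> F \in D &
      forall S F, S \in D -> F \in D ->
        conv S `&` conv F = conv (S `&` F)%fset].

Definition complex_vertices D : {fset 'rV[rat]_n} := fcover D.

Definition support D : set 'rV[R]_n :=
  [set x | exists2 S, S \in D & conv S x].

Definition farey_mediant (v w : 'rV[rat]_n) : 'rV[rat]_n :=
  xget 0 [set e | conv [fset v; w]%fset (map_mx ratr e) /\
                  homog e = homog v + homog w].

Definition blowup D (p : 'rV[rat]_n) : {fset {fset 'rV[rat]_n}} :=
  ([fset S in D | map_mx ratr p \notin conv S] `|`
   \bigcup_(S <- D | map_mx ratr p \in conv S)
     [fset (p |` F) | F in fpowerset S & map_mx ratr p \notin conv F])%fset.

End RegularComplexes.

Arguments conv R {n} S.
Arguments regular_complex R {n} D.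
Arguments support R {n} D.
Arguments farey_mediant R {n} v w.
Arguments blowup R {n} D p.

Section ConvexHulls.
Variables (R : realType) (n : nat).

Lemma conv_subset (S F : {fset 'rV[rat]_n}) (p : 'rV[rat]_n) :
  (F `<=` S)%fset -> conv R S (map_mx ratr p) ->
  conv R (p |` F)%fset `<=` conv R S.
Proof.
move=> FS [b [b0 b1 pE]] x [a [a0 a1 xE]].
have GS : (F `\ p `<=` S)%fset by apply: fsubset_trans FS; exact: fsubD1set.
have sub (V : nmodType) (g : 'rV[rat]_n -> V) :
    \sum_(v <- S) (if v \in (F `\ p)%fset then g v else 0)
    = \sum_(v <- (F `\ p)%fset) g v.
  rewrite -(big_fset_incl _ GS); last by move=> v _ /negbTE ->.
  by rewrite big_seq [RHS]big_seq; apply: eq_bigr => v ->.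
have D1 (V : nmodType) (g : 'rV[rat]_n -> V) :
    \sum_(v <- (p |` F)%fset) g v = g p + \sum_(v <- (F `\ p)%fset) g v.
  rewrite (big_fsetD1 p) ?fset1U1 //; congr (_ + _).
  by apply: eq_fbigl => v; rewrite !inE; case: eqP.
exists (fun v => (if v \in (F `\ p)%fset then a v else 0) + a p * b v); split.
- move=> v vS; apply: addr_ge0; last first.
    by rewrite mulr_ge0 ?b0 // a0 // fset1U1.
  by case: ifP => // /fsetD1P[_ vF]; rewrite a0 // fset1Ur.
- by rewrite big_split /= sub -mulr_sumr b1 mulr1 addrC -D1.
rewrite xE D1 pE scaler_sumr -sub -big_split /=.
apply: eq_bigr => v _; rewrite scalerDl scalerA addrC.
by case: ifP => // _; rewrite scale0r.
Qed.

Lemma support_blowup (D : {fset {fset 'rV[rat]_n}}) (p : 'rV[rat]_n) :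
  support R (blowup R D p) `<=` support R D.
Proof.
move=> x [S]; rewrite /blowup in_fsetU => /orP[].
  by rewrite in_fset => /andP[SD _] Sx; exists S.
move=> /bigfcupP[S' /andP[S'D pS'] /imfsetP[F /= FP ->]] Fx; exists S' => //.
case: (andP FP); rewrite fpowersetE => FS' _.
by apply: conv_subset Fx => //; exact: set_mem.
Qed.

End ConvexHulls.

(* The vertex set is the domain of the weight. *)
Record wcomplex (T : choiceType) := WComplex {
  wfaces : {fset {fset T}};
  weight : {fmap T -> nat}
}.

Section Stellar.
Variable T : choiceType.
Implicit Types (W : wcomplex T) (M : {fset T}).

Definition wvertices W : {fset T} := domf (weight W).

Definition wt W (v : T) : nat := odflt 0%N (weight W).[? v]%fmap.

Definition is_wcomplex W : Prop :=
  [/\ wvertices W != fset0,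
      fcover (wfaces W) = wvertices W,
      forall S F, S \in wfaces W -> (F `<=` S)%fset -> F \in wfaces W &
      forall v, v \in wvertices W -> (0 < wt W v)%N].

Inductive step :=
| Delete of {fset T}
| Subdivide of T & T & T
| Stay.

HB.instance Definition _ := gen_eqMixin step.
HB.instance Definition _ := gen_choiceMixin step.

Definition deletion W M : wcomplex T :=
  WComplex (wfaces W `\ M)%fset
    (if #|` M| == 1%N then (weight W).[\ M]%fmap else weight W).

Definition binary_subdivision W (v w a : T) : wcomplex T :=
  WComplex
    ([fset S in wfaces W | ~~ ([fset v; w] `<=` S)] `|`
     \bigcup_(S <- wfaces W | [fset v; w] `<=` S)
       (fpowerset (a |` (S `\ w)) `|` fpowerset (a |` (S `\ v))))%fset
    (weight W).[a <- (wt W v + wt W w)%N]%fmap.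

Definition apply_step W (s : step) : wcomplex T :=
  match s with
  | Delete M => deletion W M
  | Subdivide v w a => binary_subdivision W v w a
  | Stay => W
  end.

Definition maximal_face W M : Prop :=
  M \in wfaces W /\ forall S, S \in wfaces W -> (M `<=` S)%fset -> S = M.

Definition valid_step W (s : step) : Prop :=
  match s with
  | Delete M => maximal_face W M
  | Subdivide v w a =>
      [/\ v != w, [fset v; w]%fset \in wfaces W & a \notin wvertices W]
  | Stay => True
  end.

Definition is_step W W' (s : step) : Prop :=
  valid_step W s /\ W' = apply_step W s.

Definition stellar (W : nat -> wcomplex T) : Prop :=
  (forall j, is_wcomplex (W j)) /\
  (forall j, exists s, is_step (W j) (W j.+1) s).

(* The step is determined by W and W', up to exchanging v and w in
   [Subdivide v w a]. *)
Definition step_of W W' : step := xget Stay [set s | is_step W W' s].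

End Stellar.

Arguments Stay {T}.

Section Realizations.
Variables (R : realType) (T : choiceType) (n : nat).
Implicit Types (W : nat -> wcomplex T) (D : {fset {fset 'rV[rat]_n}}).
Implicit Types (io : T -> 'rV[rat]_n).

(* Only the values of a realization on the vertices matter. *)
Definition realization (W0 : wcomplex T) D io : Prop :=
  [/\ regular_complex R D,
      {in wvertices W0 &, injective io},
      (io @` wvertices W0)%fset = complex_vertices D,
      forall v, v \in wvertices W0 -> den (io v) = wt W0 v &
      forall S, (S `<=` wvertices W0)%fset ->
        (S \in wfaces W0) = ((io @` S)%fset \in D)].

Definition geometric_step (c : {fset {fset 'rV[rat]_n}} * (T -> 'rV[rat]_n))
    (s : step T) : {fset {fset 'rV[rat]_n}} * (T -> 'rV[rat]_n) :=
  match s with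
  | Delete M => ((c.1 `\ (c.2 @` M))%fset, c.2)
  | Subdivide a b x =>
      let e := farey_mediant R (c.2 a) (c.2 b) in
      (blowup R c.1 e, fun t => if t == x then e else c.2 t)
  | Stay => c
  end.

(* (Delta_j, iota_j) *)
Fixpoint realization_at W D io (j : nat)
    : {fset {fset 'rV[rat]_n}} * (T -> 'rV[rat]_n) :=
  if j is j'.+1 then
    geometric_step (realization_at W D io j') (step_of (W j') (W j'.+1))
  else (D, io).

Definition orbit_support W D io j : set 'rV[R]_n :=
  support R (realization_at W D io j).1.

Definition orbit W D io : set (set 'rV[R]_n) := range (orbit_support W D io).

Lemma orbit_supportS W D io j :
  orbit_support W D io j.+1 `<=` orbit_support W D io j.
Proof.
rewrite /orbit_support /=; case: step_of => [M|a b c|] //=.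
  by move=> x [S /fsetD1P[_ SD] Sx]; exists S.
exact: support_blowup.
Qed.

Lemma orbit_support_le W D io i j : (i <= j)%N ->
  orbit_support W D io j `<=` orbit_support W D io i.
Proof.
move=> /subnK <-; elim: (j - i)%N => // k IH.
by rewrite addSn; apply: subset_trans IH; exact: orbit_supportS.
Qed.

Definition zeroset (f : mcNaughton R n) : set (cube R n) :=
  [set x | f x = 0].

(* As |Delta_j| is contained in the cube, its inclusion in the zeroset of f
   can be tested on the points of the cube. *)
Definition orbit_ideal W D io : {pred mcNaughton R n} :=
  [pred f : mcNaughton R n |
    `[< exists j, set_val @^-1` orbit_support W D io j `<=` zeroset f >]].

Lemma orbit_idealP W D io (f : mcNaughton R n) :
  f \in orbit_ideal W D io <->
  exists j, forall x : cube R n, orbit_support W D io j (set_val x) -> f x = 0.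
Proof. by split => [/asboolP|h]; last exact/asboolP. Qed.

Lemma orbit_ideal_zmod W D io : zmod_closed (orbit_ideal W D io).
Proof.
split; first by apply/orbit_idealP; exists 0%N.
move=> f g /orbit_idealP[i fi] /orbit_idealP[j gj].
apply/orbit_idealP; exists (maxn i j) => x xij.
rewrite (_ : (f - g) x = f x - g x) // fi ?gj ?subrr //.
  exact: orbit_support_le (leq_maxr i j) _ xij.
exact: orbit_support_le (leq_maxl i j) _ xij.
Qed.

HB.instance Definition _ W D io := GRing.isZmodClosed.Build
  (mcNaughton R n) (orbit_ideal W D io) (orbit_ideal_zmod W D io).

Lemma orbit_ideal_joinl W D io (f g h : mcNaughton R n) :
  f - g \in orbit_ideal W D io ->
  ljoin f h - ljoin g h \in orbit_ideal W D io.
Proof.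
move=> /orbit_idealP[j fg]; apply/orbit_idealP; exists j => x /fg /eqP.
rewrite (_ : (f - g) x = f x - g x) // subr_eq0 => /eqP E.
apply/eqP; rewrite (_ : _ x = Num.max (f x) (h x) - Num.max (g x) (h x)) //.
by rewrite E subrr.
Qed.

Lemma orbit_ideal_meetl W D io (f g h : mcNaughton R n) :
  f - g \in orbit_ideal W D io ->
  lmeet f h - lmeet g h \in orbit_ideal W D io.
Proof.
move=> /orbit_idealP[j fg]; apply/orbit_idealP; exists j => x /fg /eqP.
rewrite (_ : (f - g) x = f x - g x) // subr_eq0 => /eqP E.
apply/eqP; rewrite (_ : _ x = Num.min (f x) (h x) - Num.min (g x) (h x)) //.
by rewrite E subrr.
Qed.

HB.instance Definition _ W D io := isLCongruence.Build
  (mcNaughton R n) (orbit_ideal W D io)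
  (@orbit_ideal_joinl W D io) (@orbit_ideal_meetl W D io).

Definition stellar_group_of W D io : unitalLGroupType :=
  lquot (orbit_ideal W D io : lIdeal (mcNaughton R n)).

End Realizations.

Arguments realization R {T n} W0 D io.
Arguments orbit_support R {T n} W D io j.
Arguments orbit R {T n} W D io.
Arguments stellar_group_of R {T n} W D io.

Section CanonicalRealization.
Variables (T : choiceType) (W0 : wcomplex T).

Local Notation n := #|` wvertices W0|.

(* v_1, ..., v_n is the enumeration of the vertices provided by finmap. *)
Definition canonical_map (v : T) : 'rV[rat]_n :=
  \row_(i < n)
    (if i == index v (wvertices W0) :> nat then (wt W0 v)%:R^-1 else 0).

Definition canonical_complex : {fset {fset 'rV[rat]_n}} :=
  [fset (canonical_map @` (S : {fset T}))%fset | S in wfaces W0]%fset.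

End CanonicalRealization.

Definition stellar_group (R : realType) (T : choiceType)
    (W : nat -> wcomplex T) : unitalLGroupType :=
  stellar_group_of R W (canonical_complex (W 0%N)) (canonical_map (W 0%N)).

Section Confluence.
Variable E : Type.
Implicit Types P Q : set (set E).

Definition filtering P : Prop :=
  P !=set0 /\
  forall X Y, P X -> P Y -> exists Z, P Z /\ Z `<=` X `&` Y.

Definition minorizes P Q : Prop :=
  forall A, Q A -> exists B, P B /\ B `<=` A.

Definition confluent P Q : Prop := minorizes P Q /\ minorizes Q P.

End Confluence.

Lemma orbit_filtering (R : realType) (T : choiceType) (n : nat)
    (W : nat -> wcomplex T) (D : {fset {fset 'rV[rat]_n}})
    (io : T -> 'rV[rat]_n) : filtering (orbit R W D io).
Proof.
split; first by exists (orbit_support R W D io 0%N), 0%N.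
move=> _ _ [i _ <-] [j _ <-].
exists (orbit_support R W D io (maxn i j)); split; first by exists (maxn i j).
move=> x xij; split.
  exact: orbit_support_le (leq_maxl i j) _ xij.
exact: orbit_support_le (leq_maxr i j) _ xij.
Qed.

Definition strongly_equivalent (R : realType) (T T' : choiceType)
    (W : nat -> wcomplex T) (W' : nat -> wcomplex T') : Prop :=
  exists (d : nat)
    (D : {fset {fset 'rV[rat]_d}}) (rho : T -> 'rV[rat]_d)
    (D' : {fset {fset 'rV[rat]_d}}) (rho' : T' -> 'rV[rat]_d),
    [/\ realization R (W 0%N) D rho,
        realization R (W' 0%N) D' rho',
        support R D `<=` cube R d,
        support R D' `<=` cube R d &
        confluent (orbit R W D rho) (orbit R W' D' rho')].

(* Main.v *)
(* Regularity makes each simplex conv(v_0, ..., v_k) the trace of a simplicial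
   cone with integer coordinates along the vectors den(v_i)(v_i, 1), and the
   Farey mediant is the sum of two such vectors.  Hence a map which is affine
   with integer coefficients on each simplex, and preserves denominators,
   carries the orbit of one realization to the orbit of another one.

   From the canonical realization to any other one such a map is even linear,
   and its inverse, made of hat functions, extends to the cube.  So the group of
   a stellar sequence does not depend on the realization, and confluent orbits
   define the same ideal: strong equivalence implies isomorphism.

   Conversely an isomorphism is composition with tuples g, h of McNaughton
   functions which are mutually inverse on some terms of the two orbits.  Blowing
   up Farey mediants makes finitely many integer forms of constant sign on each
   simplex.  Applied to the differences of the linear pieces of g and h, this
   gives a triangulation of a term of the orbit of W' on which g is a simplicial
   isomorphism preserving denominators; applied to the faces of the following
   terms, it turns each of them into a subcomplex, reached by deletions.  The
   stellar sequence W'' obtained in this way has one realization confluent with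
   W', and its image by g is confluent with W. *)
From mathcomp Require Import all_boot all_order all_algebra.
From mathcomp Require Import finmap.
From mathcomp Require Import all_classical reals topology normedtype.
From mathcomp Require Import ring lra.
Require Import Defs.

Set Implicit Arguments.
Unset Strict Implicit.
Unset Printing Implicit Defensive.

Import Order.TTheory GRing.Theory Num.Theory.
Import numFieldNormedType.Exports.

Local Open Scope ring_scope.

(** * Homogeneous coordinates and regular simplexes *)

(** Everything is carried out in homogeneous coordinates, where regularity is the existence of dual
    integer covectors ([dual_covectors]). Unlike a completion to a basis, these are written down
    explicitly for a blow-up and for the image of a simplex under an integer map. Being a complex
    then amounts to uniqueness of coordinates across simplexes.

    The images of the coordinate functions determine an isomorphism only on the l-group which they
    generate with the unit. Every McNaughton function agrees with a generated one on the support of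
    a complex. To use this behind the isomorphism, the tuple must map some term of one orbit into
    the initial support of the other, which follows from a generated function vanishing exactly on
    that support.

    The subdivisions of [W'] may be incompatible with the triangulation on which [g] is simplicial.
    So only the supports of its later terms are kept, and new subdivisions and deletions are
    inserted to reach them: finitely many between two terms, and these finite paths are
    concatenated. *)

Section Homogeneous.
Variable n : nat.
Implicit Types (y v : 'rV[rat]_n) (S : {fset 'rV[rat]_n}).

Lemma den_gt0 y : (0 < den y)%N.
Proof.
rewrite /den; elim/big_ind: _ => // [a b|i _]; first by rewrite lcmn_gt0 => -> ->.
by rewrite absz_gt0 denq_neq0.
Qed.

Lemma homog_rat y :
  map_mx intr (homog y) = (den y)%:R *: row_mx y 1%:M :> 'rV[rat]_(n + 1).
Proof.
apply/rowP => i; rewrite mxE [homog y 0 i]mxE; apply: numqK; rewrite mxE.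
case: (split_ordP i) => j ->; last first.
  by rewrite row_mxEr !mxE !ord1 eqxx mulr1 natr_int.
rewrite row_mxEl.
have : (`|denq (y 0%R j)| %| den y)%N by rewrite /den (bigD1 j) //= dvdn_lcml.
case/dvdnP => k ->; rewrite natrM natr_absz normr_denq -mulrA.
rewrite (mulrC _ (y 0 j)) -numqE.
by rewrite rpredM ?natr_int ?intr_int.
Qed.

Lemma homog_last y i : homog y 0 (rshift n i) = den y.
Proof.
apply: (intr_inj (R := rat)).
have := congr1 (fun m : 'rV_(n + 1) => m 0 (rshift n i)) (homog_rat y).
by rewrite /= mxE => ->; rewrite mxE row_mxEr mxE !ord1 eqxx mulr1.
Qed.

Lemma homog_inj : injective (@homog n).
Proof.
move=> y v yv; have dyv : den y = den v.
  by have := congr1 (fun m : 'rV_(n + 1) => m 0 (rshift n ord0)) yv;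
    rewrite !homog_last => -[].
have := homog_rat y; rewrite yv homog_rat dyv.
move/(congr1 (fun m => (den v)%:R^-1 *: m)).
rewrite !scalerA mulVf ?scale1r; last by rewrite pnatr_eq0 -lt0n den_gt0.
by case/eq_row_mx.
Qed.

(** The covector [c] witnesses that [z] is primitive. A priori [z] is a positive multiple [k] of the
    vector of the rational point on its ray, and pairing with [c] shows that [k] divides 1. *)
Lemma homog_exists (z : 'rV[int]_(n + 1)) (c : 'cV[int]_(n + 1)) :
  z *m c = 1%:M -> 0 < z 0 (rshift n ord0) -> exists y, homog y = z.
Proof.
set l := z 0 (rshift n ord0) => zc l0.
pose y : 'rV[rat]_n := \row_i ((z 0 (lshift 1 i))%:~R / l%:~R).
have l0q : (l%:~R : rat) != 0 by rewrite intr_eq0 gt_eqF.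
have yz : map_mx intr z = l%:~R *: row_mx y 1%:M :> 'rV[rat]_(n + 1).
  apply/rowP => i; rewrite mxE [RHS]mxE.
  case: (split_ordP i) => j ->.
    by rewrite row_mxEl mxE mulrC divfK.
  by rewrite row_mxEr mxE !ord1 eqxx mulr1.
(* Each entry of [y] is a fraction over [l], so its reduced denominator divides [l]. *)
have : (den y %| `|l|)%N.
  rewrite /den; elim/big_ind: _ => [|a b al bl|i _]; first exact: dvd1n.
    by rewrite dvdn_lcm al.
  rewrite mxE; move: (z 0 (lshift 1 i))%R => t.
  set q := (t%:~R / l%:~R)%R.
  have E : (t * denq q = numq q * l)%R.
    by apply: (intr_inj (R := rat)); rewrite !intrM numqE mulrAC divfK.
  have cq : coprime `|denq q| `|numq q| by rewrite coprime_sym coprime_num_den.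
  by rewrite -(Gauss_dvdr _ cq) -abszM -E abszM dvdn_mull.
case/dvdnP => k lk; exists y.
have zk : z = k%:Z *: homog y.
  have injQ : injective (map_mx intr : 'rV[int]_(n + 1) -> 'rV[rat]_(n + 1)).
    by move=> u v uv; apply/matrixP => i j; apply: (@intr_inj rat);
      move/matrixP: uv => /(_ i j); rewrite !mxE.
  apply: injQ; rewrite map_mxZ /= homog_rat yz scalerA -natrM -lk; congr (_ *: _).
  by rewrite natr_absz gtr0_norm.
have : (k %| 1)%N.
  have : (k%:Z %| 1)%Z; last by [].
  apply/dvdzP; exists ((homog y *m c) 0 0).
  have := congr1 (fun m : 'M_1 => m 0 0) zc.
  by rewrite zk -scalemxAl !mxE eqxx mulrC => ->.
by rewrite dvdn1 => /eqP k1; rewrite zk k1 scale1r.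
Qed.

(** A one-sided form of regularity: integer forms dual to the vertices, without the remaining
    vectors of a basis. [regular_dual] and [dual_regular] give the equivalence. *)
Definition dual_covectors S (c : 'rV[rat]_n -> 'cV[int]_(n + 1)) : Prop :=
  forall v w, v \in S -> w \in S -> homog v *m c w = (v == w)%:R%:M.

Lemma regular_dual S : regular_simplex S -> exists c, dual_covectors S c.
Proof.
move=> [B uB rB].
have /choice[f fP] : forall v, exists i, v \in S -> row i B = homog v.
  move=> v; case: (boolP (v \in S)) => [/rB[i iv]|_]; first by exists i.
  by exists (rshift n ord0).
exists (fun v => col (f v) (invmx B)) => v w vS wS.
apply/matrixP => i j; rewrite !ord1.
have := congr1 (fun m : 'M_(n + 1) => m (f v) (f w)) (mulmxV uB).
rewrite !mxE /= => BE; rewrite mulr1n.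
transitivity ((f v == f w)%:R : int).
  by rewrite -BE; apply: eq_bigr => k _; rewrite -fP // !mxE.
congr (_%:R); congr nat_of_bool; apply/eqP/eqP => [fE|-> //].
by apply: homog_inj; rewrite -!fP // fE.
Qed.

End Homogeneous.

(** In the Smith normal form [L *m D *m Q] of [A], the right inverse forces [k <= N] and makes every
    diagonal entry of [D] a unit. Hence the block matrix of [L] times the diagonal part and an
    identity, followed by [Q], is invertible, and its top rows are those of [A]. *)
Lemma unimodular_extension N k (A : 'M[int]_(k, N)) (C : 'M[int]_(N, k)) :
  A *m C = 1%:M ->
  exists2 B : 'M[int]_N, B \in unitmx & forall i, exists j, row j B = row i A.
Proof.
move=> AC; have [L uL [Q uQ [d _ AE]]] := int_Smith_normal_form A.
set D := (\matrix_(i, j) _) in AE.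
have DX : D *m (Q *m C *m L) = 1%:M.
  have : L *m (D *m (Q *m C)) = 1%:M by rewrite !mulmxA -AE.
  by move=> /mulmx1C <-; rewrite !mulmxA.
set X := Q *m C *m L in DX.
have DXi (i : 'I_k) : exists2 j : 'I_N, i = j :> nat & d`_i * X j i = 1.
  have := congr1 (fun m : 'M_k => m i i) DX; rewrite !mxE eqxx.
  have [iN|iN] := ltnP i N; last first.
    rewrite big1 // => j _; rewrite mxE gtn_eqF ?mulr0n ?mul0r //.
    exact: leq_trans (ltn_ord j) iN.
  rewrite (bigD1 (Ordinal iN)) //= mxE eqxx mulr1n big1 ?addr0; last first.
    move=> j jN; rewrite mxE (_ : (_ == _) = false) ?mulr0n ?mul0r //.
    by apply: contraNF jN => /eqP ij; apply/eqP/val_inj.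
  by move=> H; exists (Ordinal iN).
have kN : (k <= N)%N.
  rewrite leqNgt; apply/negP => Nk; have [j /= jE _] := DXi (Ordinal Nk).
  by have := ltn_ord j; rewrite -jE ltnn.
have [r NE] : {r | N = k + r}%N by exists (N - k)%N; rewrite subnKC.
clear kN; subst N.
exists (block_mx (L *m diag_mx (\row_i d`_i)) 0 0 1%:M *m Q).
  rewrite unitmx_mul uQ andbT unitmxE det_ublock det1 mulr1 -unitmxE.
  rewrite unitmx_mul uL unitmxE det_diag; apply: rpred_prod => i _.
  have [j _ dX] := DXi i; rewrite mxE; apply/unitrP; exists (X j i).
  by rewrite mulrC.
move=> i; exists (lshift r i).
rewrite row_mul AE row_mul; congr (_ *m _).
apply/rowP => j; case: (split_ordP j) => j' ->; rewrite mxE [RHS]mxE [RHS]mxE.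
  rewrite block_mxEul mxE; apply: eq_bigr => l _; rewrite !mxE.
  by congr (_ * _); rewrite -mulrb.
rewrite block_mxEur mxE big1 // => l _.
rewrite [D _ _]mxE /= (_ : (_ == _) = false) ?mulr0n ?mulr0 //.
by apply/ltn_eqF; apply: leq_trans (ltn_ord l) _; rewrite leq_addr.
Qed.

Section Dual.
Variable n : nat.
Implicit Types (y v : 'rV[rat]_n) (S : {fset 'rV[rat]_n}).

Lemma dual_regular S c : dual_covectors S c -> regular_simplex S.
Proof.
move=> cS; pose k := size (enum_fset S).
pose s (i : 'I_k) := nth 0 (enum_fset S) i.
have sS i : s i \in S by apply: mem_nth.
pose A := \matrix_(i < k) homog (s i).
pose C : 'M_(n + 1, k) := \matrix_(i, j) c (s j) i 0.
have AC : A *m C = 1%:M.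
  apply/matrixP => i j.
  have := congr1 (fun m : 'M_1 => m 0 0) (cS (s i) (s j) (sS i) (sS j)).
  rewrite !mxE eqxx mulr1n.
  under eq_bigr => l do rewrite /=.
  have -> : (s i == s j) = (i == j) by rewrite nth_uniq // fset_uniq.
  by move=> <-; apply: eq_bigr => l _; rewrite !mxE.
have [B uB BA] := unimodular_extension AC.
exists B => // v vS.
have iv : (index v (enum_fset S) < k)%N by rewrite index_mem.
have [j jE] := BA (Ordinal iv); exists j; rewrite jE rowK /s /=.
by rewrite nth_index.
Qed.

End Dual.

(** * Barycentric coordinates along the integer vectors of the vertices *)

Section Barycentric.
Variables (R : realType) (n : nat).
Local Notation K := 'rV[rat]_n.
Implicit Types (v w : K) (S F : {fset K}) (D : {fset {fset K}}).
Implicit Types (a b : K -> R) (x : 'rV[R]_n) (l : 'cV[int]_(n + 1)).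

Definition hpoint x : 'rV[R]_(n + 1) := row_mx x 1%:M.

Definition hvertex v : 'rV[R]_(n + 1) := map_mx intr (homog v).

Lemma hvertexE v : hvertex v = (den v)%:R *: hpoint (map_mx ratr v).
Proof.
rewrite /hvertex; have -> : map_mx intr (homog v) =
    map_mx ratr (map_mx intr (homog v) : 'rV[rat]_(n + 1)) :> 'rV[R]_(n + 1).
  by apply/matrixP => i j; rewrite !mxE ratr_int.
by rewrite homog_rat map_mxZ map_row_mx map_mx1 /= rmorph_nat.
Qed.

Lemma hpoint_inj : injective hpoint.
Proof. by move=> x y /eq_row_mx[]. Qed.

Lemma hvertex_last v i : hvertex v 0 (rshift n i) = (den v)%:R.
Proof. by rewrite mxE homog_last -pmulrn. Qed.

Lemma hpoint_last x i : hpoint x 0 (rshift n i) = 1.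
Proof. by rewrite row_mxEr mxE !ord1 eqxx. Qed.

Lemma hpointl x i : hpoint x 0 (lshift 1 i) = x 0 i.
Proof. by rewrite row_mxEl. Qed.

Lemma hvertexl v i : hvertex v 0 (lshift 1 i) = (den v)%:R * ratr (v 0 i).
Proof. by rewrite hvertexE mxE hpointl mxE. Qed.

Definition form l (z : 'rV[R]_(n + 1)) : R := (z *m map_mx intr l) 0 0.

Definition formz l v : int := (homog v *m l) 0 0.

Lemma form_vertex l v : form l (hvertex v) = (formz l v)%:~R.
Proof. by rewrite /form -map_mxM mxE. Qed.

Lemma formD l z1 z2 : form l (z1 + z2) = form l z1 + form l z2.
Proof. by rewrite /form mulmxDl mxE. Qed.

Lemma formZ l t z : form l (t *: z) = t * form l z.
Proof. by rewrite /form -scalemxAl mxE. Qed.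

Lemma form_sum l (I : Type) (s : seq I) (F : I -> 'rV[R]_(n + 1)) :
  form l (\sum_(i <- s) F i) = \sum_(i <- s) form l (F i).
Proof. by rewrite /form mulmx_suml summxE. Qed.

Lemma form_lB l1 l2 z : form (l1 - l2) z = form l1 z - form l2 z.
Proof. by rewrite /form map_mxB mulmxBr !mxE. Qed.

Lemma dualE S c v w : dual_covectors S c -> v \in S -> w \in S ->
  formz (c w) v = (v == w)%:R.
Proof. by move=> cS vS wS; rewrite /formz cS // mxE eqxx. Qed.

(* Coordinates are relative to the integer vectors [homog v], not to the points
   themselves: the weights of a convex combination are [a v * den v]. *)
Definition bary S a x : Prop :=
  [/\ forall v, 0 <= a v, forall v, v \notin S -> a v = 0 &
      hpoint x = \sum_(v <- S) a v *: hvertex v].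

Lemma convP S x : conv R S x <-> exists a, bary S a x.
Proof.
have dn0 v : (den v)%:R != 0 :> R by rewrite pnatr_eq0 -lt0n den_gt0.
split=> [[a [a0 a1 xE]]|[a [a0 aS xE]]].
  exists (fun v => if v \in S then a v / (den v)%:R else 0); split=> [v|v /negbTE ->//|].
    by case: ifP => // vS; rewrite divr_ge0 ?a0 ?ler0n.
  rewrite big_seq; under eq_bigr => v vS do
    rewrite vS hvertexE scalerA divfK //.
  rewrite -big_seq xE.
  apply/rowP => j; rewrite summxE; case: (split_ordP j) => i ->.
    rewrite hpointl summxE; apply: eq_bigr => v _.
    by rewrite mxE [RHS]mxE hpointl.
  rewrite hpoint_last; transitivity (\sum_(v <- S) a v); first by rewrite a1.
  apply: eq_bigr => v _.
  by rewrite mxE hpoint_last mulr1.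
exists (fun v => a v * (den v)%:R); split=> [v vS||].
- by rewrite mulr_ge0.
- have /(congr1 (fun m : 'rV_(n + 1) => m 0 (rshift n ord0))) := xE.
  rewrite hpoint_last summxE => E; rewrite [RHS]E; apply: eq_bigr => v _.
  by rewrite mxE hvertex_last.
apply/rowP => j.
have /(congr1 (fun m : 'rV_(n + 1) => m 0 (lshift 1 j))) := xE.
rewrite hpointl => ->; rewrite !summxE; apply: eq_bigr => v _.
by rewrite mxE hvertexl mulrA [RHS]mxE mxE.
Qed.

Lemma bary_supp S F a x :
  bary S a x -> (forall v, v \notin F -> a v = 0) -> bary F a x.
Proof.
move=> [a0 aS xE] aF; split=> //; rewrite xE.
have E (G : {fset K}) : (forall v, v \notin G -> a v = 0) ->
    \sum_(v <- G) a v *: hvertex v = \sum_(v <- (G `|` S `|` F)%fset) a v *: hvertex v.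
  move=> aG; apply: big_fset_incl; first by apply/fsubsetP => v; rewrite !inE => ->.
  by move=> v _ /aG ->; rewrite scale0r.
rewrite (E S) // (E F) //; apply: eq_fbigl => v; rewrite !inE.
by case: (v \in S); case: (v \in F).
Qed.

Lemma bary_sub S F a x : (S `<=` F)%fset -> bary S a x -> bary F a x.
Proof.
move=> /fsubsetP SF aS; apply: (bary_supp aS) => v vF.
by case: aS => _ aS _; apply: aS; apply: contra vF => /SF.
Qed.

Lemma bary_form S a x l : bary S a x ->
  form l (hpoint x) = \sum_(v <- S) a v * (formz l v)%:~R.
Proof.
move=> [_ _ ->]; rewrite form_sum; apply: eq_bigr => v _.
by rewrite formZ form_vertex.
Qed.

Lemma bary_den S a x : bary S a x -> \sum_(v <- S) a v * (den v)%:R = 1.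
Proof.
move=> [_ _ /(congr1 (fun m : 'rV_(n + 1) => m 0 (rshift n ord0)))].
rewrite hpoint_last summxE => E; rewrite [RHS]E; apply: eq_bigr => v _.
by rewrite mxE hvertex_last.
Qed.

Lemma bary_dual S a x c v : dual_covectors S c -> bary S a x -> v \in S ->
  a v = form (c v) (hpoint x).
Proof.
move=> cS aS vS; rewrite (bary_form _ aS) (big_fsetD1 v) //=.
rewrite (dualE cS) // eqxx mulr1 big_seq big1 ?addr0 // => w.
by rewrite !inE => /andP[/negbTE wv wS]; rewrite (dualE cS) // wv mulr0.
Qed.

Lemma regular_bary_inj S a b x : regular_simplex S ->
  bary S a x -> bary S b x -> a =1 b.
Proof.
move=> /regular_dual[c cS] aS bS v.
have [vS|vS] := boolP (v \in S).
  by rewrite (bary_dual cS aS) ?(bary_dual cS bS).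
by case: aS bS => _ -> // _ [_ ->].
Qed.

(** The point lies in the common face, whose coordinates can be compared with both. Coordinates are
    total functions vanishing off the simplex, so that those taken in different simplexes can be
    equated. *)
Lemma bary_uniq D S F a b x : regular_complex R D -> S \in D -> F \in D ->
  bary S a x -> bary F b x -> a =1 b.
Proof.
move=> [regD _ intD] SD FD aS bF.
have : conv R (S `&` F)%fset x.
  by rewrite -intD //; split; apply/convP; [exists a|exists b].
move=> /convP[d dSF] v.
rewrite (regular_bary_inj (regD _ SD) aS (bary_sub (fsubsetIl _ _) dSF)).
by rewrite (regular_bary_inj (regD _ FD) bF (bary_sub (fsubsetIr _ _) dSF)).
Qed.

(** Converse of [bary_uniq]: it turns the condition on intersections into one on coordinates, which
    can be pushed along blow-ups and maps. *)
Lemma bary_complex D :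
  (forall S, S \in D -> regular_simplex S) ->
  (forall S F, S \in D -> (F `<=` S)%fset -> F \in D) ->
  (forall S F a b x, S \in D -> F \in D -> bary S a x -> bary F b x -> a =1 b) ->
  regular_complex R D.
Proof.
move=> regD downD uniqD; split=> // S F SD FD.
apply/seteqP; split=> x /=; last first.
  move=> /convP[a aSF]; split; apply/convP; exists a; apply: bary_sub aSF.
    exact: fsubsetIl.
  exact: fsubsetIr.
move=> [/convP[a aS] /convP[b bF]]; apply/convP; exists a.
apply: (bary_supp aS) => v; rewrite inE negb_and => /orP[vS|vF].
  by case: aS => _ ->.
by rewrite (uniqD _ _ _ _ _ SD FD aS bF); case: bF => _ ->.
Qed.

End Barycentric.

(** * Binary subdivisions and Farey blow-ups *)

Local Open Scope fset_scope.

Section BinarySubdivision.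
Variable K : choiceType.
Implicit Types (D : {fset {fset K}}) (S F : {fset K}) (u v w e : K).

Definition down_closed D := forall S F, S \in D -> F `<=` S -> F \in D.

(** The faces of [binary_subdivision], as an operation on any family of finite sets, so that
    abstract complexes and the vertex sets of geometric ones share it. *)
Definition bsub D v w e : {fset {fset K}} :=
  [fset S in D | ~~ ([fset v; w] `<=` S)] `|`
  \bigcup_(S <- D | [fset v; w] `<=` S)
    (fpowerset (e |` (S `\ w)) `|` fpowerset (e |` (S `\ v))).

Lemma fset2_sub v w S : ([fset v; w] `<=` S) = (v \in S) && (w \in S).
Proof.
apply/fsubsetP/andP => [H|[vS wS] u]; first by split; apply: H; rewrite !inE eqxx ?orbT.
by rewrite !inE => /orP[]/eqP->.
Qed.

Lemma in_fcover D u : (u \in fcover D) <-> exists2 S, S \in D & u \in S.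
Proof.
split=> [/bigfcupP[S /andP[SD _] uS]|[S SD uS]]; first by exists S.
by apply/bigfcupP; exists S; rewrite ?SD.
Qed.

(** The face of the original complex that carries [S], the new vertex [e] being interior to the edge
    from [v] to [w]. *)
Definition unstar v w e S := if e \in S then (S `\ e) `|` [fset v; w] else S.

(** This criterion replaces the two halves of the definition from here on; the half that contains
    [S] is decided by which of [v] and [w] it misses. *)
Lemma in_bsub D v w e S : down_closed D -> v != w -> e \notin fcover D ->
  (S \in bsub D v w e) =
  ~~ ([fset v; w] `<=` S) && (unstar v w e S \in D).
Proof.
move=> downD vw eD.
have eS F : F \in D -> e \notin F.
  by move=> FD; apply: contra eD => eF; apply/in_fcover; exists F.
apply/idP/andP; rewrite /unstar; last first.
  case; case: ifP => [eS' nvw SD|_ nvw SD]; rewrite in_fsetU; last first.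
    by rewrite !inE nvw SD.
  apply/orP; right; apply/bigfcupP; exists (S `\ e `|` [fset v; w]).
    by rewrite SD fsubsetUr.
  have [ve we] : v != e /\ w != e.
    by split; apply: contraNneq (eS _ SD) => <-; rewrite !inE eqxx ?orbT.
  rewrite in_fsetU !fpowersetE; move: nvw; rewrite fset2_sub negb_and.
  case/orP => [vS|wS]; apply/orP; [right|left]; apply/fsubsetP => u uS;
    rewrite !inE uS ?andbT.
    by case: (u =P e) => //= _; rewrite andbT; apply: contraNneq vS => <-.
  by case: (u =P e) => //= _; rewrite andbT; apply: contraNneq wS => <-.
rewrite in_fsetU => /orP[|/bigfcupP[F /andP[FD vwF]]].
  by rewrite in_fset => /andP[/= SD ->]; rewrite (negbTE (eS _ SD)).
have [ve we] : v != e /\ w != e.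
  by move: vwF; rewrite fset2_sub => /andP[vF wF];
  split; apply: contraNneq (eS _ FD) => <-.
rewrite in_fsetU !fpowersetE => H.
have SF : S `<=` e |` F.
  by case/orP: H => /fsubsetP H; apply/fsubsetP => u /H; rewrite !inE;
    case: (u == e) => //= /andP[].
split.
  rewrite fset2_sub; apply/negP => /andP[vS wS].
  by case/orP: H => /fsubsetP H; [move/H: wS|move/H: vS]; rewrite !inE eqxx
    ?(negbTE ve) ?(negbTE we).
case: ifP => eS'.
  apply: downD FD _; rewrite fsubUset vwF andbT; apply/fsubsetP => u.
  by rewrite !inE => /andP[ue /(fsubsetP SF)]; rewrite !inE (negbTE ue).
apply: downD FD _; apply/fsubsetP => u uS; have := fsubsetP SF u uS.
by rewrite !inE; case: eqP => // ue; rewrite -ue uS in eS'.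
Qed.

Lemma bsub_down D v w e : down_closed D -> v != w -> e \notin fcover D ->
  down_closed (bsub D v w e).
Proof.
move=> downD vw eD S F; rewrite !in_bsub // => /andP[nvw SD] FS.
rewrite (contra (fun H => fsubset_trans H FS) nvw) /=.
apply: downD SD _; apply/fsubsetP => u; rewrite /unstar.
case: ifP => eF.
  rewrite (fsubsetP FS _ eF) !inE => /orP[/andP[-> /(fsubsetP FS) ->]//|->].
  by rewrite orbT.
move=> uF; case: ifP => _; rewrite ?inE (fsubsetP FS _ uF) // andbT.
by case: eqP => // ue; rewrite -ue uF in eF.
Qed.

End BinarySubdivision.

Local Close Scope fset_scope.

Section Mediant.
Variables (R : realType) (n : nat).
Local Notation K := 'rV[rat]_n.
Implicit Types (u v w e : K) (S F : {fset K}) (D : {fset {fset K}}).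
Implicit Types (a b : K -> R) (x : 'rV[R]_n).

Definition mediant v w e := homog e = homog v + homog w.

Lemma mediantC v w e : mediant v w e -> mediant w v e.
Proof. by rewrite /mediant addrC. Qed.

(** The sum of the two vectors is primitive, because the dual covector of [v] takes the value 1 on
    it. *)
Lemma mediant_exists v w S : regular_simplex S -> v \in S -> w \in S -> v != w ->
  exists e, mediant v w e.
Proof.
move=> /regular_dual[c cS] vS wS vw; apply: (@homog_exists _ _ (c v)).
  by rewrite mulmxDl !cS // eqxx eq_sym (negbTE vw) -raddfD /= addr0.
by rewrite mxE !homog_last -PoszD ltz_nat addn_gt0 den_gt0.
Qed.

Lemma mediant_den v w e : mediant v w e -> den e = (den v + den w)%N.
Proof.
move=> med; have : (homog v + homog w) 0 (rshift n ord0) = (den v + den w)%N.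
  by rewrite mxE !homog_last.
by rewrite -med homog_last => -[].
Qed.

Lemma hvertex_mediant v w e : mediant v w e ->
  hvertex R e = hvertex R v + hvertex R w.
Proof. by rewrite /hvertex => ->; rewrite map_mxD. Qed.

Lemma formz_mediant v w e l : mediant v w e ->
  formz l e = formz l v + formz l w.
Proof. by rewrite /formz => ->; rewrite mulmxDl mxE. Qed.

Definition vertex_coord v : K -> R :=
  fun u => if u == v then (den v)%:R^-1 else 0.

Lemma den_neq0 v : (den v)%:R != 0 :> R.
Proof. by rewrite pnatr_eq0 -lt0n den_gt0. Qed.

Lemma bary_vertex v : bary [fset v]%fset (vertex_coord v) (map_mx ratr v).
Proof.
rewrite /vertex_coord; split=> [u|u|].
- by case: ifP => _ //; rewrite invr_ge0 ler0n.
- by rewrite inE => /negbTE ->.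
by rewrite big_seq_fset1 eqxx hvertexE scalerA mulVf ?den_neq0 // scale1r.
Qed.

Definition mediant_coord v w e : K -> R :=
  fun u => if u \in [fset v; w]%fset then (den e)%:R^-1 else 0.

Lemma bary_mediant v w e : v != w -> mediant v w e ->
  bary [fset v; w]%fset (mediant_coord v w e) (map_mx ratr e).
Proof.
move=> vw med; rewrite /mediant_coord; split=> [u|u|].
- by case: ifP => _ //; rewrite invr_ge0 ler0n.
- by move=> /negbTE ->.
rewrite big_fsetU1 /= ?inE // big_seq_fset1 !inE !eqxx orbT /= -scalerDr.
by rewrite -(hvertex_mediant med) hvertexE scalerA mulVf ?den_neq0 // scale1r.
Qed.

Lemma farey_mediantE v w e : v != w -> mediant v w e ->
  farey_mediant R v w = e.
Proof.
move=> vw med; rewrite /farey_mediant; apply: xget_unique.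
  by split=> //; apply/convP; eexists; exact: bary_mediant.
by move=> e' [_ e'E]; apply: homog_inj; rewrite e'E.
Qed.

Variables (D : {fset {fset K}}) (v w e : K).
Hypotheses (cD : regular_complex R D) (vw : v != w).
Hypotheses (vwD : [fset v; w]%fset \in D) (med : mediant v w e).

Let downD : down_closed D. Proof. by case: cD. Qed.

(** The coordinates of the mediant at [v] and at [w] are both nonzero; by uniqueness of coordinates
    any simplex containing it has both as vertices. *)
Lemma conv_mediant S : S \in D ->
  conv R S (map_mx ratr e) <-> ([fset v; w] `<=` S)%fset.
Proof.
move=> SD; split=> [/convP[a aS]|vwS]; last first.
  apply/convP; exists (mediant_coord v w e).
  by apply: bary_sub vwS _; exact: bary_mediant.
have E := bary_uniq cD SD vwD aS (bary_mediant vw med).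
apply/fsubsetP => u uvw; apply/negPn/negP => uS.
have [_ aS0 _] := aS; have /eqP := E u; rewrite aS0 // /mediant_coord uvw.
by rewrite eq_sym invr_eq0 (negbTE (den_neq0 _)).
Qed.

(** If [e] were a vertex, the simplex [[fset e]] would contain the mediant, hence both [v] and [w],
    which are distinct. *)
Lemma mediant_fresh : e \notin fcover D.
Proof.
apply/negP => /in_fcover[S SD eS].
have eD : [fset e]%fset \in D by apply: downD SD _; rewrite fsub1set.
have := (conv_mediant eD).1; rewrite fset2_sub !inE => H.
have /H/andP[/eqP ve /eqP we] : conv R [fset e]%fset (map_mx ratr e).
  by apply/convP; eexists; exact: bary_vertex.
by move: vw; rewrite ve we eqxx.
Qed.

Lemma mediant_neq : v != e /\ w != e.
Proof.
by split; apply: contraNneq mediant_fresh => <-; apply/in_fcover;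
  exists [fset v; w]%fset; rewrite ?inE ?eqxx ?orbT.
Qed.

Lemma blowupE : blowup R D e = bsub D v w e.
Proof.
apply/fsetP => S; rewrite in_bsub //; last exact: mediant_fresh.
have nconv F : F \in D ->
    (map_mx ratr e \in conv R F) = ([fset v; w] `<=` F)%fset.
  by move=> FD; apply/idP/idP => [/set_mem|] /(conv_mediant FD) // /mem_set.
have eF F : F \in D -> e \notin F.
  by move=> FD; apply: contra mediant_fresh => eF; apply/in_fcover; exists F.
rewrite /blowup in_fsetU in_fset /=; apply/orP/andP.
  case=> [/andP[/= SD]|/bigfcupP[F /andP[FD]]].
    by rewrite nconv // /unstar (negbTE (eF _ SD)).
  rewrite nconv // => vwF /imfsetP[G /= /andP[]]; rewrite fpowersetE => GF.
  have GD := downD FD GF.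
  rewrite nconv // fset2_sub => nvw ->; rewrite fset2_sub !inE.
  have [/negbTE -> /negbTE ->] := mediant_neq; rewrite /= nvw; split=> //.
  rewrite /unstar !inE eqxx /=; apply: downD FD _; rewrite fsubUset vwF andbT.
  by apply/fsubsetP => u; rewrite !inE => /andP[/negbTE -> /= /(fsubsetP GF)].
rewrite /unstar; case: ifP => eS [nvw SD]; last first.
  by left; apply/andP; split; rewrite //= nconv.
right; apply/bigfcupP; exists (S `\ e `|` [fset v; w])%fset.
  by rewrite SD nconv // fsubsetUr.
have SeD : (S `\ e)%fset \in D by apply: downD SD _; exact: fsubsetUl.
apply/imfsetP; exists (S `\ e)%fset => /=; last by rewrite fsetD1K.
rewrite [_ \in _]/= -topredE /= fpowersetE fsubsetUl /= nconv //.
by apply: contra nvw => H; apply: fsubset_trans H (fsubD1set _ _).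
Qed.

(** From coordinates in the subdivision to coordinates in the original complex: the vector of [e] is
    the sum of those of [v] and [w], so its coefficient is moved onto both. *)
Definition push (a : K -> R) u :=
  if u == e then 0 else a u + a e *+ (u == v) + a e *+ (u == w).

Lemma push_sum a (G : {fset K}) : v \in G -> w \in G ->
  \sum_(u <- (e |` G)%fset) a u *: hvertex R u =
  \sum_(u <- (e |` G)%fset) push a u *: hvertex R u.
Proof.
move=> vG wG; have [ve we] := mediant_neq.
rewrite (big_fsetD1 e) ?fset1U1 //= [RHS](big_fsetD1 e) ?fset1U1 //=.
have -> : push a e = 0 by rewrite /push eqxx.
rewrite scale0r add0r.
set H := (_ `\ e)%fset.
have vH : v \in H by rewrite !inE ve vG orbT.
have wH : w \in H by rewrite !inE we wG orbT.
transitivity (\sum_(u <- H) (a u + a e *+ (u == v) + a e *+ (u == w)) *: hvertex R u); last first.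
  by rewrite big_seq [RHS]big_seq; apply: eq_bigr => u; rewrite !inE /push => /andP[/negbTE ->].
have sub1 z : z \in H -> \sum_(u <- H) (a e *+ (u == z)) *: hvertex R u = a e *: hvertex R z.
  move=> zH; rewrite (big_fsetD1 z) //= eqxx big_seq big1 ?addr0 // => u.
  by rewrite !inE => /andP[/negbTE -> _]; rewrite scale0r.
under [RHS]eq_bigr => u _ do rewrite !scalerDl.
rewrite !big_split /= !sub1 // (hvertex_mediant med) scalerDr.
by rewrite addrC addrA.
Qed.

Lemma bary_push S a x : bary S a x -> bary (unstar v w e S) (push a) x.
Proof.
move=> aS; have [a0 a0S _] := aS; have [ve we] := mediant_neq.
have [_ _ xE] : bary (e |` (S `|` [fset v; w]))%fset a x.
  by apply: bary_sub aS; apply/fsubsetP => u uS; rewrite !inE uS orbT.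
apply: (@bary_supp _ _ (e |` (S `|` [fset v; w]))%fset); first split=> [u|u|].
- by rewrite /push; case: ifP => // _; rewrite !addr_ge0 ?mulrn_wge0.
- rewrite /push !inE !negb_or => /and4P[/negbTE -> uS /negbTE -> /negbTE ->].
  by rewrite a0S // !mulr0n !addr0.
- by rewrite xE push_sum // !inE eqxx ?orbT.
move=> u; rewrite /unstar /push; case: ifP => eS; rewrite ?inE.
  case: (u == e) => //=; rewrite !negb_or => /and3P[uS /negbTE -> /negbTE ->].
  by rewrite a0S // !mulr0n !addr0.
by move=> uS; case: ifP => // _; rewrite !a0S ?eS // !mul0rn !addr0.
Qed.

(* No face of the subdivision contains both [v] and [w], so the coefficient at
   the mediant is the minimum of the two pushed coefficients. *)
Lemma push_inj S F a b x y : S \in bsub D v w e -> F \in bsub D v w e ->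
  bary S a x -> bary F b y -> push a =1 push b -> a =1 b.
Proof.
rewrite !in_bsub ?mediant_fresh // => /andP[nS _] /andP[nF _].
move=> [a0 aS _] [b0 bF _] ab.
have min0 (G : {fset K}) c : (forall u, 0 <= c u) ->
    (forall u, u \notin G -> c u = 0) -> ~~ ([fset v; w] `<=` G)%fset ->
    c e = Num.min (push c v) (push c w).
  move=> c0 cG; rewrite fset2_sub negb_and.
  have [/negbTE ve /negbTE we] := mediant_neq.
  rewrite /push ve we !eqxx eq_sym [w == v]eq_sym (negbTE vw) !mulr0n !mulr1n !addr0.
  case/orP => [vG|wG].
    by rewrite (cG v) // add0r; apply/esym/min_idPl; rewrite lerDr.
  by rewrite (cG w) // add0r; apply/esym/min_idPr; rewrite lerDr.
have E : a e = b e by rewrite (min0 S a) // (min0 F b) // !ab.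
move=> u; have := ab u; rewrite /push E; case: eqP => [-> //|_].
by move=> /addIr/addIr.
Qed.

(** A right inverse of [push] on coordinates vanishing at [e]. Moving the smaller of the two
    coefficients to [e] annihilates one of [v] and [w], so that the result is carried by a face of
    the subdivision. *)
Definition pull (a : K -> R) u :=
  if u == e then Num.min (a v) (a w)
  else a u - Num.min (a v) (a w) *+ (u \in [fset v; w]%fset).

Lemma push_pull a : a e = 0 -> push (pull a) =1 a.
Proof.
move=> ae u; rewrite /push /pull eqxx.
case: (u =P e) => [-> //|_]; rewrite !inE.
have [->|uv] := eqVneq u v; first by rewrite (negbTE vw) mulr0n addr0 mulr1n subrK.
rewrite mulr0n addr0 orFb; case: eqVneq => _; last by rewrite !mulr0n subr0 addr0.
by rewrite mulr1n subrK.
Qed.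

Lemma support_bsub : support R (bsub D v w e) = support R D.
Proof.
apply/seteqP; split=> x [S SD /convP[a aS]].
  move: SD; rewrite in_bsub ?mediant_fresh // => /andP[_ SD].
  by exists (unstar v w e S) => //; apply/convP; exists (push a); exact: bary_push.
have [vwS|nvw] := boolP ([fset v; w] `<=` S)%fset; last first.
  exists S; last by apply/convP; exists a.
  rewrite in_bsub ?mediant_fresh // nvw /unstar ifF //.
  by apply: contraNF mediant_fresh => eS; apply/in_fcover; exists S.
have [ve we] := mediant_neq.
have eS : e \notin S.
  by apply: contra mediant_fresh => eS; apply/in_fcover; exists S.
have [a0 aS0 _] := aS.
move: (vwS); rewrite fset2_sub => /andP[vS wS].
(* The endpoint whose coefficient vanishes under [pull]; removing it selects the half of the star
   that contains [x]. *)
pose z := if a v <= a w then v else w.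
have zE : a z = Num.min (a v) (a w).
  by rewrite /z; case: leP => [h|h].
have zvw : z \in [fset v; w]%fset by rewrite /z !inE; case: ifP; rewrite eqxx ?orbT.
have zS : z \in S by rewrite /z; case: ifP.
have ze : z != e by rewrite /z; case: ifP.
have m0 : 0 <= Num.min (a v) (a w) by rewrite le_min !a0.
exists ((e |` S) `\ z)%fset.
  rewrite in_bsub ?mediant_fresh // fset2_sub !inE.
  rewrite (negbTE ve) (negbTE we) vS wS /= !andbT; apply/andP; split.
    by rewrite /z; case: ifP => _; rewrite eqxx //= andbF.
  rewrite /unstar !inE eq_sym ze eqxx /=.
  apply: downD SD _; rewrite fsubUset vwS andbT; apply/fsubsetP => u.
  by rewrite !inE => /and3P[/negbTE -> _ /=].
apply/convP; exists (pull a).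
apply: (@bary_supp _ _ (e |` S)%fset); first split.
- move=> u; rewrite /pull; case: ifP => // _.
  case: (boolP (u \in _)) => [|_]; last by rewrite mulr0n subr0.
  by rewrite !inE mulr1n subr_ge0 ge_min => /orP[]/eqP->; rewrite lexx ?orbT.
- move=> u; rewrite !inE negb_or /pull => /andP[/negbTE -> uS].
  rewrite aS0 // !inE; case: eqP => [uv|_]; first by rewrite uv vS in uS.
  case: eqP => [uw|_]; first by rewrite uw wS in uS.
  by rewrite mulr0n subr0.
- have [_ _ ->] := bary_sub (fsubsetU1 e S) aS.
  by rewrite [RHS]push_sum //; apply: eq_bigr => u _; rewrite push_pull // aS0.
move=> u; rewrite !inE negb_and negbK negb_or => /orP[/eqP ->|/andP[ue uS]].
  by rewrite /pull (negbTE ze) zvw zE mulr1n subrr.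
rewrite /pull (negbTE ue) aS0 // !inE.
case: eqP => [uv|_]; first by rewrite uv vS in uS.
case: eqP => [uw|_]; first by rewrite uw wS in uS.
by rewrite mulr0n subr0.
Qed.

Lemma bsub_conv S : S \in bsub D v w e ->
  unstar v w e S \in D /\ (conv R S `<=` conv R (unstar v w e S))%classic.
Proof.
rewrite in_bsub ?mediant_fresh // => /andP[_ SD]; split=> // x /convP[a aS].
by apply/convP; exists (push a); exact: bary_push.
Qed.

(** If [q] is the endpoint missing from [S] and [p] the other one, exchanging the vector of [q] for
    that of [e], the sum of both, is unimodular. In the dual family [e] takes over the covector of
    [q], and that of [p] is corrected by it so as to vanish on [e]. *)
Lemma bsub_regular S : S \in bsub D v w e -> regular_simplex S.
Proof.
have [regD _ _] := cD; have [ve we] := mediant_neq.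
rewrite in_bsub ?mediant_fresh // /unstar => /andP[nvw].
case: ifP => eS SD; last exact: regD.
have [c cS] := regular_dual (regD _ SD).
have key p q : [fset p; q]%fset = [fset v; w]%fset -> p != q -> q \notin S ->
    mediant p q e -> regular_simplex S.
  move=> pqE pq qS pqe.
  apply: (@dual_regular _ _ (fun u => if u == e then c q else if u == p then c p - c q else c u)).
  have pqS z : z \in [fset p; q]%fset -> z \in (S `\ e `|` [fset v; w])%fset.
    by rewrite pqE => H; rewrite in_fsetU H orbT.
  have pS := pqS p (fset21 _ _); have qS' := pqS q (fset22 _ _).
  have mS z : z \in S -> z != e -> z \in (S `\ e `|` [fset v; w])%fset.
    by move=> zS ze; rewrite in_fsetU in_fsetD1 zS ze.
  have E z : z \in (S `\ e `|` [fset v; w])%fset ->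
     homog e *m c z = ((p == z)%:R + (q == z)%:R)%:M.
    by move=> zS; rewrite pqe mulmxDl !cS // -raddfD.
  move=> y z yS zS; case: (eqVneq z e) => [->|ze].
    case: (eqVneq y e) => [->|ye].
      by rewrite E // eqxx (negbTE pq) add0r.
    have yq : (y == q) = false by apply/eqP => yq; rewrite -yq yS in qS.
    by rewrite (cS _ _ (mS _ yS ye) qS') yq.
  case: (eqVneq z p) => [zp|zp].
    rewrite mulmxBr; case: (eqVneq y e) => [->|ye].
      rewrite !E // !eqxx (negbTE pq) eq_sym (negbTE pq) addr0 add0r subrr.
      by rewrite eq_sym (negbTE ze); apply/matrixP => i j; rewrite !mxE mul0rn.
    have yq : (y == q) = false by apply/eqP => yq; rewrite -yq yS in qS.
    rewrite (cS _ _ (mS _ yS ye) qS') (cS _ _ (mS _ yS ye) pS) yq zp.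
    by apply/matrixP => i j; rewrite !mxE mul0rn subr0.
  have zq : (q == z) = false by apply/eqP => zq; rewrite zq zS in qS.
  case: (eqVneq y e) => [->|ye]; last by rewrite cS ?mS.
  by rewrite E ?mS // zq eq_sym (negbTE zp) addr0 eq_sym (negbTE ze).
move: nvw; rewrite fset2_sub negb_and => /orP[vS|wS].
  by apply: (key w v) => //; [rewrite fsetUC|rewrite eq_sym|exact: mediantC].
exact: (key v w).
Qed.

(** Two systems of coordinates of one point agree after [push], as coordinates in the original
    complex are unique, and [push_inj] lifts the equality. *)
Lemma bsub_complex : regular_complex R (bsub D v w e).
Proof.
apply: bary_complex; first exact: bsub_regular.
  exact: bsub_down mediant_fresh.
move=> S F a b x SD FD aS bF.
apply: (push_inj SD FD aS bF) => u.
apply: (bary_uniq cD _ _ (bary_push aS) (bary_push bF)).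
  by case: (bsub_conv SD).
by case: (bsub_conv FD).
Qed.

End Mediant.

(** * Realizations along a stellar sequence *)

Local Open Scope fset_scope.

Section ImageInj.
Variables (T K : choiceType) (io : T -> K) (V : {fset T}).
Hypothesis inj : {in V &, injective io}.
Implicit Types (S F : {fset T}).

Lemma mem_imfset_in S t : S `<=` V -> t \in V -> (io t \in io @` S) = (t \in S).
Proof.
move=> SV tV; apply/imfsetP/idP => [[u /= uS tu]|tS]; last by exists t.
by rewrite (inj tV (fsubsetP SV _ uS) tu).
Qed.

Lemma imfset_sub_in S F : S `<=` V -> F `<=` V ->
  (io @` S `<=` io @` F) = (S `<=` F).
Proof.
move=> SV FV; apply/fsubsetP/fsubsetP => [H t tS|H _ /imfsetP[t /= tS ->]].
  have tV := fsubsetP SV _ tS.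
  by rewrite -(mem_imfset_in FV tV) H // in_imfset.
by rewrite in_imfset //; exact: H.
Qed.

Lemma imfset_inj_in S F : S `<=` V -> F `<=` V -> io @` S = io @` F -> S = F.
Proof.
move=> SV FV E; apply/eqP; rewrite eqEfsubset.
by rewrite -(imfset_sub_in SV FV) -(imfset_sub_in FV SV) E fsubset_refl.
Qed.

End ImageInj.

Lemma sub_imfset (T K : choiceType) (io : T -> K) (V : {fset T}) (F : {fset K}) :
  F `<=` io @` V -> exists2 S, S `<=` V & F = io @` S.
Proof.
move=> FV; exists [fset t in V | io t \in F].
  by apply/fsubsetP => t; rewrite !inE => /andP[].
apply/fsetP => u; apply/idP/imfsetP => [uF|[t /=]]; last first.
  by rewrite !inE => /andP[_ tF] ->.
have /imfsetP[t /= tV ut] := fsubsetP FV _ uF.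
by exists t; rewrite //= !inE tV -ut.
Qed.

Section WComplex.
Variable T : choiceType.
Implicit Types (W : wcomplex T) (S M : {fset T}).

Lemma wfaces_sub W S : is_wcomplex W -> S \in wfaces W -> S `<=` wvertices W.
Proof.
move=> [_ <- _ _] SW; apply/fsubsetP => t tS.
by apply/in_fcover; exists S.
Qed.

Lemma wt_deletion W M t : t \in wvertices (deletion W M) ->
  t \in wvertices W /\ wt (deletion W M) t = wt W t.
Proof.
rewrite /wvertices /wt /deletion /=; case: ifP => // _.
move=> H; have /andP[/negbTE tM tV] : (t \notin M) && (t \in wvertices W).
  by rewrite -in_fsetD -(domf_rem (weight W)).
by rewrite fnd_rem tM.
Qed.

Lemma wvertices_deletion W M : wvertices (deletion W M) =
  if #|` M| == 1%N then wvertices W `\` M else wvertices W.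
Proof. by rewrite /wvertices /=; case: ifP => // _; rewrite domf_rem. Qed.

Lemma wt_subdivision W a b x t : wt (binary_subdivision W a b x) t =
  if t == x then (wt W a + wt W b)%N else wt W t.
Proof. by rewrite /wt fnd_set; case: ifP. Qed.

Lemma wvertices_subdivision W a b x :
  wvertices (binary_subdivision W a b x) = x |` wvertices W.
Proof. by []. Qed.

End WComplex.

Section RealizationStep.
Variables (R : realType) (T : choiceType) (n : nat).
Local Notation K := 'rV[rat]_n.
Implicit Types (W : wcomplex T) (D : {fset {fset K}}) (io : T -> K).

Lemma realization_intro W D io : is_wcomplex W -> regular_complex R D ->
  {in wvertices W &, injective io} ->
  (forall v, v \in wvertices W -> den (io v) = wt W v) ->
  (forall F, F \in D -> F `<=` io @` wvertices W) ->
  (forall S, S `<=` wvertices W -> (S \in wfaces W) = (io @` S \in D)) ->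
  realization R W D io.
Proof.
move=> [nV cov downW _] cD inj dn DV SD; split=> //.
apply/fsetP => u; apply/idP/idP => [/imfsetP[t /= tV ->]|/in_fcover[F /DV /fsubsetP FV /FV]//].
move: (tV); rewrite -cov => /in_fcover[S SW tS].
apply/in_fcover; exists (io @` S); last by rewrite in_imfset.
by rewrite -SD // -cov; apply/fsubsetP => z zS; apply/in_fcover; exists S.
Qed.

Lemma realization_sub W D io F : realization R W D io -> F \in D ->
  F `<=` io @` wvertices W.
Proof.
move=> [_ _ -> _ _] FD; apply/fsubsetP => u uF.
by apply/in_fcover; exists F.
Qed.

Lemma regular_complex_delete D M : regular_complex R D ->
  (forall S, S \in D -> M `<=` S -> S = M) -> regular_complex R (D `\ M).
Proof.
move=> [regD downD intD] maxM.
split=> [S /fsetD1P[_ /regD]//|S F|S F /fsetD1P[_ SD'] /fsetD1P[_ FD]]; last exact: intD.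
move=> /fsetD1P[SM SD'] FS; apply/fsetD1P; split; last exact: downD FS.
by apply: contra_neq SM => FM; apply: maxM; rewrite -?FM.
Qed.

Lemma realization_step W W' s D io : is_wcomplex W -> is_wcomplex W' ->
  is_step W W' s -> realization R W D io ->
  realization R W' (geometric_step R (D, io) s).1 (geometric_step R (D, io) s).2.
Proof.
move=> wW wW' [vs W'E] rW; have [cD inj cov dn SD] := rW.
have downD : down_closed D by case: cD.
have DV := realization_sub rW.
have [_ _ downW _] := wW.
case: s vs W'E => [M|a b x|] /= vs W'E; last by rewrite W'E.
- have [MW maxM] := vs; have MV := wfaces_sub wW MW.
  have V'E := wvertices_deletion W M.
  have V'V : wvertices W' `<=` wvertices W.
    by apply/fsubsetP => t; rewrite W'E => /wt_deletion[].
  apply: realization_intro => //.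
  + apply: regular_complex_delete => // F FD.
    have [G GV GE] := sub_imfset (DV _ FD); rewrite GE in FD *.
    by rewrite (imfset_sub_in inj) // => /maxM ->; rewrite ?SD.
  + by move=> t u tV uV; apply: inj; exact: (fsubsetP V'V).
  + by move=> t; rewrite W'E => /wt_deletion[tV ->]; exact: dn.
  + move=> F /fsetD1P[FM FD]; have [G GV GE] := sub_imfset (DV _ FD).
    rewrite GE in FM FD *; rewrite -SD // in FD.
    have GW' : G \in wfaces W'.
      rewrite W'E; apply/fsetD1P; split=> //.
      by apply: contra_neq FM => ->.
    have /fsubsetP H := wfaces_sub wW' GW'.
    by apply/fsubsetP => _ /imfsetP[t /= tG ->]; rewrite in_imfset //; exact: H.
  move=> S SV'; have SV := fsubset_trans SV' V'V.
  rewrite W'E /= !in_fsetD1 -SD //; congr (~~ _ && _).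
  by apply/eqP/eqP => [->//|/(imfset_inj_in inj SV MV)].
have [ab abW xV] := vs.
have abV := wfaces_sub wW abW.
have [aV bV] : a \in wvertices W /\ b \in wvertices W.
  by move: abV; rewrite fset2_sub => /andP[].
have vw : io a != io b by apply: contraNneq ab => /(inj _ _ aV bV) ->.
have imab (f : T -> K) : f @` [fset a; b] = [fset f a; f b].
  by rewrite imfsetU !imfset_fset1.
have vwD : [fset io a; io b] \in D by rewrite -imab -SD.
have [e med] : exists e, mediant (io a) (io b) e.
  have [regD _ _] := cD.
  by apply: (mediant_exists (regD _ vwD)); rewrite ?inE ?eqxx ?orbT.
rewrite (farey_mediantE R vw med) (blowupE cD vw vwD med).
have fresh := mediant_fresh cD vw vwD med.
have V'E : wvertices W' = x |` wvertices W by rewrite W'E wvertices_subdivision.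
set io' := fun t => _.
have io'E t : t \in wvertices W -> io' t = io t.
  by move=> tV; rewrite /io' ifN //; apply: contraNneq xV => <-.
have ioS S : S `<=` wvertices W -> io' @` S = io @` S.
  by move=> SV; apply: eq_in_imfset => // t /(fsubsetP SV); exact: io'E.
have io'x : io' x = e by rewrite /io' eqxx.
have ioe t : t \in wvertices W -> io t != e.
  move=> tV; apply: contraNneq fresh => <-.
  by rewrite -[fcover D]/(complex_vertices D) -cov in_imfset.
have inj' : {in wvertices W' &, injective io'}.
  move=> t u; rewrite V'E !inE.
  case: (eqVneq t x) => [->|tx] /=; case: (eqVneq u x) => [->|ux] //= tV uV.
  - by rewrite io'x io'E // => ue; case/eqP: (ioe _ uV).
  - by rewrite io'x io'E // => ue; case/eqP: (ioe _ tV).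
  - by rewrite !io'E //; exact: inj.
have VV' : wvertices W `<=` wvertices W' by rewrite V'E fsubsetU1.
(* By [in_bsub], being a face of a subdivision is a condition on the old faces, so it is carried by
   the injection once the new vertex is sent to [e]. *)
have faceE S : S `<=` wvertices W' -> (S \in wfaces W') = (io' @` S \in bsub D (io a) (io b) e).
  move=> SV'; rewrite W'E -[wfaces _]/(bsub (wfaces W) a b x) !in_bsub //; last first.
    by case: wW => _ -> _ _.
  have -> : [fset io a; io b] = io' @` [fset a; b] by rewrite imab !io'E.
  rewrite (imfset_sub_in inj') //; last exact: fsubset_trans abV VV'.
  have xV' : x \in wvertices W' by rewrite V'E fset1U1.
  have eS : (e \in io' @` S) = (x \in S).
    by rewrite -(mem_imfset_in inj' SV' xV') io'x.
  rewrite /unstar eS.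
  case: ifP => xS; last first.
    have SV : S `<=` wvertices W.
      apply/fsubsetP => t tS; have := fsubsetP SV' _ tS.
      by rewrite V'E !inE; case: eqP => // tx; rewrite -tx tS in xS.
    by rewrite SD // ioS.
  have SV : S `\ x `|` [fset a; b] `<=` wvertices W.
    rewrite fsubUset abV andbT; apply/fsubsetP => t; rewrite in_fsetD1 => /andP[tx tS].
    by have := fsubsetP SV' _ tS; rewrite V'E !inE (negbTE tx).
  rewrite SD // imfsetU imab.
  suff : io @` (S `\ x) = (io' @` S) `\ e by move=> ->.
  apply/fsetP => u; rewrite !inE; apply/imfsetP/andP => [[t /= ]|[ue /imfsetP[t /= tS uE]]].
    rewrite in_fsetD1 => /andP[tx tS ->].
    have tV : t \in wvertices W by have := fsubsetP SV' _ tS; rewrite V'E !inE (negbTE tx).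
    by rewrite ioe // -io'E // in_imfset.
  have tx : t != x by apply: contraNneq ue => tx; rewrite uE tx io'x.
  have tV : t \in wvertices W by have := fsubsetP SV' _ tS; rewrite V'E !inE (negbTE tx).
  by exists t; rewrite /= ?in_fsetD1 ?tx // -io'E.
apply: realization_intro => //.
- exact: bsub_complex.
- move=> t; rewrite V'E W'E wt_subdivision !inE; case: (eqVneq t x) => [->|tx] /= tV.
    by rewrite io'x -!dn //; exact: mediant_den.
  by rewrite io'E // dn.
- move=> F /(bsub_conv cD vw vwD med)[+ _]; rewrite V'E /unstar => H.
  apply/fsubsetP => u uF; apply/imfsetP.
  case: (eqVneq u e) => [->|ue]; first by exists x; rewrite //= fset1U1.
  have : u \in io @` wvertices W.
    apply: (fsubsetP (DV _ H)); case: ifP => _ //.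
    by rewrite !inE ue uF.
  by case/imfsetP => t /= tV ->; exists t; rewrite ?fset1Ur // io'E.
Qed.

End RealizationStep.

Section RealizationSequence.
Variables (R : realType) (T : choiceType) (n : nat).
Local Notation K := 'rV[rat]_n.
Variables (W : nat -> wcomplex T) (D : {fset {fset K}}) (io : T -> K).
Hypotheses (sW : stellar W) (rW : realization R (W 0%N) D io).

Lemma step_ofP j : is_step (W j) (W j.+1) (step_of (W j) (W j.+1)).
Proof. by have [s ?] := sW.2 j; apply: xgetPex; exists s. Qed.

Lemma realization_atP j : realization R (W j)
  (realization_at R W D io j).1 (realization_at R W D io j).2.
Proof.
elim: j => //= j IH.
have := realization_step (sW.1 j) (sW.1 j.+1) (step_ofP j) IH.
by case: (realization_at _ _ _ _ _).
Qed.

End RealizationSequence.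

(** * Stellar sequences read off from sequences of geometric complexes *)

Section GeometricSequence.
Variables (R : realType) (n : nat).
Local Notation K := 'rV[rat]_n.
Implicit Types (D : {fset {fset K}}).

Definition geometric_wcomplex D : wcomplex K :=
  WComplex D [fmap v : fcover D => den (val v)].

Lemma fnd_geometric D v :
  (weight (geometric_wcomplex D)).[? v]%fmap = if v \in fcover D then Some (den v) else None.
Proof.
case: ifP => vD; last by rewrite not_fnd // -[_ \notin _]/(~~ (v \in fcover D)) vD.
by rewrite (in_fnd (f := weight (geometric_wcomplex D)) vD) ffunE.
Qed.

Lemma wt_geometric D v : v \in fcover D -> wt (geometric_wcomplex D) v = den v.
Proof. by move=> vD; rewrite /wt fnd_geometric vD. Qed.

Lemma is_wcomplex_geometric D : down_closed D -> fcover D != fset0 ->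
  is_wcomplex (geometric_wcomplex D).
Proof.
move=> downD D0; split=> //= v vD.
by rewrite wt_geometric // den_gt0.
Qed.

(** The geometric counterpart of [is_step]. The last condition on deletions keeps the vertex set
    nonempty, as [is_wcomplex] demands. *)
Variant gstep D : {fset {fset K}} -> Prop :=
| GSubdivide v w e of v != w & [fset v; w] \in D & mediant v w e :
    gstep D (bsub D v w e)
| GDelete M of M \in D & (forall S, S \in D -> M `<=` S -> S = M)
    & fcover (D `\ M) != fset0 : gstep D (D `\ M)
| GStay : gstep D D.

Lemma gstep_complex D D' : gstep D D' -> regular_complex R D -> regular_complex R D'.
Proof.
case=> [v w e vw vwD med|M MD maxM _|] // cD; first exact: bsub_complex.
exact: regular_complex_delete.
Qed.

Lemma fcover_bsub D v w e : regular_complex R D -> v != w -> [fset v; w] \in D ->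
  mediant v w e -> fcover (bsub D v w e) = e |` fcover D.
Proof.
move=> cD vw vwD med; have fresh := mediant_fresh cD vw vwD med.
have downD : down_closed D by case: cD.
have [ve we] := mediant_neq cD vw vwD med.
apply/fsetP => u; rewrite in_fset1U; apply/idP/idP => [/in_fcover[S]|].
  move=> /(bsub_conv cD vw vwD med)[+ _]; rewrite /unstar => H uS.
  case: (eqVneq u e) => //= ue; apply/in_fcover; eexists; first exact: H.
  by case: (e \in S); rewrite ?inE ?ue uS.
case: (eqVneq u e) => /= [-> _|ue uD]; apply/in_fcover.
  exists [fset e]; last exact: fset11.
  rewrite in_bsub // fset2_sub !inE (negbTE ve) /=.
  by rewrite /unstar !inE eqxx /= fsetDv fset0U.
exists [fset u]; last exact: fset11.
rewrite in_bsub // fset2_sub !inE.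
have [S SD uS] := (in_fcover _ _).1 uD.
rewrite /unstar !inE [e == u]eq_sym (negbTE ue) (downD _ _ SD) ?fsub1set // andbT.
by apply/negP => /andP[/eqP vu /eqP wu]; move: vw; rewrite vu wu eqxx.
Qed.

Lemma fcover_gstep D D' : regular_complex R D -> fcover D != fset0 -> gstep D D' ->
  fcover D' != fset0.
Proof.
move=> cD D0 [v w e vw vwD med|M _ _ //|//].
by rewrite (fcover_bsub cD) //; apply/fset0Pn; exists e; rewrite fset1U1.
Qed.

Lemma wcomplex_eq (U : choiceType) (W W' : wcomplex U) : wfaces W = wfaces W' ->
  (forall t, (weight W).[? t] = (weight W').[? t])%fmap -> W = W'.
Proof.
by case: W W' => [F w] [F' w'] /= -> E; congr WComplex; apply/fmapP.
Qed.

Lemma gstep_is_step D D' : regular_complex R D -> gstep D D' ->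
  exists s, is_step (geometric_wcomplex D) (geometric_wcomplex D') s.
Proof.
move=> cD; have downD : down_closed D by case: cD.
case=> [v w e vw vwD med|M MD maxM _|]; last by exists Stay.
  have fresh := mediant_fresh cD vw vwD med.
  exists (Subdivide v w e); split=> //; apply: wcomplex_eq => // t.
  rewrite fnd_set !fnd_geometric (fcover_bsub cD) // in_fset1U.
  case: (eqVneq t e) => //= ->; rewrite !wt_geometric; last 2 first.
  - by apply/in_fcover; exists [fset v; w]; rewrite ?inE ?eqxx ?orbT.
  - by apply/in_fcover; exists [fset v; w]; rewrite ?inE ?eqxx ?orbT.
  by rewrite (mediant_den med).
exists (Delete M); split=> //; apply: wcomplex_eq => // t.
rewrite /apply_step /deletion [weight (WComplex _ _)]/=.
rewrite (fun_if (fun f : {fmap K -> nat} => f.[? t]%fmap)) fnd_rem !fnd_geometric.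
have : t \in fcover (D `\ M) -> t \in fcover D.
  by move/in_fcover => [S /fsetD1P[_ SD] tS]; apply/in_fcover; exists S.
(* A maximal singleton is an isolated vertex and disappears with its face; deleting any other
   maximal set leaves all singletons, hence all vertices. *)
have [/cardfs1P[z ME]|M1] := boolP (#|` M| == 1%N).
  rewrite ME inE; case: eqVneq => [-> _|tz H].
    case: ifP => // /in_fcover[S /fsetD1P[SM SD] zS].
    by case/eqP: SM; rewrite -ME; apply: maxM; rewrite // ME fsub1set.
  suff -> : t \in fcover (D `\ [fset z]) = (t \in fcover D) by [].
  rewrite -ME in H *; apply/idP/idP => [//|/in_fcover[S SD tS]].
  apply/in_fcover; exists [fset t]; rewrite ?inE ?eqxx // (downD _ _ SD) ?fsub1set //.
  by rewrite ME andbT; apply: contra_neq tz => /fset1_inj.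
move=> H; suff -> : t \in fcover (D `\ M) = (t \in fcover D) by [].
apply/idP/idP => [//|/in_fcover[S SD tS]].
apply/in_fcover; exists [fset t]; rewrite ?inE ?eqxx // (downD _ _ SD) ?fsub1set //.
by rewrite andbT; apply: contraNneq M1 => <-; rewrite cardfs1.
Qed.

(** [step_of] picks some step between two complexes, so a subdivision must determine its data: the
    new vertex is the one whose singleton is new, and the edge cut is an old face that is lost. *)
Lemma bsub_determined (U : choiceType) (E : {fset {fset U}}) v w e a b x :
  down_closed E -> v != w -> a != b -> [fset v; w] \in E -> [fset a; b] \in E ->
  e \notin fcover E -> x \notin fcover E -> bsub E v w e = bsub E a b x ->
  x = e /\ [fset a; b] = [fset v; w].
Proof.
move=> downE vw ab vwE abE eE xE EE.
have notin (f : U) S : f \notin fcover E -> S \in E -> f \notin S.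
  by move=> fE SE; apply: contra fE => fS; apply/in_fcover; exists S.
have xab := notin _ _ xE abE; split.
  have : [fset x] \in bsub E a b x.
    rewrite in_bsub // /unstar fset11 fsetDv fset0U abE andbT fset2_sub !inE.
    by apply: contra xab => /andP[/eqP <- _]; rewrite !inE eqxx.
  rewrite -EE in_bsub // /unstar !inE; case: eqP => // _ /andP[_ H].
  by have := notin _ _ xE H; rewrite fset11.
have sub p q y p' q' y' : p != q -> p' != q' -> [fset p'; q'] \in E -> y \notin fcover E ->
   y' \notin fcover E ->
   bsub E p q y = bsub E p' q' y' -> [fset p; q] `<=` [fset p'; q'].
  move=> pq pq' H yE yE' bE; have : [fset p'; q'] \notin bsub E p' q' y'.
    by rewrite in_bsub // fsubset_refl.
  rewrite -bE in_bsub // negb_and negbK => /orP[//|].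
  by rewrite /unstar (negbTE (notin _ _ yE H)) H.
apply/eqP; rewrite eqEfsubset; apply/andP; split.
  by apply: (sub a b x v w e).
by apply: (sub v w e a b x).
Qed.

Variable (D : nat -> {fset {fset K}}).
Hypotheses (cD0 : regular_complex R (D 0%N)) (D0 : fcover (D 0%N) != fset0).
Hypothesis stepD : forall j, gstep (D j) (D j.+1).

Lemma gsequence_complex j : regular_complex R (D j) /\ fcover (D j) != fset0.
Proof.
elim: j => // j [cD nD]; split; first exact: gstep_complex (stepD j) cD.
exact: fcover_gstep (stepD j).
Qed.

Local Notation GW := (fun j => geometric_wcomplex (D j)).

Lemma gsequence_stellar : stellar GW.
Proof.
split=> j; have [cD nD] := gsequence_complex j.
  by apply: is_wcomplex_geometric => //; case: cD.
exact: gstep_is_step.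
Qed.

Lemma gsequence_realization0 : realization R (GW 0%N) (D 0%N) id.
Proof.
have imid (S : {fset K}) : id @` S = S.
  by apply/fsetP => u; apply/imfsetP/idP => [[t /= tS ->]|uS] //; exists u.
by split=> // [v vD|S _]; rewrite ?wt_geometric // imid.
Qed.

Lemma gsequence_realization j :
  (realization_at R GW (D 0%N) id j).1 = D j /\
  {in fcover (D j), (realization_at R GW (D 0%N) id j).2 =1 id}.
Proof.
elim: j => //= j [IH1 IH2].
have imid (S : {fset K}) : S \in D j -> (realization_at R GW (D 0%N) id j).2 @` S = S.
  move=> SD; have E u : u \in S -> (realization_at R GW (D 0%N) id j).2 u = u.
    by move=> uS; apply: IH2; apply/in_fcover; exists S.
  apply/fsetP => u; apply/imfsetP/idP => [[t /= tS ->]|uS]; first by rewrite E.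
  by exists u; rewrite //= E.
have [cD nD] := gsequence_complex j; have downD : down_closed (D j) by case: cD.
have := step_ofP gsequence_stellar j.
case: step_of => [M|a b x|] [vs] /(congr1 (@wfaces _)) /= E; rewrite IH1; last by rewrite E.
- have [MD _] := vs; rewrite E imid //; split=> // u.
  by move=> /in_fcover[S /fsetD1P[_ SD] uS]; apply: IH2; apply/in_fcover; exists S.
have [ab abD xV] := vs.
have [aD bD] : a \in fcover (D j) /\ b \in fcover (D j).
  by split; apply/in_fcover; exists [fset a; b]; rewrite ?inE ?eqxx ?orbT.
have [e med] : exists e, mediant a b e.
  have [regD _ _] := cD.
  by apply: (mediant_exists (regD _ abD)); rewrite ?inE ?eqxx ?orbT.
have xb : [fset x] \in D j.+1.
  rewrite E in_bsub // /unstar fset11 fsetDv fset0U abD andbT fset2_sub !inE.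
  by apply: contra xV => /andP[/eqP <- _].
(* The step chosen by [step_of] is compared with the one in [stepD]. The face [[fset x]] is new,
   which excludes a deletion or a stay, and two subdivisions with the same result agree up to
   exchanging the endpoints. *)
have [xm [abE medx]] : x \notin fcover (D j) /\ [fset a; b] \in D j /\ mediant a b x.
  move: E xb; case: (D j.+1) / (stepD j) => [v w m vw vwD medm|M MD maxM _|] E xb.
  - have mV := mediant_fresh cD vw vwD medm.
    have [xm abvw] := bsub_determined downD vw ab vwD abD mV xV E.
    split; first exact: xV.
    split; first exact: abD.
    have av : a = v \/ a = w by apply/fset2P; rewrite -abvw fset21.
    have bv : b = v \/ b = w by apply/fset2P; rewrite -abvw fset22.
    rewrite xm; case: av bv => [av|aw] [bv|bw].
    - by rewrite av bv eqxx in ab.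
    - by rewrite av bw.
    - by rewrite aw bv; exact: mediantC.
    - by rewrite aw bw eqxx in ab.
  - case/negP: xV; apply/in_fcover; exists [fset x]; rewrite ?fset11 //.
    by move: xb; rewrite in_fsetD1 => /andP[].
  by case/negP: xV; apply/in_fcover; exists [fset x]; rewrite ?fset11.
have ex : e = x by apply: homog_inj; rewrite medx -med.
rewrite !IH2 // (farey_mediantE R ab medx) (blowupE cD ab abD medx); split=> // u.
rewrite E (fcover_bsub cD) // !inE; case: eqP => //= _.
exact: IH2.
Qed.

End GeometricSequence.

Local Close Scope fset_scope.

(** * Sign refinements *)

Local Open Scope fset_scope.

Section Refinement.
Variables (R : realType) (n : nat).
Local Notation K := 'rV[rat]_n.
Implicit Types (u v w e : K) (S F : {fset K}) (D E : {fset {fset K}}).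
Implicit Types (l : 'cV[int]_(n + 1)) (a b : K -> R) (x : 'rV[R]_n).

Inductive gsteps D : {fset {fset K}} -> Prop :=
| gsteps_refl : gsteps D D
| gsteps_cons D1 D2 of gstep D D1 & gsteps D1 D2 : gsteps D D2.

Lemma gsteps_trans D D1 D2 : gsteps D D1 -> gsteps D1 D2 -> gsteps D D2.
Proof. by elim=> // D' D3 D4 st _ IH /IH; exact: gsteps_cons. Qed.

Inductive blowups D : {fset {fset K}} -> Prop :=
| blowups_refl : blowups D D
| blowups_cons v w e D' of v != w & [fset v; w] \in D & mediant v w e
    & blowups (bsub D v w e) D' : blowups D D'.

Lemma blowups_trans D D1 D2 : blowups D D1 -> blowups D1 D2 -> blowups D D2.
Proof. by elim=> // D' v w e D3 vw vwD med _ IH /IH; exact: blowups_cons. Qed.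

Lemma blowups_gsteps D D' : blowups D D' -> gsteps D D'.
Proof.
elim=> [D1|D1 v w e D2 vw vwD med _]; first exact: gsteps_refl.
by apply: gsteps_cons; exact: GSubdivide.
Qed.

Definition refines D' D :=
  forall S, S \in D' -> exists2 F, F \in D & (conv R S `<=` conv R F)%classic.

Lemma refines_trans D D1 D2 : refines D1 D -> refines D2 D1 -> refines D2 D.
Proof.
move=> r1 r2 S /r2[F /r1[G GD FG] SF]; exists G => //.
exact: subset_trans FG.
Qed.

Lemma blowups_complex D D' : blowups D D' -> regular_complex R D ->
  [/\ regular_complex R D', support R D' = support R D & refines D' D].
Proof.
elim=> [D1|D1 v w e D2 vw vwD med _ IH] cD; first by split=> // S SD; exists S.
have [|cD2 sD2 rD2] := IH; first exact: bsub_complex.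
split=> //; first by rewrite sD2 support_bsub.
apply: refines_trans rD2 => S /(bsub_conv cD vw vwD med)[SD sub].
by exists (unstar v w e S).
Qed.

Definition signed l D := forall S, S \in D ->
  (forall v, v \in S -> 0 <= formz l v) \/ (forall v, v \in S -> formz l v <= 0).

Lemma blowups_signed D D' l : blowups D D' -> regular_complex R D ->
  signed l D -> signed l D'.
Proof.
elim=> // D1 v w e D2 vw vwD med _ IH cD sD; apply: IH; first exact: bsub_complex.
move=> S /(bsub_conv cD vw vwD med)[]; rewrite /unstar => SD _.
have [eS|eS] := boolP (e \in S); last by apply: sD; rewrite (negbTE eS) in SD.
rewrite eS in SD; have vS : v \in S `\ e `|` [fset v; w] by rewrite !inE eqxx orbT.
have wS : w \in S `\ e `|` [fset v; w] by rewrite !inE eqxx !orbT.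
case: (sD _ SD) => H; [left|right] => u uS; have [->|ue] := eqVneq u e;
  rewrite ?(formz_mediant _ med) ?addr_ge0 ?H // ?in_fsetU ?in_fsetD1 ?ue ?uS //.
by rewrite -[0]addr0 lerD ?H.
Qed.

Definition oppedge l v w := (0 < formz l v) && (formz l w < 0).

Lemma oppedge_bsub D v w e l (m : int) : regular_complex R D -> v != w ->
  [fset v; w] \in D -> mediant v w e -> oppedge l v w ->
  (forall p q, [fset p; q] \in D -> oppedge l p q -> formz l p - formz l q <= m) ->
  forall p q, [fset p; q] \in bsub D v w e -> oppedge l p q ->
  formz l p - formz l q < m \/ ([fset p; q] \in D /\ [fset p; q] != [fset v; w]).
Proof.
move=> cD vw vwD med /andP[v0 w0] bound p q pqB /andP[p0 q0].
have downD : down_closed D by case: cD.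
have pq : p != q by apply: contraTneq p0 => ->; rewrite -leNgt ltW.
have [pqD _] := bsub_conv cD vw vwD med pqB; move: pqD pqB.
rewrite in_bsub //; last exact: (mediant_fresh cD vw vwD med).
rewrite /unstar; have fe := formz_mediant l med.
have [pe|pe] := eqVneq p e.
  rewrite pe fset21 => H _; left; rewrite fe; rewrite pe eq_sym in pq.
  have vqD : [fset v; q] \in D.
    apply: downD H _; apply/fsubsetP => u; rewrite !inE => /orP[]/eqP->.
      by rewrite eqxx !orbT.
    by rewrite eqxx pq orbT.
  have := bound _ _ vqD; rewrite /oppedge v0 q0 => /(_ isT).
  by move=> le_m; apply: lt_le_trans le_m; rewrite ltrD2r gtrDl.
have [qe|qe] := eqVneq q e.
  rewrite qe fset22 => H _; left; rewrite fe; rewrite qe in pq.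
  have pwD : [fset p; w] \in D.
    apply: downD H _; apply/fsubsetP => u; rewrite !inE => /orP[]/eqP->.
      by rewrite eqxx pq.
    by rewrite eqxx !orbT.
  have := bound _ _ pwD; rewrite /oppedge w0 p0 => /(_ isT).
  by move=> le_m; apply: lt_le_trans le_m; rewrite ltrD2l ltrN2 ltrDr.
rewrite !inE [e == p]eq_sym [e == q]eq_sym (negbTE pe) (negbTE qe) /= => H.
rewrite H andbT => nvw; right; split=> //.
by apply: contraNneq nvw => ->.
Qed.

(* Blowing up an edge on which [formz l v - formz l w] is maximal among the edges
   of opposite signs creates only such edges with a smaller difference, so that
   the maximum and the number of edges reaching it decrease lexicographically. *)
Lemma blowups_no_oppedge D l : regular_complex R D ->
  exists2 D', blowups D D' & forall p q, [fset p; q] \in D' -> ~~ oppedge l p q.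
Proof.
move=> cD; have [m] : exists m : nat, forall p q, [fset p; q] \in D -> oppedge l p q ->
    formz l p - formz l q <= m%:Z.
  exists (\sum_(S <- D) \sum_(u <- S) `|formz l u|)%N => p q pqD /andP[p0 q0].
  have pq : p != q by apply: contraTneq p0 => ->; rewrite -leNgt ltW.
  rewrite (big_fsetD1 _ pqD) /= big_fsetU1 ?inE //= big_seq_fset1.
  rewrite !PoszD !abszE (gtr0_norm p0) (ltr0_norm q0).
  by rewrite lerDl.
elim: m D cD => [|m IHm] D cD bound.
  exists D; first exact: blowups_refl.
  move=> p q pqD; apply/negP => /andP[p0 q0]; have := bound _ _ pqD.
  rewrite /oppedge p0 q0 => /(_ isT); rewrite subr_le0 leNgt.
  by rewrite (lt_trans q0 p0).
pose bad D := [fset S in D | `[< exists p q, [/\ S = [fset p; q], oppedge l p q &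
  formz l p - formz l q = m.+1] >]].
have badP D1 S : S \in bad D1 <-> S \in D1 /\ exists p q,
    [/\ S = [fset p; q], oppedge l p q & formz l p - formz l q = m.+1].
  rewrite /bad in_fset /=; split=> [/andP[? /asboolP]|[? ?]] //.
  by apply/andP; split=> //; exact/asboolP.
have [k] := ubnP #|` bad D|; elim: k D cD bound => // k IHk D cD bound badk.
have [|/fset0Pn[S]] := boolP (bad D == fset0).
  move=> /eqP bad0; apply: IHm => // p q pqD opq.
  have := bound _ _ pqD opq; rewrite le_eqVlt => /orP[/eqP mE|]; last first.
    by rewrite -addn1 PoszD ltzD1.
  have : [fset p; q] \in bad D.
    by apply/badP; split=> //; exists p, q.
  by rewrite bad0 inE.
move=> /badP[SD [v [w [SE ovw vwm]]]].
have vw : v != w.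
  by case/andP: ovw => v0 w0; apply: contraTneq v0 => ->; rewrite -leNgt ltW.
rewrite SE in SD; have [regD downD _] := cD.
have [e med] := mediant_exists (regD _ SD) (fset21 _ _) (fset22 _ _) vw.
have key := oppedge_bsub cD vw SD med ovw bound.
have [|p q pqB opq||D' bD' nD'] := IHk (bsub D v w e).
- exact: bsub_complex.
- by have [/ltW//|[pqD _]] := key _ _ pqB opq; exact: bound.
- rewrite -ltnS; apply: leq_trans badk; apply: fproper_ltn_card.
  rewrite fproperE; apply/andP; split; [apply/fsubsetP => G|apply/fsubsetPn].
    move=> /badP[GB [p [q [GE opq pqm]]]]; rewrite GE in GB *.
    have [|[pqD _]] := key _ _ GB opq; first by rewrite pqm ltxx.
    by apply/badP; split=> //; exists p, q.
  exists [fset v; w]; first by apply/badP; split=> //; exists v, w.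
  apply/negP => /badP[+ _]; rewrite in_bsub //; last exact: (mediant_fresh cD vw SD med).
  by rewrite fsubset_refl.
by exists D' => //; apply: blowups_cons bD'.
Qed.

(** The forms are treated one at a time, since [blowups_signed] keeps the signs already settled. A
    simplex with values of both signs would have an edge with ends of opposite signs. *)
Lemma signed_refinement D (L : seq 'cV[int]_(n + 1)) : regular_complex R D ->
  exists2 D', blowups D D' & forall l, l \in L -> signed l D'.
Proof.
elim: L D => [|l L IH] D cD; first by exists D => //; exact: blowups_refl.
have [D1 b1 n1] := blowups_no_oppedge l cD.
have [cD1 _ _] := blowups_complex b1 cD.
have [D2 b2 s2] := IH _ cD1; exists D2; first exact: blowups_trans b2.
move=> l'; rewrite inE => /orP[/eqP->|/s2 //].
apply: (blowups_signed b2) => // S SD1; have [_ downD _] := cD1.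
have [H|/existsNP[v /not_implyP[vS /negP]]] := pselect (forall v, v \in S -> 0 <= formz l v).
  by left.
rewrite -ltNge => v0; right => w wS; rewrite leNgt; apply/negP => w0.
have /n1 : [fset w; v] \in D1 by apply: downD SD1 _; rewrite fset2_sub wS.
by rewrite /oppedge w0 v0.
Qed.

Lemma form_lN l (z : 'rV[R]_(n + 1)) : form (- l) z = - form l z.
Proof. by rewrite /form map_mxN mulmxN mxE. Qed.

(** The dual covectors compute the candidate coordinates and must be nonnegative. The forms [q k],
    taken with both signs, express that these coordinates give back the point, that is, that it lies
    in the span of [S]. *)
Lemma simplex_forms S : regular_simplex S -> exists P : seq 'cV[int]_(n + 1),
  forall x, conv R S x <-> forall l, l \in P -> 0 <= form l (hpoint x).
Proof.
move=> /regular_dual[c cS].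
pose q (k : 'I_(n + 1)) : 'cV[int]_(n + 1) :=
  delta_mx k 0 - \sum_(v <- S) homog v 0 k *: c v.
have qE k (z : 'rV[R]_(n + 1)) :
    form (q k) z = z 0 k - \sum_(v <- S) form (c v) z * hvertex R v 0 k.
  rewrite form_lB; congr (_ - _).
    rewrite /form mxE (bigD1 k) //= !mxE !eqxx mulr1 big1 ?addr0 // => i ik.
    by rewrite !mxE (negbTE ik) mulr0.
  rewrite /form raddf_sum mulmx_sumr summxE; apply: eq_bigr => v _.
  by rewrite /= map_mxZ -scalemxAr mxE mulrC [hvertex R v 0 k]mxE.
exists ([seq c v | v <- S] ++ [seq q k | k : 'I_(n + 1)] ++ [seq - q k | k : 'I_(n + 1)]).
move=> x; split=> [/convP[a aS] l|H].
  have [a0 _ xE] := aS.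
  have q0 k : form (q k) (hpoint x) = 0.
    rewrite qE {1}xE summxE; apply/eqP; rewrite subr_eq0; apply/eqP.
    rewrite big_seq [RHS]big_seq; apply: eq_bigr => v vS.
    by rewrite mxE (bary_dual cS aS vS).
  rewrite !mem_cat => /or3P[/mapP[v vS ->]|/mapP[k _ ->]|/mapP[k _ ->]].
  - by rewrite -(bary_dual cS aS).
  - by rewrite q0.
  - by rewrite form_lN q0 oppr0.
have q0 k : form (q k) (hpoint x) = 0.
  apply/eqP; rewrite eq_le; apply/andP; split.
    rewrite -oppr_ge0 -form_lN; apply: H.
    by rewrite !mem_cat; apply/or3P/Or33/map_f; rewrite mem_enum.
  apply: H; rewrite !mem_cat; apply/or3P/Or32/map_f; by rewrite mem_enum.
apply/convP; exists (fun v => if v \in S then form (c v) (hpoint x) else 0); split.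
- move=> v; case: ifP => // vS; apply: H.
  by rewrite !mem_cat; apply/or3P/Or31/map_f.
- by move=> v /negbTE ->.
apply/rowP => k; rewrite summxE; apply/eqP; rewrite -subr_eq0; apply/eqP.
rewrite -[RHS](q0 k) qE; congr (_ - _).
by rewrite big_seq [RHS]big_seq; apply: eq_bigr => v ->; rewrite mxE.
Qed.

(** A face of largest cardinality outside [E] is maximal in [D]: a face above it cannot belong to
    [E], which is closed downwards. *)
Lemma gsteps_delete D E : regular_complex R D -> E `<=` D -> down_closed E ->
  fcover E != fset0 -> gsteps D E.
Proof.
move=> cD; have [k] := ubnP #|` D `\` E|; elim: k D cD => // k IHk D cD Dk ED downE E0.
have [/eqP DE|/fset0Pn[S0 S0D]] := boolP (D `\` E == fset0).
  suff -> : D = E by exact: gsteps_refl.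
  by apply/eqP; rewrite eqEfsubset ED andbT -fsetD_eq0 DE.
have [[M /= MDE] _ maxM] :=
  @arg_maxnP _ [` S0D] xpredT (fun S : D `\` E => #|` val S|) isT.
have /fsetDP[MD ME] := MDE.
have maxMD S : S \in D -> M `<=` S -> S = M.
  move=> SD MS; have SDE : S \in D `\` E.
    by rewrite inE SD andbT; apply: contra ME => SE; apply: downE SE MS.
  have := maxM [` SDE] isT; rewrite /= => SM.
  by apply/esym/eqP; rewrite eqEfcard MS.
have EDM : E `<=` D `\ M.
  by apply/fsubsetP => S SE; rewrite in_fsetD1 (fsubsetP ED) // andbT;
    apply: contraNneq ME => <-.
have D0 : fcover (D `\ M) != fset0.
  have /fset0Pn[u /in_fcover[S SE uS]] := E0.
  by apply/fset0Pn; exists u; apply/in_fcover; exists S => //; exact: (fsubsetP EDM).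
apply: gsteps_cons (GDelete MD maxMD D0) _; apply: IHk => //.
  exact: regular_complex_delete.
rewrite -ltnS; apply: leq_trans Dk; apply: fproper_ltn_card.
rewrite fproperE; apply/andP; split; [apply/fsubsetP => S|apply/fsubsetPn].
  by rewrite !inE => /and3P[-> _ ->].
by exists M => //; rewrite !inE eqxx /= andbF.
Qed.

Lemma support_fcover D : (exists x, support R D x) -> fcover D != fset0.
Proof.
move=> [x [S SD /convP[a aS]]]; apply/fset0Pn.
have [S0|/fset0Pn[u uS]] := eqVneq S fset0.
  have := bary_den aS; rewrite S0 big_seq_fset0 => /eqP.
  by rewrite eq_sym oner_eq0.
by exists u; apply/in_fcover; exists S.
Qed.

Lemma fcover_support D : fcover D != fset0 -> exists x, support R D x.
Proof.
move=> /fset0Pn[u /in_fcover[S SD uS]]; exists (map_mx ratr u), S => //.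
apply/convP; exists (vertex_coord R u); apply: bary_sub (bary_vertex R u).
by rewrite fsub1set.
Qed.

Lemma gsteps_support D E : regular_complex R D -> regular_complex R E ->
  fcover E != fset0 -> (support R E `<=` support R D)%classic ->
  exists2 D', gsteps D D' & support R D' = support R E.
Proof.
move=> cD [regE _ _] E0 ED.
have /choice[P PE] : forall S, exists P : seq 'cV[int]_(n + 1), S \in E ->
    forall x, conv R S x <-> forall l, l \in P -> 0 <= form l (hpoint x).
  move=> S; case: (boolP (S \in E)) => [/regE/simplex_forms[P HP]|_].
    by exists P.
  by exists [::].
have [D1 b1 s1] := signed_refinement (flatten [seq P F | F <- E]) cD.
have {}s1 S l : S \in E -> l \in P S -> signed l D1.
  by move=> SE lP; apply: s1; apply/flattenP; exists (P S) => //; exact: map_f.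
have [cD1 supD1 _] := blowups_complex b1 cD.
pose E' := [fset S in D1 | `[< exists2 F, F \in E & (conv R S `<=` conv R F)%classic >]].
have inE' S : S \in E' <-> S \in D1 /\ exists2 F, F \in E & (conv R S `<=` conv R F)%classic.
  by rewrite !inE /=; split=> [/andP[? /asboolP]|[? ?]] //; apply/andP; split => //; exact/asboolP.
have downD1 : down_closed D1 by case: cD1.
have supE' : support R E' = support R E.
  apply/seteqP; split=> x [S].
    by move=> /inE'[SD1 [F FE SF]] /SF Fx; exists F.
  move=> SE Sx; have : support R D1 x by rewrite supD1; apply: ED; exists S.
  move=> [F FD1 /convP[a aF]]; have [a0 aF0 _] := aF.
  (* Keep the face carrying [x] in its relative interior. Since all its coefficients are positive, a
     form that is nonpositive at its vertices and nonnegative at [x] vanishes at all of them; so the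
     inequalities of [S] at [x] extend to the whole face. *)
  pose F' := [fset v in F | a v != 0].
  have aF' : bary F' a x.
    apply: (bary_supp aF) => v; rewrite !inE /= negb_and negbK.
    by case/orP => [/aF0|/eqP].
  have F'D1 : F' \in D1.
    by apply: downD1 FD1 _; apply/fsubsetP => v; rewrite !inE => /andP[].
  exists F'; last by apply/convP; exists a.
  apply/inE'; split=> //; exists S => // y /convP[b bF'].
  have [b0 _ _] := bF'.
  apply/(PE _ SE) => l lP; rewrite (bary_form _ bF').
  rewrite big_seq; apply: sumr_ge0 => v vF'; apply: mulr_ge0 => //.
  rewrite ler0z; case: (s1 _ _ SE lP _ F'D1) => H; first exact: H.
  have /(PE _ SE) /(_ _ lP) := Sx; rewrite (bary_form _ aF') => sum0.
  have : \sum_(v <- F') - (a v * (formz l v)%:~R) == 0.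
    rewrite eq_le; apply/andP; split; first by rewrite sumrN oppr_le0.
    rewrite big_seq; apply: sumr_ge0 => u uF'.
    by rewrite -mulrN mulr_ge0 // -mulrNz ler0z oppr_ge0 H.
  rewrite big_seq psumr_eq0 => [/allP /(_ v vF')|u uF']; last first.
    by rewrite -mulrN mulr_ge0 // -mulrNz ler0z oppr_ge0 H.
  rewrite vF' /= oppr_eq0 mulf_eq0 intr_eq0 => /orP[|/eqP -> //].
  by move: vF'; rewrite !inE /= => /andP[_ /negbTE ->].
exists E' => //.
apply: gsteps_trans (blowups_gsteps b1) _; apply: gsteps_delete => //.
- by apply/fsubsetP => S; rewrite !inE => /andP[].
- move=> S F /inE'[SD1 [G GE SG]] FS; apply/inE'; split; first exact: downD1 FS.
  exists G => // x /convP[a aF]; apply: SG; apply/convP; exists a.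
  exact: bary_sub aF.
by apply: support_fcover; rewrite supE'; exact: fcover_support.
Qed.

End Refinement.

Local Close Scope fset_scope.

(** * McNaughton functions and simplicial complexes *)

Section CubePoints.
Variables (R : realType) (n : nat).
Local Notation K := 'rV[rat]_n.

(** Truncation lets functions on the cube be evaluated at any point. Made of a join with 0 and a
    meet with the unit, it is respected by unital l-homomorphisms. *)
Definition clip1 (r : R) : R := Num.min (Num.max r 0) 1.

Lemma clip1_itv r : 0 <= clip1 r <= 1.
Proof. by rewrite /clip1 le_min ge_min lexx orbT ler01 le_max lexx orbT. Qed.

Lemma clip1_id r : 0 <= r <= 1 -> clip1 r = r.
Proof. by move=> /andP[/max_idPl r0 r1]; rewrite /clip1 r0; apply/min_idPl. Qed.

Lemma clip1_nonexpansive r s : `|clip1 r - clip1 s| <= `|r - s|.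
Proof.
wlog sr : r s / s <= r.
  move=> H; have [/H //|/ltW/H] := leP s r.
  by rewrite distrC (distrC s).
have cle : clip1 s <= clip1 r.
  by rewrite /clip1 le_min2 // le_max2.
rewrite !ger0_norm ?subr_ge0 // /clip1 /Num.min /Num.max.
by case: (ltP r 0); case: (ltP s 0); rewrite ?ltr01;
  try case: (ltP r 1); try case: (ltP s 1); lra.
Qed.

Definition clip (x : 'rV[R]_n) : 'rV[R]_n := \row_i clip1 (x 0 i).

Lemma clip_cube x : cube R n (clip x).
Proof. by move=> i; rewrite mxE clip1_itv. Qed.

Lemma clip_id x : cube R n x -> clip x = x.
Proof. by move=> cx; apply/rowP => i; rewrite mxE clip1_id. Qed.

Definition cubept (x : 'rV[R]_n) : cube R n :=
  exist (fun z => z \in cube R n) _ (mem_set (clip_cube x)).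

Lemma set_val_cubept x : set_val (cubept x) = clip x.
Proof. by []. Qed.

Lemma cubeptK x : cube R n x -> set_val (cubept x) = x.
Proof. exact: clip_id. Qed.

Lemma set_val_cube (x : cube R n) : cube R n (set_val x).
Proof. exact: set_mem (valP x). Qed.

Lemma set_valK (x : cube R n) : cubept (set_val x) = x.
Proof. by apply: val_inj; apply: cubeptK; exact: set_val_cube. Qed.

Lemma continuous_cubeP (f : cube R n -> R) : continuous f <->
  forall (x : cube R n) e, 0 < e -> exists2 d, 0 < d &
    forall y : cube R n, (forall i, `|set_val x 0 i - set_val y 0 i| < d) -> `|f x - f y| < e.
Proof.
split=> [cf x e e0|H x].
  have /cvgrPdist_lt/(_ e e0)/nbhs_ballP[d /= d0 dP] := cf x.
  exists d => // y xy; apply: dP; rewrite -initial_ballE /=; split=> // i j.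
  by rewrite !ord1; exact: xy.
have FF : Filter (nbhs x) by exact: nbhs_filter.
apply/(@cvgrPdist_lt _ _ _ _ FF) => e e0; have [d d0 dP] := H x e e0.
apply/nbhs_ballP; exists d => //= y; rewrite -initial_ballE /= => -[_ xy].
by apply: dP => i; exact: xy.
Qed.

Definition coordinate_fun (i : 'I_n) : cube R n -> R := fun x => set_val x 0 i.

Lemma coordinate_mcN i : coordinate_fun i \in @mcNaughton_pred R n.
Proof.
apply/mcNaughtonP; split.
  by apply/continuous_cubeP => x e e0; exists e => // y; exact.
exists [:: (0, delta_mx 0 i)] => x; exists (0, delta_mx 0 i); rewrite ?inE //.
rewrite /int_affine /= add0r (bigD1 i) //= mxE !eqxx mul1r big1 ?addr0 // => j ji.
by rewrite mxE (negbTE ji) andbF mul0r.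
Qed.

Definition coordinate i : mcNaughton R n := McNaughton (coordinate_mcN i).

Implicit Types (l : 'cV[int]_(n + 1)) (f g : mcNaughton R n) (x y : 'rV[R]_n).

Lemma formE l x : form l (hpoint x) =
  (l (rshift n ord0) 0)%:~R + \sum_(i < n) (l (lshift 1 i) 0)%:~R * x 0 i.
Proof.
rewrite /form mxE big_split_ord /= addrC big_ord1 hpoint_last mul1r mxE.
congr (_ + _); apply: eq_bigr => i _.
by rewrite hpointl mxE mulrC.
Qed.

Definition piece_form (p : int * 'rV[int]_n) : 'cV[int]_(n + 1) :=
  col_mx p.2^T p.1%:M.

Lemma piece_formE p x : int_affine p x = form (piece_form p) (hpoint x).
Proof.
rewrite formE /piece_form col_mxEd mxE eqxx mulr1n; congr (_ + _).
by apply: eq_bigr => i _; rewrite col_mxEu mxE.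
Qed.

Lemma mcN_forms f : exists L : seq 'cV[int]_(n + 1),
  forall x, exists2 l, l \in L & f (cubept x) = form l (hpoint (clip x)).
Proof.
have [_ [s sf]] := (mcNaughtonP f).1 (mcNP f).
exists (map piece_form s) => x; have [p ps ->] := sf (cubept x).
by exists (piece_form p); rewrite ?map_f // piece_formE.
Qed.

Lemma forms_piecewise (f : cube R n -> R) (L : seq 'cV[int]_(n + 1)) :
  (forall x : cube R n, exists2 l, l \in L & f x = form l (hpoint (set_val x))) ->
  int_piecewise f.
Proof.
move=> fL; exists [seq (l (rshift n ord0) 0, (usubmx l)^T) | l <- L] => x.
have [l lL ->] := fL x; eexists; first by apply: map_f; exact: lL.
rewrite formE /int_affine /=; congr (_ + _).
by apply: eq_bigr => i _; rewrite !mxE.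
Qed.

Lemma mcN_path_continuous f x y : cube R n x -> cube R n y ->
  continuous (fun t : R => f (cubept ((1 - t) *: x + t *: y))).
Proof.
move=> cx cy t; apply/cvgrPdist_lt => e e0.
have [/continuous_cubeP cf _] := (mcNaughtonP f).1 (mcNP f).
have [d d0 dP] := cf (cubept ((1 - t) *: x + t *: y)) e e0.
apply/nbhs_ballP; exists d => //= s ts; apply: dP => i.
rewrite !set_val_cubept ![clip _ 0 i]mxE.
apply: le_lt_trans (clip1_nonexpansive _ _) _; rewrite !mxE.
have -> : (1 - t) * x 0 i + t * y 0 i - ((1 - s) * x 0 i + s * y 0 i) =
  (t - s) * (y 0 i - x 0 i) by ring.
rewrite normrM; apply: le_lt_trans ts; rewrite ler_piMr // ler_norml.
by have /andP[? ?] := cx i; have /andP[? ?] := cy i; apply/andP; split; lra.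
Qed.

Lemma bary_exists (S : {fset K}) (a : K -> R) : (forall v, 0 <= a v) ->
  (forall v, v \notin S -> a v = 0) -> \sum_(v <- S) a v * (den v)%:R = 1 ->
  exists x, bary S a x.
Proof.
move=> a0 aS a1; exists (lsubmx (\sum_(v <- S) a v *: hvertex R v)); split=> //.
rewrite /hpoint -[RHS]hsubmxK; congr row_mx.
apply/rowP => i; rewrite !ord1 [RHS]mxE summxE mxE eqxx -a1.
by apply: eq_bigr => v _; rewrite mxE hvertex_last.
Qed.

Lemma conv0 x : ~ conv R (fset0 : {fset K}) x.
Proof. by move=> [a [_ + _]]; rewrite big_seq_fset0 => /eqP; rewrite eq_sym oner_eq0. Qed.

(** Let [l0] be the piece taken at an interior point [b]. Along the segment from [b] to [x], the
    difference of [f] and [l0] is zero or bounded away from zero, because the other pieces differ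
    from [l0] with a constant sign; by continuity it cannot jump. *)
Lemma mcN_affine_simplex f (L : seq 'cV[int]_(n + 1)) (S : {fset K}) :
  S != fset0 ->
  (conv R S `<=` cube R n)%classic ->
  (forall x, conv R S x -> exists2 l, l \in L & f (cubept x) = form l (hpoint x)) ->
  (forall l q, l \in L -> q \in L -> signed (q - l) [fset S]%fset) ->
  exists2 l, l \in L & forall x, conv R S x -> f (cubept x) = form l (hpoint x).
Proof.
move=> /fset0Pn[u uS] Scube fL sL.
pose N : nat := (\sum_(v <- S) den v)%N.
have N0 : (0 < N)%N by rewrite /N (big_fsetD1 u) //= addn_gt0 den_gt0.
(* Equal coefficients, normalized by the sum of the denominators, give a point of the relative
   interior. *)
pose a0 (v : K) : R := if v \in S then N%:R^-1 else 0.
have [b bS] : exists b, bary S a0 b.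
  apply: bary_exists => [v|v /negbTE vS|]; rewrite /a0.
  - by case: ifP => // _; rewrite invr_ge0.
  - by rewrite vS.
  rewrite big_seq; under eq_bigr => v vS do rewrite vS.
  rewrite -big_seq -mulr_sumr -natr_sum mulVf // pnatr_eq0 -lt0n //.
have Sb : conv R S b by apply/convP; exists a0.
have bc := Scube _ Sb; have [l0 l0L fb] := fL b Sb.
exists l0 => // x Sx; have xc := Scube _ Sx.
have [a aS] := (convP _ _).1 Sx; have [a_ge0 _ _] := aS.
pose y (t : R) := (1 - t) *: b + t *: x.
have hy t : hpoint (y t) = (1 - t) *: hpoint b + t *: hpoint x.
  rewrite /hpoint !scale_row_mx add_row_mx; congr row_mx.
  by rewrite -scalerDl subrK scale1r.
have yS t : 0 <= t <= 1 -> conv R S (y t).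
  move=> /andP[t0 t1]; apply/convP; exists (fun v => (1 - t) * a0 v + t * a v).
  have [b0 bS0 bE] := bS; have [_ aS0 aE] := aS; split=> [v|v vS|].
  - by rewrite addr_ge0 ?mulr_ge0 ?subr_ge0.
  - by rewrite bS0 // aS0 // !mulr0 addr0.
  rewrite hy bE aE !scaler_sumr -big_split /=; apply: eq_bigr => v _.
  by rewrite !scalerA scalerDl.
have dE q t : form (q - l0) (hpoint (y t)) =
    (1 - t) * form (q - l0) (hpoint b) + t * form (q - l0) (hpoint x).
  by rewrite hy formD !formZ.
pose beta q := form (q - l0) (hpoint b).
have sgn q : q \in L -> (0 <= beta q /\ 0 <= form (q - l0) (hpoint x)) \/
    (beta q <= 0 /\ form (q - l0) (hpoint x) <= 0).
  move=> qL; have [a0_ge0 _ _] := bS.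
  rewrite /beta !(bary_form _ bS) !(bary_form _ aS).
  case: (sL l0 q l0L qL S (fset11 S)) => H; [left|right]; split;
    rewrite ?[X in _ <= X]big_seq; try (by apply: sumr_ge0 => v vS; rewrite mulr_ge0 ?ler0z ?H);
    rewrite -oppr_ge0 -sumrN big_seq; apply: sumr_ge0 => v vS;
    by rewrite -mulrN mulr_ge0 // -mulrNz ler0z oppr_ge0 H.
have beta0 q : q \in L -> beta q = 0 -> form (q - l0) (hpoint x) = 0.
  move=> qL b0; have Nn0 : (N%:R^-1 : R) != 0 by rewrite invr_eq0 pnatr_eq0 -lt0n.
  suff z0 v : v \in S -> formz (q - l0) v = 0.
    by rewrite (bary_form _ aS) big_seq big1 // => v /z0 ->; rewrite mulr0.
  have sum0 : \sum_(v <- S) (formz (q - l0) v)%:~R = 0 :> R.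
    apply: (mulfI Nn0); transitivity (beta q); last by rewrite b0 mulr0.
    rewrite /beta (bary_form _ bS) mulr_sumr.
    by rewrite big_seq [RHS]big_seq; apply: eq_bigr => w wS; rewrite /a0 wS.
  case: (sL l0 q l0L qL S (fset11 S)) => H vS.
    move/eqP: sum0; rewrite big_seq psumr_eq0 => [/allP/(_ v vS)|w wS]; last by rewrite ler0z H.
    by rewrite vS /= intr_eq0 => /eqP.
  have : \sum_(v <- S) - (formz (q - l0) v)%:~R == 0 :> R by rewrite sumrN sum0 oppr0.
  rewrite big_seq psumr_eq0 => [/allP/(_ v vS)|w wS].
    by rewrite vS /= oppr_eq0 intr_eq0 => /eqP.
  by rewrite oppr_ge0 lerz0 H.
(* [d] is a positive lower bound for the finitely many nonzero gaps at [b]. A piece with zero gap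
   there agrees with [l0] on all of [S], by [beta0]. *)
have [d d0 dL] : exists2 d, 0 < d & forall q, q \in L -> beta q = 0 \/ d <= `|beta q|.
  clear -beta; elim: L => [|q L [d d0 dL]]; first by exists 1.
  have [bq|bq] := eqVneq (beta q) 0.
    by exists d => // q'; rewrite inE => /orP[/eqP->|/dL //]; left.
  exists (Num.min d `|beta q|); first by rewrite lt_min d0 normr_gt0.
  move=> q'; rewrite inE => /orP[/eqP->|/dL [?|H]]; [right|by left|right].
    by rewrite ge_min lexx orbT.
  by rewrite ge_min H.
pose phi t := f (cubept (y t)) - form l0 (hpoint (y t)).
have phid t : 0 <= t <= 1 -> phi t = 0 \/ (1 - t) * d <= `|phi t|.
  move=> t01; have [q qL] := fL (y t) (yS t t01).
  rewrite /phi => ->; rewrite -form_lB dE -/(beta q); have /andP[t0 t1] := t01.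
  case: (dL q qL) => [b0|db]; first by left; rewrite b0 beta0 // !mulr0 addr0.
  right; case: (sgn q qL) => -[s1 s2].
    rewrite ger0_norm // in db.
    rewrite ger0_norm; nra.
  rewrite ler0_norm // in db.
  rewrite ler0_norm; nra.
have phi0 : phi 0 = 0.
  by rewrite /phi /y subr0 scale1r scale0r addr0 fb subrr.
have cphi : continuous phi.
  have phiE : phi = fun s => f (cubept (y s)) -
      ((1 - s) * form l0 (hpoint b) + s * form l0 (hpoint x)).
    by apply/funext => s; rewrite /phi hy formD !formZ.
  rewrite phiE => t; apply: (@cvgB R R^o); first exact: mcN_path_continuous.
  apply: (@cvgD R R^o); apply: cvgM; try exact: cvg_cst; last exact: cvg_id.
  by apply: (@cvgB R R^o); [exact: cvg_cst|exact: cvg_id].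
have phi_lt1 t : 0 <= t < 1 -> phi t = 0.
  move=> /andP[t0 t1]; apply/eqP/negPn/negP => pt.
  have := phid t; rewrite t0 (ltW t1) => /(_ isT)[/eqP|ptd]; first by rewrite (negbTE pt).
  have eta0 : 0 < (1 - t) * d by rewrite mulr_gt0 // subr_gt0.
  (* A nonzero value at [t] would force [phi] through half of its lower bound at some [c <= t],
     where the forbidden gap is even larger. *)
  have [||c] := @IVT _ (fun s => `|phi s|) 0 t ((1 - t) * d / 2) t0.
  - apply: continuous_subspaceT => s.
    by apply: (@continuous_comp _ _ _ phi); [exact: cphi|exact: norm_continuous].
  - by rewrite phi0 normr0 ge_min le_max; apply/andP; split; apply/orP; [left|right]; lra.
  rewrite in_itv /= => /andP[c0 ct] pc.
  have := phid c; rewrite c0 (le_trans ct (ltW t1)) => /(_ isT)[pc0|pcd].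
    by move: pc; rewrite pc0 normr0; lra.
  by move: pcd; rewrite pc; nra.
have : phi 1 = 0.
  apply/eqP/negPn/negP => p1.
  (* At the end point the gap closes, so the value there is obtained as a limit from the left. *)
  have /cvgrPdist_lt/(_ `|phi 1|) := cphi 1.
  rewrite normr_gt0 => /(_ p1)/nbhs_ballP[e /= e0 eP].
  have [m [m0 m1 me]] : exists m : R, [/\ 0 < m, m <= 1 & m < e].
    exists (Num.min (e / 2) 1); rewrite lt_min ge_min gt_min lexx ltr01 orbT.
    by rewrite divr_gt0 // ltr_pdivrMr // ltr_pMr // ltr1n.
  have := eP (1 - m); rewrite (phi_lt1 (1 - m)); last first.
    by apply/andP; split; lra.
  rewrite subr0 ltxx => H; suff /H : ball (1 : R) e (1 - m) by [].
  rewrite /ball /= opprB addrC subrK ger0_norm //.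
  exact: ltW.
rewrite /phi /y subrr scale0r scale1r add0r => /eqP.
by rewrite subr_eq0 => /eqP.
Qed.

End CubePoints.

(** * Functions generated by the coordinates and extension of integer values *)

Section Generated.
Variables (R : realType) (n : nat).
Local Notation K := 'rV[rat]_n.
Implicit Types (l : 'cV[int]_(n + 1)) (f g : mcNaughton R n) (x y : 'rV[R]_n).
Implicit Types (L P : seq 'cV[int]_(n + 1)) (S F : {fset K}) (D : {fset {fset K}}).

Definition lgroup_closed (Q : mcNaughton R n -> Prop) : Prop :=
  [/\ Q lunit, forall i, Q (coordinate R i),
      forall f g, Q f -> Q g -> Q (f - g),
      forall f g, Q f -> Q g -> Q (ljoin f g) &
      forall f g, Q f -> Q g -> Q (lmeet f g)].

(** These are the functions on which a unital l-homomorphism is determined by its values at the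
    coordinates; the impredicative form is their induction principle. *)
Definition generated f := forall Q, lgroup_closed Q -> Q f.

Lemma generated_closed : lgroup_closed generated.
Proof.
split=> [Q|i Q|f g gf gg Q cQ|f g gf gg Q cQ|f g gf gg Q cQ].
- by case.
- by case.
- by case: (cQ) => _ _ H _ _; apply: H; [exact: gf|exact: gg].
- by case: (cQ) => _ _ _ H _; apply: H; [exact: gf|exact: gg].
- by case: (cQ) => _ _ _ _ H; apply: H; [exact: gf|exact: gg].
Qed.

Let generatedB f g : generated f -> generated g -> generated (f - g).
Proof. by case: generated_closed => _ _ + _ _; exact. Qed.

Lemma generated_join f g : generated f -> generated g -> generated (ljoin f g).
Proof. by case: generated_closed => _ _ _ + _; exact. Qed.

Lemma generated_meet f g : generated f -> generated g -> generated (lmeet f g).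
Proof. by case: generated_closed => _ _ _ _; exact. Qed.

Lemma generated0 : generated 0.
Proof.
rewrite -(subrr lunit); apply: generatedB; by case: generated_closed.
Qed.

Lemma generatedD f g : generated f -> generated g -> generated (f + g).
Proof.
move=> gf gg; rewrite -[g]opprK -[- g]add0r; apply: generatedB => //.
by apply: generatedB => //; exact: generated0.
Qed.

Lemma generatedMn f k : generated f -> generated (f *+ k).
Proof.
move=> gf; elim: k => [|k IH]; first exact: generated0.
by rewrite mulrS; exact: generatedD.
Qed.

Lemma generatedMz f (k : int) : generated f -> generated (f *~ k).
Proof.
move=> gf; case: k => k; first exact: generatedMn.
rewrite NegzE mulrNz -[- _]add0r; apply: generatedB; first exact: generated0.
exact: generatedMn.
Qed.

Lemma generated_sum (I : Type) (s : seq I) (F : I -> mcNaughton R n) :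
  (forall i, generated (F i)) -> generated (\sum_(i <- s) F i).
Proof. by move=> gF; elim/big_ind: _ => //; [exact: generated0|exact: generatedD]. Qed.

Lemma mcN_addE f g (x : cube R n) : (f + g) x = f x + g x.
Proof. by []. Qed.

Lemma mcN_subE f g (x : cube R n) : (f - g) x = f x - g x.
Proof. by []. Qed.

Lemma mcN_mulnE f k (x : cube R n) : (f *+ k) x = f x *+ k.
Proof. by elim: k => // k IH; rewrite !mulrS mcN_addE IH. Qed.

Lemma mcN_mulzE f (k : int) (x : cube R n) : (f *~ k) x = f x * k%:~R.
Proof.
case: k => k; first by rewrite -!pmulrn mcN_mulnE mulr_natr.
rewrite NegzE !mulrNz -!pmulrn -[- _]add0r mcN_subE mcN_mulnE.
by rewrite mulrN mulr_natr -[LHS]/(0 - _) sub0r.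
Qed.

Lemma mcN_sumE (I : Type) (s : seq I) (F : I -> mcNaughton R n) (x : cube R n) :
  (\sum_(i <- s) F i) x = \sum_(i <- s) F i x.
Proof.
elim: s => [|i s IH]; first by rewrite !big_nil.
by rewrite !big_cons mcN_addE IH.
Qed.

Lemma mcN_joinE f g (x : cube R n) : ljoin f g x = Num.max (f x) (g x).
Proof. by []. Qed.

Lemma mcN_meetE f g (x : cube R n) : lmeet f g x = Num.min (f x) (g x).
Proof. by []. Qed.

Definition form_mcN l : mcNaughton R n :=
  lunit *~ l (rshift n ord0) 0 + \sum_(i < n) coordinate R i *~ l (lshift 1 i) 0.

Lemma form_mcNE l (x : cube R n) : form_mcN l x = form l (hpoint (set_val x)).
Proof.
rewrite mcN_addE mcN_mulzE mcN_sumE formE mul1r; congr (_ + _).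
by apply: eq_bigr => i _; rewrite mcN_mulzE mulrC.
Qed.

Lemma generated_form l : generated (form_mcN l).
Proof.
have [g1 gc _ _ _] := generated_closed.
apply: generatedD; first exact: generatedMz.
by apply: generated_sum => i; exact: generatedMz.
Qed.

Definition violation P (z : 'rV[R]_(n + 1)) : R :=
  \sum_(l <- P) Num.max (- form l z) 0.

Definition violation_mcN P : mcNaughton R n :=
  \sum_(l <- P) ljoin (form_mcN (- l)) 0.

Lemma violation_mcNE P (x : cube R n) :
  violation_mcN P x = violation P (hpoint (set_val x)).
Proof.
rewrite mcN_sumE; apply: eq_bigr => l _.
by rewrite mcN_joinE form_mcNE form_lN.
Qed.

Lemma generated_violation P : generated (violation_mcN P).
Proof.
apply: generated_sum => l; apply: generated_join; first exact: generated_form.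
exact: generated0.
Qed.

Lemma violation_ge0 P z : 0 <= violation P z.
Proof. by apply: sumr_ge0 => l _; rewrite le_max lexx orbT. Qed.

Lemma violation_eq0 P z : violation P z = 0 <-> forall l, l \in P -> 0 <= form l z.
Proof.
split=> [/eqP|H].
  rewrite psumr_eq0 => [/allP H l /H /eqP E|l _]; last by rewrite le_max lexx orbT.
  by rewrite -oppr_le0 -E le_max lexx.
rewrite /violation big_seq big1 // => l /H l0.
by apply/max_idPr; rewrite oppr_le0.
Qed.

Lemma fpowerset_complex D S : regular_complex R D -> S \in D ->
  regular_complex R (fpowerset S).
Proof.
move=> [regD downD intD] SD.
have sub F : F \in fpowerset S -> F \in D by rewrite fpowersetE; exact: downD.
split=> [F /sub/regD //|F G|F G /sub FD /sub GD]; last exact: intD.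
by rewrite !fpowersetE => FS GF; exact: fsubset_trans FS.
Qed.

Lemma conv_fpowerset S : support R (fpowerset S) = conv R S.
Proof.
apply/seteqP; split=> [x [F FS /convP[a aF]]|x Sx]; last first.
  by exists S => //; rewrite fpowersetE.
rewrite fpowersetE in FS; apply/convP; exists a; exact: bary_sub aF.
Qed.

Lemma support_vertex D F v : F \in D -> v \in F -> support R D (map_mx ratr v).
Proof.
move=> FD vF; exists F => //; apply/convP; exists (vertex_coord R v).
by apply: bary_sub (bary_vertex R v); rewrite fsub1set.
Qed.

Lemma form_rational l (v : K) :
  (den v)%:R * form l (hpoint (map_mx ratr v)) = (formz l v)%:~R :> R.
Proof. by rewrite -formZ -hvertexE form_vertex. Qed.

(* After sign-refinement both sides are affine on every cell, so the inequality
   only has to be checked at the finitely many rational vertices, where a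
   nonzero violation is at least 1. *)
Lemma violation_domination S l P : regular_complex R (fpowerset S) ->
  (forall v : K, conv R S (map_mx ratr v) ->
     (forall q, q \in P -> 0 <= formz q v) -> formz l v <= 0) ->
  exists N : nat, forall x, conv R S x ->
    form l (hpoint x) <= N%:R * violation P (hpoint x).
Proof.
move=> cS dom; have [D1 b1 s1] := signed_refinement P cS.
have [cD1 supD1 _] := blowups_complex b1 cS.
pose N : nat := (\sum_(v <- fcover D1) `|formz l v|)%N.
exists N => x Sx; have : support R D1 x by rewrite supD1 conv_fpowerset.
move=> [F FD1 /convP[a aF]]; have [a0 _ _] := aF.
pose w v : int := \sum_(q <- P) Num.max (- formz q v) 0.
have w0 v : 0 <= w v by apply: sumr_ge0 => q _; rewrite le_max lexx orbT.
have -> : violation P (hpoint x) = \sum_(v <- F) a v * (w v)%:~R.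
  transitivity (\sum_(q <- P) \sum_(v <- F) a v * (Num.max (- formz q v) 0)%:~R); last first.
    rewrite exchange_big; apply: eq_bigr => v _.
    by rewrite rmorph_sum /= mulr_sumr.
  rewrite /violation big_seq [RHS]big_seq; apply: eq_bigr => q qP.
  rewrite (bary_form _ aF); case: (s1 q qP F FD1) => sq.
    have s0 : 0 <= \sum_(v <- F) a v * (formz q v)%:~R.
      by rewrite big_seq; apply: sumr_ge0 => v vF; rewrite mulr_ge0 // ler0z sq.
    rewrite (max_idPr _) ?oppr_le0 // big_seq big1 // => v vF.
    by rewrite (max_idPr _) ?mulr0 // oppr_le0 sq.
  have s0 : 0 <= \sum_(v <- F) a v * (- formz q v)%:~R.
    by rewrite big_seq; apply: sumr_ge0 => v vF; rewrite mulr_ge0 // ler0z oppr_ge0 sq.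
  have E : - (\sum_(v <- F) a v * (formz q v)%:~R) =
      \sum_(v <- F) a v * (- formz q v)%:~R.
    by rewrite -sumrN; apply: eq_bigr => v _; rewrite mulrNz mulrN.
  rewrite E (max_idPl _) // big_seq [RHS]big_seq; apply: eq_bigr => v vF.
  by rewrite (max_idPl _) // oppr_ge0 sq.
rewrite (bary_form _ aF) mulr_sumr big_seq [leRHS]big_seq.
apply: ler_sum => v vF; rewrite mulrCA; apply: ler_wpM2l => //.
rewrite -[N%:R]/((Posz N)%:~R) -intrM ler_int.
have vD1 : v \in fcover D1 by apply/in_fcover; exists F.
have lN : formz l v <= N.
  apply: le_trans (ler_norm _) _; rewrite -abszE lez_nat /N (big_fsetD1 _ vD1) /=.
  exact: leq_addr.
have [wv0|wvn] := eqVneq (w v) 0.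
  rewrite wv0 mulr0; apply: dom.
    by rewrite -conv_fpowerset -supD1; apply: support_vertex vF.
  move=> q qP; move/eqP: wv0; rewrite psumr_eq0 => [/allP/(_ q qP)/eqP E|? _]; last first.
    by rewrite le_max lexx orbT.
  by rewrite -oppr_le0 -E le_max lexx.
apply: le_trans lN _; rewrite ler_peMr //.
by rewrite -gtz0_ge1 lt_neqAle eq_sym wvn w0.
Qed.

Lemma foldr_join (I : eqType) (s : seq I) (F : I -> mcNaughton R n) i0 (x : cube R n) (y : R) :
  F i0 x <= y -> (forall i, i \in s -> F i x <= y) ->
  (exists2 i, i \in s & F i x = y) ->
  foldr (fun i g => ljoin (F i) g) (F i0) s x = y.
Proof.
move=> i0y sy [i is_ iy].
have le s' : {subset s' <= s} -> foldr (fun i g => ljoin (F i) g) (F i0) s' x <= y.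
  elim: s' => //= j s' IH js; rewrite ge_max IH ?andbT.
    by apply: sy; apply: js; rewrite inE eqxx.
  by move=> k ks; apply: js; rewrite inE ks orbT.
apply/eqP; rewrite eq_le le //=.
have: i \in s by []; elim: (s) => //= j s' IH; rewrite in_cons le_max.
by case/orP => [/eqP <-|/IH ->]; rewrite ?iy ?lexx ?orbT.
Qed.

Lemma foldr_meet_eq0 (I : eqType) (s : seq I) (F : I -> mcNaughton R n) (x : cube R n) :
  (forall i, 0 <= F i x) ->
  foldr (fun i g => lmeet (F i) g) lunit s x = 0 <-> exists2 i, i \in s & F i x = 0.
Proof.
move=> F0; elim: s => [|i s IH] /=.
  by split=> [/eqP|[]//]; rewrite oner_eq0.
have s0 : 0 <= foldr (fun i g => lmeet (F i) g) lunit s x.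
  by elim: (s) => //= j s' IH'; rewrite le_min F0.
split.
  rewrite /Num.min; case: ifP => _; first by exists i; rewrite // inE eqxx.
  by move/IH => [j js j0]; exists j; rewrite // inE js orbT.
case=> j; rewrite inE => /orP[/eqP -> ->|js j0]; first exact/min_idPl.
by rewrite (IH.2 _); [exact/min_idPr|exists j].
Qed.

(* If [p S] extends the prescribed values linearly from [S] and [P S] cuts out
   [S], the join over [S] of [p S - N * violation (P S)] is the wanted function
   as soon as [N] is large. *)
Lemma extension D (val : K -> int) : regular_complex R D ->
  (support R D `<=` cube R n)%classic ->
  exists2 f, generated f & forall S a x, S \in D -> bary S a x ->
    f (cubept x) = \sum_(v <- S) a v * (val v)%:~R.
Proof.
move=> cD Dcube; have [regD downD _] := cD.
have [->|/fset0Pn[S0 S0D]] := eqVneq D fset0.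
  by exists 0; [exact: generated0|move=> S a x; rewrite inE].
have /choice[P PE] : forall S, exists P, S \in D ->
    forall x, conv R S x <-> forall l, l \in P -> 0 <= form l (hpoint x).
  move=> S; case: (boolP (S \in D)) => [/regD/(simplex_forms R)[P HP]|_].
    by exists P.
  by exists [::].
have /choice[p pE] : forall S, exists p : 'cV[int]_(n + 1), S \in D ->
    forall v, v \in S -> formz p v = val v.
  move=> S; case: (boolP (S \in D)) => [/regD/regular_dual[c cS]|_]; last by exists 0.
  exists (\sum_(w <- S) val w *: c w) => _ v vS.
  rewrite /formz mulmx_sumr summxE (big_fsetD1 v) //= -scalemxAr mxE cS // eqxx mxE mulr1.
  rewrite big_seq big1 ?addr0 // => w; rewrite !inE => /andP[wv wS].
  by rewrite -scalemxAr mxE cS // eq_sym (negbTE wv) !mxE mul0rn mulr0.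
have pval S a x : S \in D -> bary S a x ->
    form (p S) (hpoint x) = \sum_(v <- S) a v * (val v)%:~R.
  move=> SD aS; rewrite (bary_form _ aS) big_seq [RHS]big_seq.
  by apply: eq_bigr => v vS; rewrite pE.
have indep S T a b x : S \in D -> T \in D -> bary S a x -> bary T b x ->
    \sum_(v <- S) a v * (val v)%:~R = \sum_(v <- T) b v * (val v)%:~R :> R.
  move=> SD TD aS bT; have ab := bary_uniq cD SD TD aS bT.
  have E (G : {fset K}) : (forall v, v \notin G -> a v = 0) -> \sum_(v <- G) a v * (val v)%:~R =
      \sum_(v <- (G `|` S `|` T)%fset) a v * (val v)%:~R :> R.
    move=> aG; apply: big_fset_incl; first by apply/fsubsetP => v; rewrite !inE => ->.
    by move=> v _ /aG ->; rewrite mul0r.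
  have [_ aS0 _] := aS; have [_ bT0 _] := bT.
  transitivity (\sum_(v <- T) a v * (val v)%:~R); last by apply: eq_bigr => v _; rewrite ab.
  rewrite (E S) // (E T); last by move=> v vT; rewrite ab bT0.
  by apply: eq_fbigl => v; rewrite !inE; case: (v \in S); case: (v \in T).
have /choice[N0 N0E] : forall ST : {fset K} * {fset K}, exists N : nat,
    ST.1 \in D -> ST.2 \in D -> forall x, conv R ST.2 x ->
    form (p ST.1 - p ST.2) (hpoint x) <= N%:R * violation (P ST.1) (hpoint x).
  move=> [S T] /=; case: (boolP (S \in D)) => [SD|_]; last by exists 0%N.
  case: (boolP (T \in D)) => [TD|_]; last by exists 0%N.
  have [|N HN] := @violation_domination T (p S - p T) (P S) (fpowerset_complex cD TD).
    move=> v Tv vP; have Sv : conv R S (map_mx ratr v).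
      apply/(PE _ SD) => q /vP q0; rewrite -(pmulr_rge0 _ (x := (den v)%:R)) ?ltr0n ?den_gt0 //.
      by rewrite form_rational ler0z.
    have [a aS] := (convP _ _).1 Sv; have [b bT] := (convP _ _).1 Tv.
    rewrite -(ler_int R) -form_rational form_lB (pval _ _ _ SD aS) (pval _ _ _ TD bT).
    by rewrite (indep _ _ _ _ _ SD TD aS bT) subrr mulr0.
  by exists N.
pose N S : nat := (\sum_(T <- D) N0 (S, T))%N.
pose G S := form_mcN (p S) - violation_mcN (P S) *+ N S.
have GE S x : cube R n x -> G S (cubept x) =
    form (p S) (hpoint x) - (N S)%:R * violation (P S) (hpoint x).
  move=> cx; rewrite mcN_subE mcN_mulnE form_mcNE violation_mcNE cubeptK //.
  by rewrite mulr_natl.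
exists (foldr (fun S g => ljoin (G S) g) (G S0) D).
  have gG S : generated (G S).
    apply: generatedB; first exact: generated_form.
    by apply: generatedMn; exact: generated_violation.
  by elim: (enum_fset D) => //= S s IH; apply: generated_join.
move=> T a x TD aT.
have Tx : conv R T x by apply/convP; exists a.
have cx : cube R n x by apply: Dcube; exists T.
have le S : S \in D -> G S (cubept x) <= \sum_(v <- T) a v * (val v)%:~R.
  move=> SD; rewrite GE // lerBlDr -lerBlDl -(pval _ _ _ TD aT) -form_lB.
  apply: le_trans (N0E (S, T) SD TD x Tx) _ => /=.
  rewrite ler_wpM2r ?violation_ge0 // ler_nat /N (big_fsetD1 _ TD) /=.
  exact: leq_addr.
apply: foldr_join; first exact: le.
  by move=> S; exact: le.
exists T => //; rewrite GE // (pval _ _ _ TD aT).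
by rewrite ((violation_eq0 _ _).2 ((PE _ TD x).1 Tx)) mulr0 subr0.
Qed.

(** The meet, over the simplexes, of the violations of their inequalities vanishes exactly on the
    union; the base [lunit] of the fold adds no zero. *)
Lemma support_zeroset D : regular_complex R D ->
  exists2 f, generated f & forall x, cube R n x ->
    (f (cubept x) = 0 <-> support R D x).
Proof.
move=> [regD _ _].
have /choice[P PE] : forall S, exists P, S \in D ->
    forall x, conv R S x <-> forall l, l \in P -> 0 <= form l (hpoint x).
  move=> S; case: (boolP (S \in D)) => [/regD/(simplex_forms R)[P HP]|_].
    by exists P.
  by exists [::].
exists (foldr (fun S g => lmeet (violation_mcN (P S)) g) lunit D).
  elim: (enum_fset D) => [|S s IH] /=; first by case: generated_closed.
  by apply: generated_meet => //; exact: generated_violation.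
move=> x cx; rewrite foldr_meet_eq0 => [|S]; last by rewrite violation_mcNE violation_ge0.
split=> [[S SD]|[S SD Sx]]; rewrite ?violation_mcNE ?cubeptK //.
  by move/violation_eq0/(PE _ SD) => Sx; exists S.
exists S => //; rewrite violation_mcNE cubeptK //.
by apply/violation_eq0; apply/(PE _ SD).
Qed.

(** On a refinement where [f] is affine with integer coefficients on each simplex, its vertex values
    times the denominators are integers; the generated function extending them has the same affine
    restrictions. *)
Lemma mcN_generated D f : regular_complex R D ->
  (support R D `<=` cube R n)%classic ->
  exists2 g, generated g & forall x, support R D x -> f (cubept x) = g (cubept x).
Proof.
move=> cD Dcube; have [L fL] := mcN_forms f.
have [D1 b1 s1] := signed_refinement [seq q - l | q <- L, l <- L] cD.
have [cD1 supD1 _] := blowups_complex b1 cD.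
have aff S : S \in D1 -> exists l,
    forall x, conv R S x -> f (cubept x) = form l (hpoint x).
  move=> SD; have Scube : (conv R S `<=` cube R n)%classic.
    by move=> x Sx; apply: Dcube; rewrite -supD1; exists S.
  have [->|S0] := eqVneq S fset0; first by exists 0 => x /conv0.
  have [|l q lL qL F|l _ fl] := @mcN_affine_simplex _ _ f L S S0 Scube.
  - move=> x /Scube cx; have [l lL E] := fL x.
    by exists l; rewrite // E clip_id.
  - by rewrite inE => /eqP ->; apply: s1 => //; exact: allpairs_f.
  - by exists l.
have /choice[val valE] : forall v : K, exists z : int, v \in fcover D1 ->
    z%:~R = (den v)%:R * f (cubept (map_mx ratr v)) :> R.
  move=> v; have [/in_fcover[S SD vS]|_] := boolP (v \in fcover D1); last by exists 0.
  have [l fl] := aff S SD; exists (formz l v) => _; rewrite fl ?form_rational //.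
  apply/convP; exists (vertex_coord R v).
  by apply: bary_sub (bary_vertex R v); rewrite fsub1set.
have [|g gg gE] := extension val cD1; first by rewrite supD1.
exists g => // x; rewrite -supD1 => -[S SD Sx].
have [a aS] := (convP _ _).1 Sx; rewrite (gE _ _ _ SD aS).
have [l fl] := aff S SD; rewrite fl // (bary_form _ aS) big_seq [RHS]big_seq.
apply: eq_bigr => v vS; rewrite valE; last by apply/in_fcover; exists S.
rewrite fl ?form_rational //; apply/convP; exists (vertex_coord R v).
by apply: bary_sub (bary_vertex R v); rewrite fsub1set.
Qed.

End Generated.

(** * Isomorphisms as tuples of McNaughton functions *)

Section Composition.
Variables (R : realType) (n m : nat).
Implicit Types (f : mcNaughton R n) (g : 'I_n -> mcNaughton R m).

Definition tuple_map g (y : 'rV[R]_m) : 'rV[R]_n := clip (\row_i g i (cubept y)).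

Lemma tuple_map_cube g y : cube R n (tuple_map g y).
Proof. exact: clip_cube. Qed.

Lemma cubept_tuple_map g y :
  set_val (cubept (tuple_map g y)) = tuple_map g y.
Proof. exact: cubeptK (tuple_map_cube g y). Qed.

Definition comp_fun f g : cube R m -> R :=
  fun y => f (cubept (tuple_map g (set_val y))).

Lemma comp_mcN f g : comp_fun f g \in @mcNaughton_pred R m.
Proof.
pose cg i : mcNaughton R m := lmeet (ljoin (g i) 0) lunit.
have cgE i y : cg i (cubept y) = tuple_map g y 0 i by rewrite !mxE.
apply/mcNaughtonP; split.
  have [/continuous_cubeP cf _] := (mcNaughtonP f).1 (mcNP f).
  apply/continuous_cubeP => x e e0.
  have [d d0 dP] := cf (cubept (tuple_map g (set_val x))) e e0.
  have /choice[d1 d1P] : forall i, exists d1, 0 < d1 /\ forall y : cube R m,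
      (forall j, `|set_val x 0 j - set_val y 0 j| < d1) -> `|cg i x - cg i y| < d.
    move=> i; have [/continuous_cubeP cgi _] := (mcNaughtonP (cg i)).1 (mcNP (cg i)).
    by have [d1 d10 H] := cgi x d d0; exists d1.
  exists (\big[Num.min/1]_i d1 i).
    by elim/big_ind: _ => // [a b|i _]; [rewrite lt_min => -> ->|case: (d1P i)].
  move=> y xy; apply: dP => i; rewrite !cubept_tuple_map.
  rewrite -!cgE !set_valK; have [_ H] := d1P i; apply: H => j.
  apply: lt_le_trans (xy j) _; rewrite (bigD1 i) //=.
  by rewrite ge_min lexx.
have [L fL] := mcN_forms f.
have [Lg gL] := choice (fun i => mcN_forms (cg i)).
pose A := flatten [seq Lg i | i : 'I_n].
pose comb (l : 'cV[int]_(n + 1)) (q : 'I_n -> 'cV[int]_(m + 1)) : 'cV[int]_(m + 1) :=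
  l (rshift n ord0) 0 *: delta_mx (rshift m ord0) 0 +
  \sum_i l (lshift 1 i) 0 *: q i.
(* The pieces of the composition are the substitutions of pieces of the truncated tuple into pieces
   of [f]. A choice of pieces is encoded by positions in [A], so that there are finitely many
   choices. *)
apply: (@forms_piecewise R m (comp_fun f g)
  [seq comb l (fun i => nth 0 A (phi i)) |
    l <- L, phi : {ffun 'I_n -> 'I_(size A)} <- enum {: {ffun 'I_n -> 'I_(size A)}}]).
move=> y; rewrite /comp_fun; have [l lL ->] := fL (tuple_map g (set_val y)).
rewrite clip_id; last exact: tuple_map_cube.
have /choice[q qP] : forall i, exists q, q \in Lg i /\
    cg i (cubept (set_val y)) = form q (hpoint (clip (set_val y))).
  by move=> i; have [q ? ?] := gL i (set_val y); exists q.
have qA i : q i \in A.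
  by apply/flattenP; exists (Lg i); [apply: map_f; rewrite mem_enum|case: (qP i)].
have qs i : (index (q i) A < size A)%N by rewrite index_mem.
exists (comb l (fun i => nth 0 A ([ffun i => Ordinal (qs i)] i))).
  by apply: allpairs_f => //; rewrite mem_enum.
rewrite formE /form map_mxD mulmxDr mxE raddf_sum mulmx_sumr summxE; congr (_ + _).
  rewrite map_mxZ -scalemxAr mxE -[LHS]mulr1; congr (_ * _).
  rewrite mxE (bigD1 (rshift m ord0)) //= hpoint_last !mxE !eqxx mulr1.
  by rewrite big1 ?addr0 // => j jr; rewrite !mxE (negbTE jr) mulr0.
apply: eq_bigr => i _; rewrite /= map_mxZ -scalemxAr [RHS]mxE; congr (_ * _).
rewrite ffunE /= nth_index // -cgE; case: (qP i) => _ ->.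
by rewrite clip_id //; exact: set_val_cube.
Qed.

Definition comp f g : mcNaughton R m := McNaughton (comp_mcN f g).

Lemma compE f g (y : cube R m) : comp f g y = f (cubept (tuple_map g (set_val y))).
Proof. by []. Qed.

End Composition.

Section QuotientIso.
Variables (R : realType) (T T' : choiceType) (n m : nat).
Variables (W : nat -> wcomplex T) (W' : nat -> wcomplex T').
Variables (D : {fset {fset 'rV[rat]_n}}) (io : T -> 'rV[rat]_n).
Variables (D' : {fset {fset 'rV[rat]_m}}) (io' : T' -> 'rV[rat]_m).

Local Notation P := (orbit_support R W D io).
Local Notation Q := (orbit_support R W' D' io').

(* [g] and [h] induce mutually inverse germs of maps along the two orbits. *)
Definition orbit_equivalence (g : 'I_n -> mcNaughton R m) (h : 'I_m -> mcNaughton R n) : Prop :=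
  [/\ exists i, forall x, cube R n x -> P i x -> tuple_map g (tuple_map h x) = x,
      exists j, forall y, cube R m y -> Q j y -> tuple_map h (tuple_map g y) = y,
      forall i, exists j, forall y, cube R m y -> Q j y -> P i (tuple_map g y) &
      forall j, exists i, forall x, cube R n x -> P i x -> Q j (tuple_map h x)].

Lemma orbit_idealE (f : mcNaughton R n) : f \in orbit_ideal W D io <->
  exists j, forall x, cube R n x -> P j x -> f (cubept x) = 0.
Proof.
rewrite orbit_idealP; split=> -[j H]; exists j => x.
  by move=> cx Px; apply: H; rewrite cubeptK.
by move=> Px; rewrite -[x]set_valK; apply: H => //; exact: set_val_cube.
Qed.

End QuotientIso.

Section QuotientMap.
Variables (R : realType) (T T' : choiceType) (n m : nat).
Variables (W : nat -> wcomplex T) (W' : nat -> wcomplex T').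
Variables (D : {fset {fset 'rV[rat]_n}}) (io : T -> 'rV[rat]_n).
Variables (D' : {fset {fset 'rV[rat]_m}}) (io' : T' -> 'rV[rat]_m).
Local Notation P := (orbit_support R W D io).
Local Notation Q := (orbit_support R W' D' io').
Local Notation I := (orbit_ideal W D io : lIdeal (mcNaughton R n)).
Local Notation J := (orbit_ideal W' D' io' : lIdeal (mcNaughton R m)).

Variable (g : 'I_n -> mcNaughton R m).
Hypothesis gQP : forall i, exists j, forall y, cube R m y -> Q j y -> P i (tuple_map g y).

Definition quotient_map (x : lquot I) : lquot J := lquot_proj J (comp (repr x) g).

(** Independence of the representative: functions that agree on a term of the first orbit agree,
    after composition with [g], on a term of the second, by [gQP]. *)
Lemma quotient_map_proj f : quotient_map (lquot_proj I f) = lquot_proj J (comp f g).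
Proof.
apply/lquot_projE.
have /orbit_idealE[i Hi] := repr_lquot_proj I f.
have [j Hj] := gQP i; apply/orbit_idealE; exists j => y cy Qy.
rewrite mcN_subE !compE cubeptK //.
exact: (Hi _ (tuple_map_cube _ _) (Hj _ cy Qy)).
Qed.

Lemma quotient_map_hom : unital_lhom quotient_map.
Proof.
have compD f1 f2 : comp (f1 + f2) g = comp f1 g + comp f2 g by apply: mcN_ext.
have compU f1 f2 : comp (ljoin f1 f2) g = ljoin (comp f1 g) (comp f2 g) by apply: mcN_ext.
have compI f1 f2 : comp (lmeet f1 f2) g = lmeet (comp f1 g) (comp f2 g) by apply: mcN_ext.
have comp1 : comp lunit g = lunit by apply: mcN_ext.
split.
- elim/lquot_ind=> a; elim/lquot_ind=> b.
  by rewrite -lquot_projD !quotient_map_proj compD lquot_projD.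
- elim/lquot_ind=> a; elim/lquot_ind=> b.
  by rewrite -[ljoin _ _]lquot_projU !quotient_map_proj compU lquot_projU.
- elim/lquot_ind=> a; elim/lquot_ind=> b.
  by rewrite -[lmeet _ _]lquot_projI !quotient_map_proj compI lquot_projI.
by rewrite [lunit]/(lquot_proj I lunit) quotient_map_proj comp1.
Qed.

End QuotientMap.

Section IsoOfEquivalence.
Variables (R : realType) (T T' : choiceType) (n m : nat).
Variables (W : nat -> wcomplex T) (W' : nat -> wcomplex T').
Variables (D : {fset {fset 'rV[rat]_n}}) (io : T -> 'rV[rat]_n).
Variables (D' : {fset {fset 'rV[rat]_m}}) (io' : T' -> 'rV[rat]_m).

Lemma equivalence_iso (g : 'I_n -> mcNaughton R m) (h : 'I_m -> mcNaughton R n) :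
  orbit_equivalence W W' D io D' io' g h ->
  unital_liso (stellar_group_of R W D io) (stellar_group_of R W' D' io').
Proof.
move=> [[i gh] [j hg] gQP hPQ].
exists (@quotient_map _ _ _ _ _ W W' D io D' io' g); split.
  exact: quotient_map_hom.
exists (@quotient_map _ _ _ _ _ W' W D' io' D io h).
  elim/lquot_ind => f; rewrite !quotient_map_proj //.
  apply/lquot_projE/orbit_idealE; exists i => x cx Px.
  by rewrite mcN_subE !compE !(cubept_tuple_map, cubeptK) // gh // subrr.
elim/lquot_ind => f; rewrite !quotient_map_proj //.
apply/lquot_projE/orbit_idealE; exists j => y cy Qy.
by rewrite mcN_subE !compE !(cubept_tuple_map, cubeptK) // hg // subrr.
Qed.

(** The tuple lifts the images of the coordinates. The formula holds for generated functions, both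
    sides being l-homomorphisms, and passes to all functions because the tuple maps a term of the
    second orbit into the support of [D], where every function agrees with a generated one. *)
Lemma iso_tuple (eta : stellar_group_of R W D io -> stellar_group_of R W' D' io') :
  regular_complex R D -> (support R D `<=` cube R n)%classic ->
  unital_lhom eta -> exists g : 'I_n -> mcNaughton R m,
    forall f, eta (lquot_proj _ f) = lquot_proj _ (comp f g).
Proof.
move=> cD Dcube [etaD etaU etaI eta1].
pose pI : mcNaughton R n -> stellar_group_of R W D io := @lquot_proj _ (orbit_ideal W D io).
pose pJ : mcNaughton R m -> stellar_group_of R W' D' io' := @lquot_proj _ (orbit_ideal W' D' io').
pose g i : mcNaughton R m := repr (eta (pI (coordinate R i))); exists g.
have eta0 : eta 0 = 0 by apply: (addrI (eta 0)); rewrite -etaD !addr0.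
have etaN x : eta (- x) = - eta x.
  by apply: (addrI (eta x)); rewrite -etaD !subrr.
have [pID pIU pII pI1] : unital_lhom pI by exact: lquot_proj_hom.
have [pJD pJU pJI pJ1] : unital_lhom pJ by exact: lquot_proj_hom.
have pI0 : pI 0 = 0 by apply: (addrI (pI 0)); rewrite -pID !addr0.
have pJ0 : pJ 0 = 0 by apply: (addrI (pJ 0)); rewrite -pJD !addr0.
have pIN x : pI (- x) = - pI x by apply: (addrI (pI x)); rewrite -pID !subrr.
have pJN x : pJ (- x) = - pJ x by apply: (addrI (pJ x)); rewrite -pJD !subrr.
have gen f : generated f -> eta (pI f) = pJ (comp f g).
  move=> gf; apply: (gf (fun f => eta (pI f) = pJ (comp f g))); split.
  - rewrite pI1 eta1 -pJ1; congr pJ; exact: mcN_ext.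
  (* Composition yields the truncation of [g i]; [eta] commutes with truncation, which fixes the
     coordinate functions. *)
  - move=> i; have -> : comp (coordinate R i) g = lmeet (ljoin (g i) 0) lunit.
      apply: mcN_ext => y; rewrite compE -[LHS]/(set_val (cubept (tuple_map g (set_val y))) 0 i).
      by rewrite cubept_tuple_map // mxE mxE set_valK.
    have pJK x : pJ (repr x) = x by exact: lquot_projK.
    rewrite pJI pJU pJ1 pJ0 /g pJK -eta0 -eta1 -pI1 -pI0 -etaU -etaI -pIU -pII.
    congr eta; congr pI; apply: mcN_ext => x; rewrite mcN_meetE mcN_joinE.
    by have := set_val_cube x i; move/clip1_id => E; rewrite -[LHS]/(set_val x 0 i) -[LHS]E.
  - move=> f1 f2 E1 E2; rewrite pID pIN etaD etaN E1 E2 -pJN -pJD; congr pJ; exact: mcN_ext.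
  - move=> f1 f2 E1 E2; rewrite pIU etaU E1 E2 -pJU; congr pJ; exact: mcN_ext.
  - move=> f1 f2 E1 E2; rewrite pII etaI E1 E2 -pJI; congr pJ; exact: mcN_ext.
(* A generated function with zero set the support of [D] has class 0, so its composition with [g]
   vanishes on some term of the second orbit. *)
have gsupp : exists j, forall y, cube R m y -> orbit_support R W' D' io' j y ->
    support R D (tuple_map g y).
  have [z gz zE] := support_zeroset cD.
  have : comp z g \in orbit_ideal W' D' io'.
    apply/lquot_proj_ker; rewrite -[lquot_proj _ _]/(pJ _) -gen //.
    rewrite (_ : pI z = 0) ?eta0 //; apply/lquot_proj_ker/orbit_idealE.
    by exists 0%N => x cx Px; apply/zE.
  move/orbit_idealE => [j H]; exists j => y cy Qy; apply/zE; first exact: tuple_map_cube.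
  by have := H y cy Qy; rewrite compE cubeptK.
move=> f; have [f' gf' fE] := mcN_generated f cD Dcube.
rewrite -[lquot_proj _ f]/(pI f) -[RHS]/(pJ _).
have -> : pI f = pI f'.
  apply/lquot_projE/orbit_idealE; exists 0%N => x cx Px.
  by rewrite mcN_subE fE // subrr.
rewrite gen //; apply/lquot_projE/orbit_idealE; have [j H] := gsupp; exists j => y cy Qy.
by rewrite mcN_subE !compE cubeptK // fE ?subrr //; exact: H.
Qed.

End IsoOfEquivalence.

Section EquivalenceOfIso.
Variables (R : realType) (T T' : choiceType) (n m : nat).
Variables (W : nat -> wcomplex T) (W' : nat -> wcomplex T').
Variables (D : {fset {fset 'rV[rat]_n}}) (io : T -> 'rV[rat]_n).
Variables (D' : {fset {fset 'rV[rat]_m}}) (io' : T' -> 'rV[rat]_m).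

Lemma tuple_orbit (eta : stellar_group_of R W D io -> stellar_group_of R W' D' io') g :
  (forall i, regular_complex R (realization_at R W D io i).1) ->
  unital_lhom eta ->
  (forall f, eta (lquot_proj _ f) = lquot_proj _ (comp f g)) ->
  forall i, exists j, forall y, cube R m y -> orbit_support R W' D' io' j y ->
    orbit_support R W D io i (tuple_map g y).
Proof.
move=> cW [etaD _ _ _] etaE i.
have eta0 : eta 0 = 0 by apply: (addrI (eta 0)); rewrite -etaD !addr0.
have [z _ zE] := support_zeroset (cW i).
have : comp z g \in orbit_ideal W' D' io'.
  apply/lquot_proj_ker; rewrite -etaE.
  rewrite -[RHS]eta0; congr eta; apply/lquot_proj_ker/orbit_idealE.
  by exists i => x cx Px; apply/zE.
move/orbit_idealE => [j H]; exists j => y cy Qy; apply/zE; first exact: tuple_map_cube.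
by have := H y cy Qy; rewrite compE cubeptK.
Qed.

Lemma tuple_inverse (eta : stellar_group_of R W D io -> stellar_group_of R W' D' io')
    (theta : stellar_group_of R W' D' io' -> stellar_group_of R W D io) g h :
  cancel eta theta ->
  (forall f, eta (lquot_proj _ f) = lquot_proj _ (comp f g)) ->
  (forall f, theta (lquot_proj _ f) = lquot_proj _ (comp f h)) ->
  exists i, forall x, cube R n x -> orbit_support R W D io i x ->
    tuple_map g (tuple_map h x) = x.
Proof.
move=> etaK etaE thetaE.
have /choice[j jP] : forall k : 'I_n, exists j, forall x, cube R n x ->
    orbit_support R W D io j x -> tuple_map g (tuple_map h x) 0 k = x 0 k.
  move=> k; have : comp (comp (coordinate R k) g) h - coordinate R k \in orbit_ideal W D io.
    by apply/lquot_projE; rewrite -thetaE -etaE etaK.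
  move/orbit_idealE => [j H]; exists j => x cx Px; have /eqP := H x cx Px.
  rewrite mcN_subE subr_eq0 !compE !(cubept_tuple_map, cubeptK) // => /eqP.
  rewrite -[LHS]/(set_val (cubept (tuple_map g (tuple_map h x))) 0 k) cubept_tuple_map //.
  by rewrite -[RHS]/(set_val (cubept x) 0 k) cubeptK.
(* The orbit decreases, so the largest index found for a coordinate serves all of them. *)
exists (\max_k j k)%N => x cx Px; apply/rowP => k; apply: jP => //.
by apply: orbit_support_le Px; exact: leq_bigmax.
Qed.

End EquivalenceOfIso.

Lemma iso_equivalence (R : realType) (T T' : choiceType) (n m : nat)
    (W : nat -> wcomplex T) (W' : nat -> wcomplex T')
    (D : {fset {fset 'rV[rat]_n}}) (io : T -> 'rV[rat]_n)
    (D' : {fset {fset 'rV[rat]_m}}) (io' : T' -> 'rV[rat]_m) :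
  (forall i, regular_complex R (realization_at R W D io i).1) ->
  (forall i, regular_complex R (realization_at R W' D' io' i).1) ->
  (support R D `<=` cube R n)%classic -> (support R D' `<=` cube R m)%classic ->
  unital_liso (stellar_group_of R W D io) (stellar_group_of R W' D' io') ->
  exists (g : 'I_n -> mcNaughton R m) (h : 'I_m -> mcNaughton R n),
    orbit_equivalence W W' D io D' io' g h.
Proof.
move=> cW cW' Dc D'c [eta [heta [theta etaK thetaK]]].
have htheta : unital_lhom theta.
  have [etaD etaU etaI eta1] := heta.
  split; try (by move=> x y; apply: (can_inj etaK); rewrite ?etaD ?etaU ?etaI !thetaK).
  by apply: (can_inj etaK); rewrite thetaK eta1.
have [g gE] := iso_tuple (cW 0%N) Dc heta.
have [h hE] := iso_tuple (cW' 0%N) D'c htheta.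
exists g, h; split.
- exact: (tuple_inverse etaK gE hE).
- exact: (tuple_inverse thetaK hE gE).
- exact: (tuple_orbit cW heta gE).
- exact: (tuple_orbit cW' htheta hE).
Qed.

(** * Transport of orbits and the canonical realization *)

Section AffineTransfer.
Variables (R : realType) (T : choiceType) (n m : nat).
Variables (S : {fset T}) (io : T -> 'rV[rat]_n) (io' : T -> 'rV[rat]_m).
Hypotheses (inj : {in S &, injective io}) (inj' : {in S &, injective io'}).

Lemma bary_imset (x : 'rV[R]_n) a : bary (io @` S)%fset a x ->
  hpoint x = \sum_(t <- S) a (io t) *: hvertex R (io t).
Proof. by move=> [_ _ ->]; rewrite big_imfset. Qed.

(** Equal denominators keep the normalization [bary_den], so the same coefficients define a point of
    the other simplex. Summing over the fibres of [io'] gives a total function without inverting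
    [io']. *)
Lemma bary_transfer (x : 'rV[R]_n) a : (forall t, t \in S -> den (io' t) = den (io t)) ->
  bary (io @` S)%fset a x ->
  exists b y, bary (io' @` S)%fset b y /\ forall t, t \in S -> b (io' t) = a (io t).
Proof.
move=> dn aS; have [a0 _ _] := aS.
pose b v := \sum_(t <- S | io' t == v) a (io t).
have bE t : t \in S -> b (io' t) = a (io t).
  move=> tS; rewrite /b big_fset_condE (_ : [fset _ | _ in _ & _]%fset = [fset t]%fset).
    by rewrite big_seq_fset1.
  apply/fsetP => u; rewrite !inE /=; apply/andP/eqP => [[uS /eqP/inj' -> //]|->].
  by rewrite tS eqxx.
have [y bS] : exists y, bary (io' @` S)%fset b y.
  apply: bary_exists => [v|v vS|].
  - by apply: sumr_ge0.
  - rewrite /b big_seq_cond big1 // => t /andP[tS /eqP tv]; case/negP: vS.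
    by rewrite -tv in_imfset.
  rewrite big_imfset //= -[RHS](bary_den aS) [RHS]big_imfset //=.
  by apply: eq_big_seq => t tS; rewrite bE // dn.
by exists b, y.
Qed.

Lemma bary_affine (x : 'rV[R]_n) (y : 'rV[R]_m) a b (G : 'M[int]_(n + 1, m + 1)) :
  (forall t, t \in S -> hvertex R (io' t) = hvertex R (io t) *m map_mx intr G) ->
  bary (io @` S)%fset a x -> bary (io' @` S)%fset b y ->
  (forall t, t \in S -> b (io' t) = a (io t)) ->
  hpoint y = hpoint x *m map_mx intr G.
Proof.
move=> hG aS [_ _ ->] ab; rewrite (bary_imset aS) mulmx_suml big_imfset //=.
rewrite big_seq [RHS]big_seq; apply: eq_bigr => t tS.
by rewrite ab // hG // scalemxAl.
Qed.

End AffineTransfer.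

Lemma conv_image (R : realType) (T : choiceType) (n m : nat) (S : {fset T})
    (io : T -> 'rV[rat]_n) (io' : T -> 'rV[rat]_m) (g : 'rV[R]_n -> 'rV[R]_m)
    (G : 'M[int]_(n + 1, m + 1)) :
  {in S &, injective io} -> {in S &, injective io'} ->
  (forall t, t \in S -> den (io' t) = den (io t)) ->
  (forall t, t \in S -> hvertex R (io' t) = hvertex R (io t) *m map_mx intr G) ->
  (forall x, conv R (io @` S)%fset x -> hpoint (g x) = hpoint x *m map_mx intr G) ->
  conv R (io' @` S)%fset = (g @` conv R (io @` S)%fset)%classic.
Proof.
move=> inj inj' dn hG gG; apply/seteqP; split=> [y /convP[b bS]|_ [x /[dup] Sx /convP[a aS] <-]].
  have dn' t : t \in S -> den (io t) = den (io' t) by move=> tS; rewrite dn.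
  have [a [x [aS ab]]] := bary_transfer inj' inj dn' bS.
  have Sx : conv R (io @` S)%fset x by apply/convP; exists a.
  exists x => //; apply: hpoint_inj; rewrite gG //.
  by rewrite (bary_affine inj inj' hG aS bS) // => t tS; rewrite ab.
have [b [y [bS ab]]] := bary_transfer inj inj' dn aS.
apply/convP; exists b; rewrite (_ : g x = y) //.
by apply: hpoint_inj; rewrite gG // (bary_affine inj inj' hG aS bS).
Qed.

Section Transport.
Variables (R : realType) (T : choiceType) (n m : nat).
Variables (W : nat -> wcomplex T) (sW : stellar W).
Variables (D : {fset {fset 'rV[rat]_n}}) (io : T -> 'rV[rat]_n).
Variables (D' : {fset {fset 'rV[rat]_m}}) (io' : T -> 'rV[rat]_m).
Hypotheses (rD : realization R (W 0%N) D io) (rD' : realization R (W 0%N) D' io').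
Variable g : 'rV[R]_n -> 'rV[R]_m.

Definition affine_on (C : set 'rV[R]_n) := exists G : 'M[int]_(n + 1, m + 1),
  forall x, C x -> hpoint (g x) = hpoint x *m map_mx intr G.

Hypothesis gaff : forall S, S \in D -> affine_on (conv R S).
Hypothesis gio : {in wvertices (W 0%N), forall t, map_mx ratr (io' t) = g (map_mx ratr (io t))}.

Lemma affine_vertex (v : 'rV[rat]_n) (w : 'rV[rat]_m) (G : 'M[int]_(n + 1, m + 1)) :
  den w = den v -> map_mx ratr w = g (map_mx ratr v) ->
  hpoint (g (map_mx ratr v)) = hpoint (map_mx ratr v) *m map_mx intr G ->
  hvertex R w = hvertex R v *m map_mx intr G.
Proof. by move=> dn wv gv; rewrite !hvertexE dn wv gv scalemxAl. Qed.

(** Affineness survives because simplexes only shrink. As [g] is linear on the homogeneous vectors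
    of an edge and the denominators agree, the image of a mediant is the mediant of the images. *)
Lemma transport_invariant j :
  (forall S, S \in (realization_at R W D io j).1 -> affine_on (conv R S)) /\
  {in wvertices (W j), forall t, map_mx ratr ((realization_at R W D' io' j).2 t) =
      g (map_mx ratr ((realization_at R W D io j).2 t))}.
Proof.
elim: j => [//|j [IH1 IH2]].
have rj := realization_atP sW rD j; have rj' := realization_atP sW rD' j.
have rj1' := realization_atP sW rD' j.+1; have rj1 := realization_atP sW rD j.+1.
move: rj1 rj1'; rewrite /=; have := step_ofP sW j.
case: step_of => [M|a b x|] [vs WE] rj1 rj1' /=; last by rewrite WE.
- split=> [S /fsetD1P[_]|t]; first exact: IH1.
  by rewrite WE => /wt_deletion[tV _]; exact: IH2.
have [ab abW xV] := vs; have wj := sW.1 j.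
have [cD inj cov dn SD] := rj; have [cD' inj' cov' dn' SD'] := rj'.
have abV := wfaces_sub wj abW.
have [aV bV] : a \in wvertices (W j) /\ b \in wvertices (W j).
  by move: abV; rewrite fset2_sub => /andP[].
set c := realization_at R W D io j in rj rj1 IH1 IH2 cD inj cov dn SD *.
set c' := realization_at R W D' io' j in rj' rj1' IH2 cD' inj' cov' dn' SD' *.
have imab (U : choiceType) (f : T -> U) : (f @` [fset a; b] = [fset f a; f b])%fset.
  by rewrite imfsetU !imfset_fset1.
have vw : c.2 a != c.2 b by apply: contraNneq ab => /(inj _ _ aV bV) ->.
have vw' : c'.2 a != c'.2 b by apply: contraNneq ab => /(inj' _ _ aV bV) ->.
have vwD : [fset c.2 a; c.2 b]%fset \in c.1 by rewrite -imab -SD.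
have vwD' : [fset c'.2 a; c'.2 b]%fset \in c'.1 by rewrite -imab -SD'.
have [e med] : exists e, mediant (c.2 a) (c.2 b) e.
  have [regD _ _] := cD.
  by apply: (mediant_exists (regD _ vwD)); rewrite ?inE ?eqxx ?orbT.
have [e' med'] : exists e, mediant (c'.2 a) (c'.2 b) e.
  have [regD' _ _] := cD'.
  by apply: (mediant_exists (regD' _ vwD')); rewrite ?inE ?eqxx ?orbT.
rewrite (farey_mediantE R vw med) (farey_mediantE R vw' med') (blowupE cD vw vwD med).
split=> [S /(bsub_conv cD vw vwD med)[/IH1[G GE] sub]|t].
  by exists G => y /sub; exact: GE.
rewrite WE wvertices_subdivision in_fset1U; case: eqVneq => [_ _|_ /= tV]; last exact: IH2.
have [G GE] := IH1 _ vwD.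
have de : den e' = den e by rewrite (mediant_den med) (mediant_den med') !dn // !dn'.
have vG t' : t' \in [fset a; b]%fset -> hvertex R (c'.2 t') = hvertex R (c.2 t') *m map_mx intr G.
  move=> t'ab; have t'V := fsubsetP abV _ t'ab.
  apply: affine_vertex; [by rewrite dn // dn'|exact: IH2|apply: GE].
  apply/convP; exists (vertex_coord R (c.2 t')); apply: bary_sub (bary_vertex R _).
  by rewrite fsub1set -imab in_imfset.
have eS : conv R [fset c.2 a; c.2 b]%fset (map_mx ratr e).
  by apply/(conv_mediant cD vw vwD med).
apply: hpoint_inj; rewrite GE //.
have de0 : (den e)%:R != 0 :> R by exact: den_neq0.
apply: (scalerI de0); rewrite scalemxAl -hvertexE -{1}de -hvertexE.
rewrite (hvertex_mediant R med) (hvertex_mediant R med') mulmxDl.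
by rewrite !vG // !inE eqxx ?orbT.
Qed.

Lemma orbit_transport j :
  orbit_support R W D' io' j = (g @` orbit_support R W D io j)%classic.
Proof.
have [gA gV] := transport_invariant j; have wj := sW.1 j.
have rj := realization_atP sW rD j; have rj' := realization_atP sW rD' j.
have [cD inj cov dn SD] := rj; have [cD' inj' cov' dn' SD'] := rj'.
rewrite /orbit_support.
set c := realization_at R W D io j in rj gA gV cD inj cov dn SD *.
set c' := realization_at R W D' io' j in rj' gV cD' inj' cov' dn' SD' *.
have key S : S \in wfaces (W j) -> conv R (c'.2 @` S)%fset = (g @` conv R (c.2 @` S)%fset)%classic.
  move=> SW; have SV := wfaces_sub wj SW; have sub t : t \in S -> t \in wvertices (W j).
    exact: (fsubsetP SV).
  have ScD : (c.2 @` S)%fset \in c.1 by rewrite -SD.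
  have [G GE] := gA _ ScD.
  apply: (@conv_image _ _ _ _ _ _ _ _ G) => //.
  - by move=> t u /sub tV /sub uV; exact: inj.
  - by move=> t u /sub tV /sub uV; exact: inj'.
  - by move=> t /sub tV; rewrite dn // dn'.
  move=> t tS; have tV := sub _ tS.
  apply: affine_vertex; [by rewrite dn // dn'|exact: gV|apply: GE].
  apply/convP; exists (vertex_coord R (c.2 t)); apply: bary_sub (bary_vertex R _).
  by rewrite fsub1set in_imfset.
apply/seteqP; split=> [y [F FD Fy]|_ [x [F FD Fx] <-]].
  have [S SV FE] := sub_imfset (realization_sub rj' FD).
  have SW : S \in wfaces (W j) by rewrite SD' // -FE.
  move: Fy; rewrite FE key // => -[x Sx <-]; exists x => //.
  by exists (c.2 @` S)%fset => //; rewrite -SD.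
have [S SV FE] := sub_imfset (realization_sub rj FD).
have SW : S \in wfaces (W j) by rewrite SD // -FE.
exists (c'.2 @` S)%fset; first by rewrite -SD'.
by rewrite key //; exists x => //; rewrite -FE.
Qed.

End Transport.

Lemma conv_cube (R : realType) (n : nat) (S : {fset 'rV[rat]_n}) :
  (forall v, v \in S -> cube R n (map_mx ratr v)) -> (conv R S `<=` cube R n)%classic.
Proof.
move=> Sc x [a [a0 a1 ->]] i; rewrite summxE; apply/andP; split.
  rewrite big_seq; apply: sumr_ge0 => v vS; rewrite mxE mulr_ge0 ?a0 //.
  by have /andP[] := Sc v vS i.
rewrite -[leRHS]a1 big_seq [leRHS]big_seq; apply: ler_sum => v vS.
by rewrite mxE ler_piMr ?a0 //; have /andP[] := Sc v vS i.
Qed.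

(** * The canonical realization and its comparison with the others *)

Section Canonical.
Variables (R : realType) (T : choiceType) (W0 : wcomplex T).
Hypothesis wW : is_wcomplex W0.
Local Notation n := #|` wvertices W0|.
Local Notation V := (wvertices W0).
Local Notation kappa := (canonical_map W0).
Local Open Scope fset_scope.

Lemma canonical_index t : t \in V -> (index t V < n)%N.
Proof. by move=> tV; rewrite index_mem. Qed.

Definition canonical_vector t : 'rV[int]_(n + 1) :=
  row_mx (\row_i (i == index t V :> nat)%:R) (wt W0 t)%:Z%:M.

Lemma homog_canonical t : t \in V -> homog (kappa t) = canonical_vector t.
Proof.
move=> tV; have w0 : (0 < wt W0 t)%N by case: wW => _ _ _; apply.
have last_z i : canonical_vector t 0 (rshift n i) = wt W0 t.
  by rewrite row_mxEr mxE !ord1 eqxx.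
have [|| y yE] := @homog_exists _ (canonical_vector t)
    (delta_mx (lshift 1 (Ordinal (canonical_index tV))) 0).
- apply/matrixP => i j; rewrite !ord1 mxE (bigD1 (lshift 1 (Ordinal (canonical_index tV)))) //=.
  rewrite row_mxEl !mxE !eqxx mulr1 big1 ?addr0 // => k kt.
  by rewrite !mxE (negbTE kt) mulr0.
- by rewrite last_z ltz_nat.
rewrite -yE; congr homog; apply/rowP => i; rewrite mxE.
have dy : den y = wt W0 t by apply/eqP; rewrite -eqz_nat -(homog_last y ord0) yE last_z.
have := congr1 (fun M : 'rV_(n + 1) => M 0 (lshift 1 i)) (homog_rat y).
rewrite /= yE dy mxE row_mxEl mxE [RHS]mxE row_mxEl => E.
have w0q : ((wt W0 t)%:R : rat) != 0 by rewrite pnatr_eq0 -lt0n.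
apply: (mulfI w0q); rewrite -E; case: ifP => _; last by rewrite mulr0.
by rewrite mulfV.
Qed.

Lemma den_canonical t : t \in V -> den (kappa t) = wt W0 t.
Proof.
move=> tV; apply/eqP; rewrite -eqz_nat -(homog_last _ ord0) homog_canonical //.
by rewrite row_mxEr mxE eqxx.
Qed.

(** At a canonical vertex this is the coordinate form along its only nonzero entry, whose
    homogeneous value is 1. *)
Definition canonical_dual (v : 'rV[rat]_n) : 'cV[int]_(n + 1) :=
  col_mx (\col_i (v 0 i != 0)%:R) 0.

Lemma canonical_neq0 t i : t \in V -> (kappa t 0 i != 0) = (i == index t V :> nat).
Proof.
move=> tV; have w0 : (0 < wt W0 t)%N by case: wW => _ _ _; apply.
rewrite mxE; case: ifP => _; last by rewrite eqxx.
by rewrite invr_eq0 pnatr_eq0 -lt0n.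
Qed.

Lemma canonical_inj : {in V &, injective kappa}.
Proof.
move=> t u tV uV tu.
have := canonical_neq0 (Ordinal (canonical_index tV)) uV.
rewrite -tu (canonical_neq0 _ tV) eqxx => /esym/eqP /= E.
by rewrite -(nth_index t tV) E nth_index.
Qed.

Lemma canonical_dualP : dual_covectors (kappa @` V) canonical_dual.
Proof.
move=> _ _ /imfsetP[t /= tV ->] /imfsetP[u /= uV ->].
rewrite homog_canonical // mul_row_col mulmx0 addr0.
apply/matrixP => i j; rewrite !ord1 mxE [RHS]mxE eqxx mulr1n.
transitivity (\sum_(k < n) (k == index t V :> nat)%:R * (k == index u V :> nat)%:R : int).
  by apply: eq_bigr => k _; rewrite mxE [X in _ * X]mxE (canonical_neq0 _ uV).
rewrite (bigD1 (Ordinal (canonical_index uV))) //= eqxx mulr1.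
rewrite big1 ?addr0 => [|k ku]; last first.
  rewrite (_ : (k == index u V :> nat) = false) ?mulr0 //.
  by apply: contraNF ku => /eqP ku; apply/eqP/val_inj.
congr (_%:R); congr nat_of_bool; apply/eqP/eqP => [E|/canonical_inj -> //].
by rewrite -(nth_index t tV) -E nth_index.
Qed.

Lemma in_canonical F : (F \in canonical_complex W0) <->
  exists2 S, S \in wfaces W0 & F = kappa @` S.
Proof.
split=> [/imfsetP[S /= SW ->]|[S SW ->]]; first by exists S.
by apply/imfsetP; exists S.
Qed.

Lemma canonical_realization : realization R W0 (canonical_complex W0) kappa.
Proof.
have subV F : F \in canonical_complex W0 -> F `<=` kappa @` V.
  move=> /in_canonical[S /(wfaces_sub wW)/fsubsetP SV ->].
  by apply/fsubsetP => _ /imfsetP[t /= tS ->]; rewrite in_imfset //; exact: SV.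
apply: realization_intro => //.
- have regD F : F \in canonical_complex W0 -> regular_simplex F.
    move=> /subV/fsubsetP FV; apply: (dual_regular (c := canonical_dual)) => u v uF vF.
    by apply: canonical_dualP; exact: FV.
  apply: bary_complex => // [S F SD FS|S F a b x SD FD aS bF].
    have [G GV FE] := sub_imfset (fsubset_trans FS (subV _ SD)).
    move: SD FS => /in_canonical[S0 S0W ->]; rewrite FE.
    rewrite (imfset_sub_in canonical_inj) // => [GS0|]; last exact: wfaces_sub.
    by apply/in_canonical; exists G => //; case: wW => _ _ downW _; exact: downW GS0.
  (* All canonical vertices together span one regular simplex, in which the coordinates are already
     unique. *)
  apply: (regular_bary_inj (dual_regular canonical_dualP)).
    exact: bary_sub (subV _ SD) aS.
  exact: bary_sub (subV _ FD) bF.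
- exact: canonical_inj.
- exact: den_canonical.
move=> S SV; apply/idP/idP => [SW|/in_canonical[F FW SF]].
  by apply/in_canonical; exists S.
by rewrite (imfset_inj_in canonical_inj SV (wfaces_sub wW FW) SF).
Qed.

Lemma canonical_cube : (support R (canonical_complex W0) `<=` cube R n)%classic.
Proof.
move=> x [F /in_canonical[S SW ->]]; apply: conv_cube => _ /imfsetP[t /= tS ->] i.
have tV := fsubsetP (wfaces_sub wW SW) _ tS.
have w0 : (0 < wt W0 t)%N by case: wW => _ _ _; apply.
rewrite !mxE; case: ifP => _; last by rewrite rmorph0 lexx ler01.
rewrite fmorphV rmorph_nat invr_ge0 ler0n /= invf_le1 ?ltr0n //.
by rewrite ler1n.
Qed.

End Canonical.

Lemma unital_liso_sym (G H : unitalLGroupType) : unital_liso G H -> unital_liso H G.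
Proof.
move=> [f [[fD fU fI f1] [f' fK f'K]]]; exists f'; split; last by exists f.
split; try (by move=> x y; apply: (can_inj fK); rewrite ?fD ?fU ?fI !f'K).
by apply: (can_inj fK); rewrite f'K f1.
Qed.

Lemma unital_liso_trans (G H L : unitalLGroupType) :
  unital_liso G H -> unital_liso H L -> unital_liso G L.
Proof.
move=> [f [[fD fU fI f1] bf]] [h [[hD hU hI h1] bh]]; exists (h \o f); split.
  by split=> [x y|x y|x y|] /=; rewrite ?fD ?fU ?fI ?f1 ?hD ?hU ?hI ?h1.
exact: bij_comp.
Qed.

Section CanonicalIso.
Variables (R : realType) (T : choiceType) (d : nat).
Variables (W : nat -> wcomplex T) (sW : stellar W).
Variables (D : {fset {fset 'rV[rat]_d}}) (io : T -> 'rV[rat]_d).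
Hypotheses (rD : realization R (W 0%N) D io) (Dcube : (support R D `<=` cube R d)%classic).
Local Notation V := (wvertices (W 0%N)).
Local Notation n := #|` V|.
Local Notation kappa := (canonical_map (W 0%N)).
Local Notation C := (canonical_complex (W 0%N)).

Let wW := sW.1 0%N.
Let rC : realization R (W 0%N) C kappa := canonical_realization R wW.

Let vertex_nth (i : 'I_n) : T := tnth (in_tuple (enum_fset V)) i.

Let vertex_nthV i : vertex_nth i \in V.
Proof. by rewrite /vertex_nth; apply: mem_tnth. Qed.

Let index_nth i : index (vertex_nth i) V = i.
Proof.
by rewrite /vertex_nth (tnth_nth (vertex_nth i)) /= index_uniq // fset_uniq.
Qed.

(* On the canonical complex the simplicial map to any other realization is the
   restriction of a single integer linear map, since the canonical vertices are
   proportional to the standard basis. *)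
Let linear_mx : 'M[int]_(n + 1, d + 1) :=
  block_mx (\matrix_(i, j) homog (io (vertex_nth i)) 0 (lshift 1 j)) 0 0 1%:M.

Let linear_mx_vertex t : t \in V -> homog (kappa t) *m linear_mx = homog (io t).
Proof.
move=> tV; have [_ _ _ dn _] := rD.
rewrite homog_canonical // mul_row_block !mulmx0 mulmx1 addr0 add0r.
rewrite -[RHS]hsubmxK; congr row_mx; apply/rowP => j; rewrite mxE; last first.
  by rewrite !ord1 eqxx [RHS]mxE homog_last dn.
rewrite (bigD1 (Ordinal (canonical_index tV))) //= big1 ?addr0 => [|i it]; last first.
  rewrite mxE (_ : (_ == _ :> nat) = false) ?mul0r //.
  by apply: contraNF it => /eqP it; apply/eqP/val_inj.
rewrite mxE /= eqxx mul1r mxE [RHS]mxE; congr (homog (io _) _ _).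
by rewrite /vertex_nth (tnth_nth t) /= nth_index.
Qed.

Let h (k : 'I_d) : mcNaughton R n := form_mcN R (col (lshift 1 k) linear_mx).

Let hE (x : 'rV[R]_n) k : cube R n x ->
  h k (cubept x) = (hpoint x *m map_mx intr linear_mx) 0 (lshift 1 k).
Proof.
move=> cx; rewrite form_mcNE cubeptK // /form !mxE.
by apply: eq_bigr => i _; rewrite !mxE.
Qed.

Let hvertex_linear t : t \in V ->
  hvertex R (io t) = hvertex R (kappa t) *m map_mx intr linear_mx.
Proof. by move=> tV; rewrite /hvertex -linear_mx_vertex // map_mxM. Qed.

Let tuple_map_coords S x a : S \in wfaces (W 0%N) -> bary (kappa @` S)%fset a x ->
  hpoint (tuple_map h x) = hpoint x *m map_mx intr linear_mx /\
  exists2 b, bary (io @` S)%fset b (tuple_map h x) & forall t, t \in S -> b (io t) = a (kappa t).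
Proof.
move=> SW aS; have SV := wfaces_sub wW SW; have sub t : t \in S -> t \in V by exact: (fsubsetP SV).
have [_ injC _ dnC SC] := rC; have [_ inj _ dn SD] := rD.
have cx : cube R n x.
  apply: (@canonical_cube R _ _ wW x); exists (kappa @` S)%fset; first by rewrite -SC.
  by apply/convP; exists a.
have injCS : {in S &, injective kappa} by move=> t u /sub tV /sub uV; exact: injC.
have injS : {in S &, injective io} by move=> t u /sub tV /sub uV; exact: inj.
have dnS t : t \in S -> den (io t) = den (kappa t) by move=> /sub tV; rewrite dn // dnC.
have [b [y [bS ab]]] := bary_transfer injCS injS dnS aS.
have hG t : t \in S -> hvertex R (io t) = hvertex R (kappa t) *m map_mx intr linear_mx.
  by move=> /sub; exact: hvertex_linear.
have yE := bary_affine injCS injS hG aS bS ab.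
(* The image point is in the cube, so the truncation inside [tuple_map] leaves it unchanged. *)
have cy : cube R d y.
  apply: Dcube; exists (io @` S)%fset; first by rewrite -SD.
  by apply/convP; exists b.
suff -> : tuple_map h x = y by split=> //; exists b.
rewrite -[RHS](clip_id cy) /tuple_map; congr clip.
by apply/rowP => k; rewrite mxE hE // -yE hpointl.
Qed.

Lemma canonical_iso : unital_liso (stellar_group R W) (stellar_group_of R W D io).
Proof.
have [cD inj _ dn SD] := rD; have [cC injC _ dnC SC] := rC.
have facesC F : F \in C -> exists2 S, S \in wfaces (W 0%N) & F = (kappa @` S)%fset.
  by move/in_canonical.
have transport j : orbit_support R W D io j = (tuple_map h @` orbit_support R W C kappa j)%classic.
  apply: orbit_transport => // [F /facesC[S SW ->]|t tV].
    exists linear_mx => x /convP[a aS].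
    by have [] := tuple_map_coords SW aS.
  have tW : [fset t]%fset \in wfaces (W 0%N).
    have [_ cov downW _] := wW; move: tV; rewrite -cov => /in_fcover[S SW tS].
    by apply: downW SW _; rewrite fsub1set.
  have := bary_vertex R (kappa t); rewrite -imfset_fset1 => /(tuple_map_coords tW)[E _].
  apply: hpoint_inj; rewrite E.
  have dt0 : (den (io t))%:R != 0 :> R by exact: den_neq0.
  apply: (scalerI dt0); rewrite -hvertexE scalemxAl hvertex_linear //.
  by rewrite dn // -dnC // hvertexE.
(* Hat functions with homogeneous value 1 at their vertex, so with actual value the inverse of its
   denominator: this is the nonzero entry of the corresponding canonical vertex. *)
have /choice[g0 g0P] : forall i : 'I_n, exists f : mcNaughton R d, forall S a x,
    S \in D -> bary S a x -> f (cubept x) = \sum_(v <- S) a v * (v == io (vertex_nth i))%:Z%:~R.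
  move=> i; have [f _ fE] := extension (fun v => (v == io (vertex_nth i))%:Z) cD Dcube.
  by exists f.
have gh x : support R C x -> tuple_map g0 (tuple_map h x) = x.
  move=> Cx; have cx := @canonical_cube R _ _ wW x Cx;
  move: Cx => [F /facesC[S SW ->] /convP[a aS]].
  have SV := wfaces_sub wW SW; have sub t : t \in S -> t \in V by exact: (fsubsetP SV).
  have [_ [b bS ab]] := tuple_map_coords SW aS.
  have injCS : {in S &, injective kappa} by move=> t u /sub tV /sub uV; exact: injC.
  have injS : {in S &, injective io} by move=> t u /sub tV /sub uV; exact: inj.
  have SioD : (io @` S)%fset \in D by rewrite -SD.
  rewrite -[RHS](clip_id cx) {1}/tuple_map; congr clip; apply/rowP => i; rewrite mxE.
  rewrite (g0P i _ _ _ SioD bS) big_imfset //= -hpointl (bary_imset injCS aS) summxE.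
  apply: eq_big_seq => t tS; rewrite ab // mxE; congr (_ * _).
  have -> : (io t == io (vertex_nth i)) = (i == index t V :> nat).
    apply/eqP/eqP => [/(inj _ _ (sub t tS) (vertex_nthV i)) ->|E].
      by rewrite index_nth.
    by congr io; rewrite -(nth_index t (sub t tS)) -E -{1}(index_nth i) nth_index.
  by rewrite mxE homog_canonical ?sub // row_mxEl mxE natz.
(* The other composition follows from [gh], since [transport] at index 0 makes [tuple_map h]
   surjective onto the support of [D]. *)
have hg y : support R D y -> tuple_map h (tuple_map g0 y) = y.
  move=> Dy; have : orbit_support R W D io 0%N y by [].
  by rewrite transport => -[x Cx <-]; rewrite gh.
apply: (equivalence_iso (g := g0) (h := h)); split.
- by exists 0%N => x _; exact: gh.
- by exists 0%N => y _; exact: hg.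
- move=> i; exists i => y _; rewrite transport => -[x Px <-]; rewrite gh //.
  exact: (orbit_support_le (leq0n i) Px).
by move=> j; exists j => x _ Px; rewrite transport; exists x.
Qed.

End CanonicalIso.

Lemma tuple_map_coordinate (R : realType) n (x : 'rV[R]_n) : cube R n x ->
  tuple_map (fun i => coordinate R i) x = x.
Proof.
move=> cx; rewrite /tuple_map -[RHS](clip_id cx); congr clip; apply/rowP => i.
by rewrite mxE -[LHS]/(set_val (cubept x) 0 i) cubeptK.
Qed.

Lemma confluent_iso (R : realType) (T T' : choiceType) (d : nat)
    (W : nat -> wcomplex T) (W' : nat -> wcomplex T')
    (D : {fset {fset 'rV[rat]_d}}) (io : T -> 'rV[rat]_d)
    (D' : {fset {fset 'rV[rat]_d}}) (io' : T' -> 'rV[rat]_d) :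
  confluent (orbit R W D io) (orbit R W' D' io') ->
  unital_liso (stellar_group_of R W D io) (stellar_group_of R W' D' io').
Proof.
move=> [mWW' mW'W].
apply: (equivalence_iso (g := fun i => coordinate R i) (h := fun i => coordinate R i)); split.
- by exists 0%N => x cx _; rewrite !tuple_map_coordinate.
- by exists 0%N => x cx _; rewrite !tuple_map_coordinate.
- move=> i; have [|_ [[j _ <-] sub]] := mW'W (orbit_support R W D io i); first by exists i.
  by exists j => y cy Qy; rewrite tuple_map_coordinate //; exact: sub.
move=> j; have [|_ [[i _ <-] sub]] := mWW' (orbit_support R W' D' io' j); first by exists j.
by exists i => y cy Qy; rewrite tuple_map_coordinate //; exact: sub.
Qed.

Lemma strongly_equivalent_iso (R : realType) (T T' : choiceType)
    (W : nat -> wcomplex T) (W' : nat -> wcomplex T') :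
  stellar W -> stellar W' -> strongly_equivalent R W W' ->
  unital_liso (stellar_group R W) (stellar_group R W').
Proof.
move=> sW sW' [d [D [rho [D' [rho' [rD rD' Dc D'c conf]]]]]].
apply: unital_liso_trans (canonical_iso sW rD Dc) _.
apply: unital_liso_trans (confluent_iso conf) _.
exact: unital_liso_sym (canonical_iso sW' rD' D'c).
Qed.

(** * A common stellar sequence *)

Section Concatenation.
Variables (X : Type) (step : X -> X -> Prop) (Inv : nat -> X -> Prop).
Hypothesis step_refl : forall x, step x x.

(** A finite path, stored as an infinite sequence with a length: the entries beyond [l] are steps
    too, so no bound on the index is carried along. *)
Definition chain x y := exists (p : nat -> X) (l : nat),
  [/\ p 0%N = x, p l = y & forall i, step (p i) (p i.+1)].

Hypothesis next : forall k x, Inv k x -> exists2 y, chain x y & Inv k.+1 y.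

Lemma chain_sequence x0 : Inv 0%N x0 -> exists f : nat -> X,
  [/\ f 0%N = x0, forall i, step (f i) (f i.+1) & forall k, exists2 t, (k <= t)%N & Inv k (f t)].
Proof.
move=> inv0.
have /choice[pl plP] : forall kx : nat * X, exists pl : (nat -> X) * nat,
    Inv kx.1 kx.2 -> [/\ pl.1 0%N = kx.2, Inv kx.1.+1 (pl.1 pl.2) &
      forall i, step (pl.1 i) (pl.1 i.+1)].
  move=> [k x]; have [/next[y [p [l [p0 py pS]]] iy]|nI] := pselect (Inv k x).
    by exists (p, l); rewrite /= p0 py.
  by exists ((fun=> x), 0%N).
pose xs := fix xs k := if k is k'.+1 then (pl (k', xs k')).1 (pl (k', xs k')).2 else x0.
have xsI k : Inv k (xs k) by elim: k => //= k /(plP (k, _))[].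
pose p k := (pl (k, xs k)).1; pose l k := (pl (k, xs k)).2.
have p0 k : p k 0%N = xs k by have [] := plP (k, xs k) (xsI k).
have plE k : p k (l k) = xs k.+1 by [].
have pS k i : step (p k i) (p k i.+1) by have [_ _ H] := plP (k, xs k) (xsI k); exact: H.
(* A state is the number of a path and a position in it. Passing to the next path repeats the common
   end point, a step by [step_refl]; so every path takes at least one unit of time, whence
   [k <= t]. *)
pose nxt (s : nat * nat) := if (s.2 < l s.1)%N then (s.1, s.2.+1) else (s.1.+1, 0%N).
pose st t := iter t nxt (0%N, 0%N).
have st_le t : ((st t).2 <= l (st t).1)%N.
  by elim: t => //= t IH; rewrite /nxt; case: ifP.
exists (fun t => p (st t).1 (st t).2); split.
- exact: p0.
- move=> t; rewrite /= -/(st t) {1 2}/nxt; case: ifP => [_|tl] /=; first exact: pS.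
  have -> : (st t).2 = l (st t).1 by apply/eqP; rewrite eqn_leq st_le leqNgt tl.
  by rewrite plE -p0.
move=> k; have [t kt tE] : exists2 t, (k <= t)%N & st t = (k, 0%N).
  elim: k => [|k [t kt tE]]; first by exists 0%N.
  have stl i : (i <= l k)%N -> st (i + t)%N = (k, i).
    elim: i => //= i IH il; rewrite /st /= -/(st (i + t)%N) IH; last exact: ltnW.
    by rewrite /nxt /= il.
  exists (l k + t).+1; first by rewrite ltnS (leq_trans kt) ?leq_addl.
  by rewrite /st /= -/(st (l k + t)%N) stl // /nxt /= ltnn.
by exists t => //; rewrite tE p0; exact: xsI.
Qed.

End Concatenation.

Lemma gsteps_chain n (D D' : {fset {fset 'rV[rat]_n}}) :
  gsteps D D' -> chain (@gstep n) D D'.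
Proof.
elim=> [D1|D1 D2 D3 st _ [p [l [p0 pl pS]]]].
  by exists (fun=> D1), 0%N; split=> // i; exact: GStay.
exists (fun i => if i is i'.+1 then p i' else D1), l.+1; split=> // -[|i]; last exact: pS.
by rewrite p0.
Qed.

(** * Triangulations on which the tuples are integer affine *)

Section TupleAffine.
Variables (R : realType) (n m : nat) (g : 'I_n -> mcNaughton R m).
Implicit Types (D : {fset {fset 'rV[rat]_m}}).

Lemma tuple_map_forms : exists A : 'I_n -> seq 'cV[int]_(m + 1),
  forall i y, cube R m y -> exists2 l, l \in A i & tuple_map g y 0 i = form l (hpoint y).
Proof.
have [A AE] := choice (fun i => mcN_forms (lmeet (ljoin (g i) 0) lunit : mcNaughton R m)).
exists A => i y cy; have [l lA E] := AE i y; exists l => //.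
by rewrite !mxE -[in RHS](clip_id cy) -E.
Qed.

Lemma tuple_map_affine D : regular_complex R D -> (support R D `<=` cube R m)%classic ->
  exists2 D1, blowups D D1 & forall S, S \in D1 -> affine_on (tuple_map g) (conv R S).
Proof.
move=> cD Dcube; have [A AE] := tuple_map_forms.
have [D1 b1 s1] := signed_refinement
  (flatten [seq [seq q - l | q <- A i, l <- A i] | i : 'I_n]) cD.
have [cD1 supD1 _] := blowups_complex b1 cD; exists D1 => // S SD1.
have [->|S0] := eqVneq S fset0; first by exists 0 => x /conv0.
have Scube : (conv R S `<=` cube R m)%classic.
  by move=> x Sx; apply: Dcube; rewrite -supD1; exists S.
have /choice[q qE] : forall i, exists q, forall x, conv R S x ->
    tuple_map g x 0 i = form q (hpoint x).
  move=> i.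
  have [|l q lA qA F|l _ fl] := @mcN_affine_simplex _ _
    (lmeet (ljoin (g i) 0) lunit : mcNaughton R m) (A i) S S0 Scube.
  - move=> x /Scube cx; have [l lA E] := AE i x cx.
    by exists l; rewrite // -E !mxE.
  - rewrite inE => /eqP ->; apply: s1 => //; apply/flattenP.
    exists [seq q' - l' | q' <- A i, l' <- A i]; last exact: allpairs_f.
    by apply/mapP; exists i; rewrite ?mem_enum.
  - by exists l => x Sx; rewrite -fl // !mxE.
(* The last column keeps the homogenizing coordinate equal to 1. *)
exists (row_mx (\matrix_(k, i) q i k 0) (delta_mx (rshift m ord0) 0)) => x Sx.
rewrite map_row_mx mul_mx_row /hpoint; congr row_mx; apply/rowP => i.
  rewrite qE // /form !mxE; apply: eq_bigr => k _; by rewrite !mxE.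
rewrite !ord1 mxE eqxx mxE (bigD1 (rshift m ord0)) //= row_mxEr !mxE !eqxx mulr1.
rewrite big1 ?addr0 // => k kl.
by rewrite !mxE (negbTE kl) mulr0.
Qed.

End TupleAffine.

(** The pieces of [h] are pulled back along the matrices of [g] to forms on the source, so no
    triangulation of the image enters. As [h] undoes [g], each coordinate function of the source is
    locally one of these pulled-back pieces, and [mcN_affine_simplex] selects one piece per simplex;
    these pieces form [H]. *)
Lemma tuple_map_unimodular (R : realType) (n m : nat) (g : 'I_n -> mcNaughton R m)
    (h : 'I_m -> mcNaughton R n) (D0 : {fset {fset 'rV[rat]_m}}) : regular_complex R D0 ->
  (support R D0 `<=` cube R m)%classic ->
  (forall x, support R D0 x -> tuple_map h (tuple_map g x) = x) ->
  exists2 D1, blowups D0 D1 & forall S, S \in D1 ->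
    exists (G : 'M[int]_(m + 1, n + 1)) (H : 'M[int]_(n + 1, m + 1)),
    forall x, conv R S x -> hpoint (tuple_map g x) = hpoint x *m map_mx intr G /\
      hpoint x = hpoint (tuple_map g x) *m map_mx intr H.
Proof.
move=> cD0 D0cube hg0; have [D b0 gD] := tuple_map_affine g cD0 D0cube.
have [cD supD _] := blowups_complex b0 cD0; rewrite -supD in D0cube hg0.
have [B BE] := tuple_map_forms h.
have /choice[G GE] : forall S, exists G : 'M[int]_(m + 1, n + 1), S \in D ->
    forall x, conv R S x -> hpoint (tuple_map g x) = hpoint x *m map_mx intr G.
  move=> S; have [/gD[G GE]|_] := boolP (S \in D); first by exists G.
  by exists 0.
have [D1 b1 s1] := signed_refinement (flatten [seq
  [seq G F *m q - G F *m l | q <- B k, l <- B k] | F <- D, k <- enum 'I_m]) cD.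
have [cD1 supD1 ref] := blowups_complex b1 cD.
exists D1; first exact: blowups_trans b1.
move=> S SD1; have [F FD SF] := ref S SD1; exists (G F).
have [->|S0] := eqVneq S fset0; first by exists 0 => x /conv0.
have Scube : (conv R S `<=` cube R m)%classic.
  by move=> x Sx; apply: D0cube; rewrite -supD1; exists S.
have /choice[q qE] : forall k, exists q, forall x, conv R S x ->
    x 0 k = form q (hpoint (tuple_map g x)).
  move=> k.
  have formG l x : conv R S x ->
      form (G F *m l) (hpoint x) = form l (hpoint (tuple_map g x)).
    by move=> /SF Fx; rewrite (GE _ FD) // /form map_mxM mulmxA.
  have [|l q|_ /mapP[l lB ->] fl] := @mcN_affine_simplex _ _
    (coordinate R k) [seq G F *m l | l <- B k] S S0 Scube.
  - move=> x Sx; have [l lB E] := BE k (tuple_map g x) (tuple_map_cube _ _).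
    exists (G F *m l); first exact: map_f.
    rewrite formG // -E hg0; last by rewrite -supD1; exists S.
    by rewrite -[LHS]/(set_val (cubept x) 0 k) cubeptK //; exact: Scube.
  - move=> /mapP[l' l'B ->] /mapP[q' q'B ->] F'; rewrite inE => /eqP ->.
    apply: s1 => //; apply/flattenP.
    exists [seq G F *m q - G F *m l | q <- B k, l <- B k].
      apply: (allpairs_f (fun F k => [seq G F *m q - G F *m l | q <- B k, l <- B k])) => //.
      by rewrite mem_enum.
    exact: (allpairs_f (fun q l => G F *m q - G F *m l)).
  exists l => x Sx; rewrite -formG // -fl //.
  by rewrite -[RHS]/(set_val (cubept x) 0 k) cubeptK //; exact: Scube.
exists (row_mx (\matrix_(i, k) q k i 0) (delta_mx (rshift n ord0) 0)) => x Sx.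
split; first by apply: (GE _ FD); exact: SF.
rewrite map_row_mx mul_mx_row {1}/hpoint; congr row_mx; apply/rowP => i.
  rewrite (qE i x Sx) /form !mxE; apply: eq_bigr => k _; by rewrite !mxE.
rewrite !ord1 mxE eqxx mxE (bigD1 (rshift n ord0)) //= row_mxEr !mxE !eqxx mulr1.
rewrite big1 ?addr0 // => k kl.
by rewrite !mxE (negbTE kl) mulr0.
Qed.

Section ImageRealization.
Variables (R : realType) (n m : nat) (g : 'rV[R]_m -> 'rV[R]_n).
Variable (D : {fset {fset 'rV[rat]_m}}).
Hypotheses (cD : regular_complex R D) (D0 : fcover D != fset0).
Hypothesis ginj : forall x y, support R D x -> support R D y -> g x = g y -> x = y.
Hypothesis gGH : forall S, S \in D ->
  exists (G : 'M[int]_(m + 1, n + 1)) (H : 'M[int]_(n + 1, m + 1)),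
  forall x, conv R S x -> hpoint (g x) = hpoint x *m map_mx intr G /\
    hpoint x = hpoint (g x) *m map_mx intr H.

Let downD : down_closed D. Proof. by case: cD. Qed.

Let vertex_conv (S : {fset 'rV[rat]_m}) v : v \in S -> conv R S (map_mx ratr v).
Proof.
move=> vS; apply/convP; exists (vertex_coord R v).
by apply: bary_sub (bary_vertex R v); rewrite fsub1set.
Qed.

Let hvertex_inj p : injective (map_mx intr : 'rV[int]_p -> 'rV[R]_p).
Proof.
by move=> u v uv; apply/matrixP => i j; apply: (@intr_inj R);
  move/matrixP: uv => /(_ i j); rewrite !mxE.
Qed.

(** The integer vector [homog v *m G] stays primitive because [H] undoes [G] on it, which makes
    [H *m c v] a covector of value 1. Its last entry is still [den v], so the denominator is
    preserved. *)
Let vertex_image v : v \in fcover D ->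
  exists w : 'rV[rat]_n, map_mx ratr w = g (map_mx ratr v) /\ den w = den v.
Proof.
move=> /in_fcover[S SD vS]; have [G [H GH]] := gGH SD.
have [gG gH] := GH _ (vertex_conv vS).
have vG : hvertex R v *m map_mx intr G = (den v)%:R *: hpoint (g (map_mx ratr v)).
  by rewrite hvertexE -scalemxAl gG.
have vGH : homog v *m G *m H = homog v.
  apply: hvertex_inj; rewrite !map_mxM -[map_mx _ (homog v)]/(hvertex R v) vG.
  by rewrite -scalemxAl -gH hvertexE.
have lastG : (homog v *m G) 0 (rshift n ord0) = den v.
  apply: (@intr_inj R); have := congr1 (fun M : 'rV_(n + 1) => M 0 (rshift n ord0)) vG.
  by rewrite /= /hvertex -map_mxM mxE => ->; rewrite mxE hpoint_last mulr1.
have [regD _ _] := cD; have [c cS] := regular_dual (regD _ SD).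
have [|| w wE] := @homog_exists _ (homog v *m G) (H *m c v).
- by rewrite mulmxA vGH cS // eqxx.
- by rewrite lastG ltz_nat den_gt0.
have dw : den w = den v by apply/eqP; rewrite -eqz_nat -(homog_last w ord0) wE lastG.
exists w; split=> //; apply: hpoint_inj.
have dw0 : (den w)%:R != 0 :> R by exact: den_neq0.
by apply: (scalerI dw0); rewrite -hvertexE /hvertex wE map_mxM -/(hvertex R v) vG dw.
Qed.

Lemma image_realization : exists (D' : {fset {fset 'rV[rat]_n}}) (io : 'rV[rat]_m -> 'rV[rat]_n),
  realization R (geometric_wcomplex D) D' io /\
  {in fcover D, forall v, map_mx ratr (io v) = g (map_mx ratr v)}.
Proof.
have /choice[io ioP] : forall v, exists w : 'rV[rat]_n, v \in fcover D ->
    map_mx ratr w = g (map_mx ratr v) /\ den w = den v.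
  move=> v; have [/vertex_image[w ?]|_] := boolP (v \in fcover D); first by exists w.
  by exists 0.
have ratr_inj : injective (map_mx ratr : 'rV[rat]_m -> 'rV[R]_m).
  move=> u v uv; apply/matrixP => i j; apply: (fmorph_inj (ratr : {rmorphism rat -> R})).
  by move/matrixP: uv => /(_ i j); rewrite !mxE.
have supv v : v \in fcover D -> support R D (map_mx ratr v).
  by move=> /in_fcover[S SD vS]; exact: support_vertex vS.
have inj : {in fcover D &, injective io}.
  move=> u v uD vD uv; apply: ratr_inj; apply: ginj; [exact: supv|exact: supv|].
  by have [<- _] := ioP u uD; have [<- _] := ioP v vD; rewrite uv.
have subD S v : S \in D -> v \in S -> v \in fcover D.
  by move=> SD vS; apply/in_fcover; exists S.
have injS S : S \in D -> {in S &, injective io}.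
  by move=> SD u v /(subD _ _ SD) uD /(subD _ _ SD) vD; exact: inj.
have sub_cover S : S \in D -> (S `<=` fcover D)%fset.
  by move=> SD; apply/fsubsetP => v; exact: subD.
have wGH S : S \in D -> exists (G : 'M[int]_(m + 1, n + 1)) (H : 'M[int]_(n + 1, m + 1)),
   [/\ forall x, conv R S x -> hpoint (g x) = hpoint x *m map_mx intr G,
     forall v, v \in S -> hvertex R (io v) = hvertex R v *m map_mx intr G &
     forall v, v \in S -> homog (io v) *m H = homog v].
  move=> SD; have [G [H GH]] := gGH SD; exists G, H.
  have vG v : v \in S -> hvertex R (io v) = hvertex R v *m map_mx intr G.
    move=> vS; have [iov dv] := ioP v (subD _ _ SD vS).
    have [gG _] := GH _ (vertex_conv vS).
    by rewrite !hvertexE dv iov gG scalemxAl.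
  split=> // [x /GH[]//|v vS]; apply: hvertex_inj.
  have [iov dv] := ioP v (subD _ _ SD vS); have [gG gH] := GH _ (vertex_conv vS).
  by rewrite map_mxM -/(hvertex R (io v)) -/(hvertex R v) !hvertexE dv iov -scalemxAl -gH.
pose D' := [fset (io @` (S : {fset 'rV[rat]_m}))%fset | S in D]%fset.
have inD' F : (F \in D') <-> exists2 S, S \in D & F = (io @` S)%fset.
  split=> [/imfsetP[S /= SD ->]|[S SD ->]]; first by exists S.
  by apply/imfsetP; exists S.
exists D', io; split; last by move=> v vD; case: (ioP v vD).
apply: realization_intro.
- exact: is_wcomplex_geometric.
- apply: bary_complex =>
    [F /inD'[S SD ->]|F1 F2 /inD'[S SD ->] FS|F1 F2 a b y /inD'[S SD ->] /inD'[F FD ->]].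
  + have [G [H [_ _ vH]]] := wGH S SD.
    have [regD _ _] := cD; have [c cS] := regular_dual (regD _ SD).
    have /choice[inv invP] : forall u, exists v, u \in (io @` S)%fset -> v \in S /\ io v = u.
      move=> u; have [/imfsetP[v /= vS ->]|_] := boolP (u \in (io @` S)%fset).
        by exists v.
      by exists 0.
    (* The dual family of the image simplex is the old one preceded by the inverse matrix. *)
    apply: (dual_regular (c := fun u => H *m c (inv u))).
    move=> _ _ /imfsetP[u /= uS ->] /imfsetP[v /= vS ->].
    have [|iS iE] := invP (io v); first by rewrite in_imfset.
    rewrite (injS _ SD _ _ iS vS iE) mulmxA vH // cS //.
    by congr (_%:R%:M); congr nat_of_bool; apply/eqP/eqP => [->//|/(injS _ SD _ _ uS vS)].
  + have [G GV FE] := sub_imfset FS; apply/inD'; exists G => //.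
    exact: downD SD GV.
  move=> aS bF.
  have idinj (Z : {fset 'rV[rat]_m}) : {in Z &, injective id} by [].
  have imid (Z : {fset 'rV[rat]_m}) : (id @` Z)%fset = Z.
    by apply/fsetP => u; apply/imfsetP/idP => [[t /= tS ->]|uS] //; exists u.
  (* Coordinates in an image simplex are those of a point of the source, viewed as realized by the
     identity. By injectivity of [g] two such points coincide, and uniqueness is inherited from
     [D]. *)
  have tr Z c z : Z \in D -> bary (io @` Z)%fset c z -> exists c' x,
      [/\ bary Z c' x, g x = z & forall v, v \in Z -> c' v = c (io v)].
    move=> ZD cZ; have [G [H [gG vG _]]] := wGH Z ZD.
    have dn v : v \in Z -> den v = den (io v).
      by move=> vZ; have [_ ->] := ioP v (subD _ _ ZD vZ).
    have [c' [x [c'Z cc']]] := bary_transfer (injS _ ZD) (idinj Z) dn cZ.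
    rewrite imid in c'Z; exists c', x; split=> //.
    have Zx : conv R Z x by apply/convP; exists c'.
    apply: hpoint_inj; rewrite (gG _ Zx); apply/esym.
    apply: (bary_affine (S := Z) (io := id) (io' := io)
      (idinj Z) (injS _ ZD) vG (a := c') (b := c)) => //.
      by rewrite imid.
    by move=> v /cc' ->.
  have [a' [x [a'S gx aa']]] := tr _ _ _ SD aS; have [b' [x' [b'F gx' bb']]] := tr _ _ _ FD bF.
  have xx' : x = x'.
    apply: ginj; last by rewrite gx gx'.
      by exists S => //; apply/convP; exists a'.
    by exists F => //; apply/convP; exists b'.
  rewrite -xx' in b'F; have ab' := bary_uniq cD SD FD a'S b'F.
  have [_ a'S0 _] := a'S; have [_ b'F0 _] := b'F; have [_ aS0 _] := aS; have [_ bF0 _] := bF.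
  have key Z1 Z2 c1 c2 c1' c2' : Z1 \in D -> Z2 \in D ->
      (forall v, v \in Z1 -> c1' v = c1 (io v)) -> (forall v, v \in Z2 -> c2' v = c2 (io v)) ->
      c1' =1 c2' -> (forall v, v \notin Z2 -> c2' v = 0) ->
      (forall u, u \notin (io @` Z2)%fset -> c2 u = 0) ->
      forall v, v \in Z1 -> c1 (io v) = c2 (io v) :> R.
    move=> Z1D Z2D E1 E2 E12 z2' z2 v vZ1; rewrite -E1 // E12.
    have [vZ2|vZ2] := boolP (v \in Z2); first by rewrite E2.
    rewrite z2' // z2 // (mem_imfset_in inj) //; first exact: sub_cover.
    exact: subD vZ1.
  move=> u; have [/imfsetP[v /= vS ->]|uS] := boolP (u \in (io @` S)%fset).
    exact: (key S F a b a' b').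
  have [/imfsetP[v /= vF ->]|uF] := boolP (u \in (io @` F)%fset).
    by apply/esym; apply: (key F S b a b' a') => // w; rewrite ab'.
  by rewrite aS0 // bF0.
- exact: inj.
- by move=> v vD; rewrite wt_geometric //; case: (ioP v vD).
- move=> F /inD'[S SD ->]; apply/fsubsetP => _ /imfsetP[v /= vS ->].
  by rewrite in_imfset //; exact: subD vS.
move=> S SV; apply/idP/idP => [SD|/inD'[F FD SF]]; first by apply/inD'; exists S.
by rewrite (imfset_inj_in inj SV (sub_cover _ FD) SF).
Qed.

End ImageRealization.

(** * Construction of the common sequence *)

Section CommonRefinement.
Variables (R : realType) (T T' : choiceType) (n m : nat).
Variables (W : nat -> wcomplex T) (W' : nat -> wcomplex T').
Variables (D : {fset {fset 'rV[rat]_n}}) (io : T -> 'rV[rat]_n).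
Variables (D' : {fset {fset 'rV[rat]_m}}) (io' : T' -> 'rV[rat]_m).
Hypotheses (sW' : stellar W') (rD' : realization R (W' 0%N) D' io').
Hypotheses (Dcube : (support R D `<=` cube R n)%classic).
Hypotheses (D'cube : (support R D' `<=` cube R m)%classic).

Local Notation P := (orbit_support R W D io).
Local Notation Q := (orbit_support R W' D' io').

Let Pcube i x : P i x -> cube R n x.
Proof. by move=> /(orbit_support_le (leq0n i)); exact: Dcube. Qed.

Let Qcube j y : Q j y -> cube R m y.
Proof. by move=> /(orbit_support_le (leq0n j)); exact: D'cube. Qed.

Lemma fcover_realization_at j : fcover (realization_at R W' D' io' j).1 != fset0.
Proof.
have [_ _ cov _ _] := realization_atP sW' rD' j; have [/fset0Pn[t tV] _ _ _] := sW'.1 j.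
rewrite -[fcover _]/(complex_vertices _) -cov; apply/fset0Pn.
by eexists; apply/in_imfset; exact: tV.
Qed.

Lemma common_stellar (g : 'I_n -> mcNaughton R m) (h : 'I_m -> mcNaughton R n) :
  orbit_equivalence W W' D io D' io' g h ->
  exists W'' : nat -> wcomplex 'rV[rat]_m, stellar W'' /\
    exists (E : {fset {fset 'rV[rat]_n}}) (rho : 'rV[rat]_m -> 'rV[rat]_n)
      (E' : {fset {fset 'rV[rat]_m}}) (rho' : 'rV[rat]_m -> 'rV[rat]_m),
    [/\ realization R (W'' 0%N) E rho /\ realization R (W'' 0%N) E' rho',
      (support R E `<=` cube R n)%classic, (support R E' `<=` cube R m)%classic,
      confluent (orbit R W'' E rho) (orbit R W D io) &
      confluent (orbit R W'' E' rho') (orbit R W' D' io')].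
Proof.
move=> [[i0 gh] [j0 hg] gQP hPQ].
(* The construction starts at the term [j0], on which [tuple_map h] undoes [tuple_map g]. *)
pose Theta k := (realization_at R W' D' io' (j0 + k)).1.
have cTheta k : regular_complex R (Theta k) by case: (realization_atP sW' rD' (j0 + k)).
have nTheta k : fcover (Theta k) != fset0 by exact: fcover_realization_at.
have ThetaE k : support R (Theta k) = Q (j0 + k)%N by [].
have hg0 y : support R (Theta 0%N) y -> tuple_map h (tuple_map g y) = y.
  by rewrite ThetaE addn0 => Qy; apply: hg => //; exact: Qcube Qy.
have Tcube : (support R (Theta 0%N) `<=` cube R m)%classic.
  by move=> y; exact: Qcube.
have [N bN GH] := tuple_map_unimodular (cTheta 0%N) Tcube hg0.
have [cN supN _] := blowups_complex bN (cTheta 0%N).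
have nN : fcover N != fset0.
  by apply: (support_fcover (R := R)); rewrite supN; exact: fcover_support.
(* Only the support of a stage is prescribed; its simplexes are those left by the earlier
   refinements. *)
pose Inv k E := [/\ regular_complex R E, fcover E != fset0 &
  support R E = support R (Theta k)].
have next k E : Inv k E -> exists2 E1, chain (@gstep m) E E1 & Inv k.+1 E1.
  move=> [cE nE EE].
  have [|E1 st1 E1E] := gsteps_support cE (cTheta k.+1) (nTheta k.+1).
    by rewrite EE !ThetaE addnS; exact: orbit_supportS.
  exists E1; first exact: gsteps_chain.
  split=> //; last by apply: (support_fcover (R := R)); rewrite E1E; exact: fcover_support.
  by elim: st1 cE {EE nE E1E} => // E2 E3 E4 st _ IH /(gstep_complex st).
have inv0 : Inv 0%N N by split.
have [f [f0 fS fI]] := chain_sequence (@GStay m) next inv0.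
pose W'' j := geometric_wcomplex (f j).
have cf0 : regular_complex R (f 0%N) by rewrite f0.
have nf0 : fcover (f 0%N) != fset0 by rewrite f0.
have sW'' : stellar W'' := gsequence_stellar cf0 nf0 fS.
have r0 := gsequence_realization0 cf0.
have ginj x y : support R (f 0%N) x -> support R (f 0%N) y ->
    tuple_map g x = tuple_map g y -> x = y.
  by rewrite f0 supN => /hg0 xE /hg0 yE gxy; rewrite -xE -yE gxy.
have GH' S : S \in f 0%N -> exists (G : 'M[int]_(m + 1, n + 1)) (H : 'M[int]_(n + 1, m + 1)),
    forall x, conv R S x -> hpoint (tuple_map g x) = hpoint x *m map_mx intr G /\
      hpoint x = hpoint (tuple_map g x) *m map_mx intr H.
  by rewrite f0; exact: GH.
have [E [rho [rE rhoE]]] := image_realization cf0 nf0 ginj GH'.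
have orb t : orbit_support R W'' (f 0%N) id t = support R (f t).
  by rewrite /orbit_support; have [-> _] := gsequence_realization cf0 nf0 fS t.
have orbE t : orbit_support R W'' E rho t = (tuple_map g @` support R (f t))%classic.
  rewrite -orb; apply: (orbit_transport sW'' r0 rE) => [S /GH'[G [H GHx]]|v vV].
    by exists G => x /GHx[].
  exact: rhoE.
have supf t t' : (t <= t')%N -> (support R (f t') `<=` support R (f t))%classic.
  by move=> tt'; rewrite -!orb; exact: orbit_support_le.
exists W''; split=> //; exists E, rho, (f 0%N), id; split=> //.
- move=> y; rewrite -[support R E]/(orbit_support R W'' E rho 0%N) orbE => -[x _ <-].
  exact: tuple_map_cube.
- by rewrite f0 supN.
- split=> [_ [i _ <-]|_ [t _ <-]].
    have [j gj] := gQP i; have [t _ [_ _ fE]] := fI j.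
    exists (orbit_support R W'' E rho t); split; first by exists t.
    rewrite orbE => _ [y ty <-]; rewrite fE ThetaE in ty.
    by apply: gj; [exact: Qcube ty|exact: (orbit_support_le (leq_addl _ _) ty)].
  (* A point [x] of a late term of the first orbit is the image of [tuple_map h x], which lies in
     stage [t]. This stage is reached at a time [t' >= t], so its support is contained in that of
     [f t]. *)
  have [t' tt' [_ _ fE]] := fI t; have [i hi] := hPQ (j0 + t)%N.
  exists (P (maxn i0 i)); split; first by exists (maxn i0 i).
  move=> x Px; have cx := Pcube Px; rewrite orbE; exists (tuple_map h x).
    apply: (supf _ _ tt'); rewrite fE ThetaE; apply: hi => //.
    exact: (orbit_support_le (leq_maxr _ _) Px).
  by apply: gh => //; exact: (orbit_support_le (leq_maxl _ _) Px).
split=> [_ [j _ <-]|_ [t _ <-]].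
  have [t _ [_ _ fE]] := fI j.
  exists (orbit_support R W'' (f 0%N) id t); split; first by exists t.
  by rewrite orb fE ThetaE; apply: orbit_support_le; exact: leq_addl.
have [t' tt' [_ _ fE]] := fI t; exists (Q (j0 + t)%N); split; first by exists (j0 + t)%N.
by rewrite orb -ThetaE -fE; exact: supf.
Qed.

End CommonRefinement.

Lemma iso_strongly_equivalent (R : realType) (T T' : choiceType)
    (W : nat -> wcomplex T) (W' : nat -> wcomplex T') :
  stellar W -> stellar W' ->
  unital_liso (stellar_group R W) (stellar_group R W') ->
  exists (T'' : choiceType) (W'' : nat -> wcomplex T''),
    stellar W'' /\ strongly_equivalent R W'' W /\ strongly_equivalent R W'' W'.
Proof.
move=> sW sW' iso.
have rC := canonical_realization R (sW.1 0%N); have rC' := canonical_realization R (sW'.1 0%N).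
have Cc := @canonical_cube R _ _ (sW.1 0%N); have C'c := @canonical_cube R _ _ (sW'.1 0%N).
have [||g [h eqv]] := iso_equivalence _ _ Cc C'c iso.
- by move=> i; case: (realization_atP sW rC i).
- by move=> i; case: (realization_atP sW' rC' i).
have [W'' [sW'' [E [rho [E' [rho' [[rE rE'] Ec E'c conf conf']]]]]]] :=
  common_stellar sW' rC' Cc C'c eqv.
exists _, W''; split=> //; split.
  by exists _, E, rho, (canonical_complex (W 0%N)), (canonical_map (W 0%N)).
by exists _, E', rho', (canonical_complex (W' 0%N)), (canonical_map (W' 0%N)).
Qed.

Theorem theorem6p3 (R : realType) (T T' : choiceType)
    (W : nat -> wcomplex T) (W' : nat -> wcomplex T')
    (hW : stellar W) (hW' : stellar W') :
  unital_liso (stellar_group R W) (stellar_group R W') <->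
  exists (T'' : choiceType) (W'' : nat -> wcomplex T''),
    stellar W'' /\
    strongly_equivalent R W'' W /\
    strongly_equivalent R W'' W'.
Proof.
split; first exact: iso_strongly_equivalent.
move=> [T'' [W'' [hW'' [eqW eqW']]]].
apply: unital_liso_trans (strongly_equivalent_iso hW'' hW' eqW').
exact: unital_liso_sym (strongly_equivalent_iso hW'' hW eqW).
Qed.
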